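(* Let $\Omega\subset\mathbb{R}^N$ satisfy $(D)$ $\Omega$ is open and bounded, and for every $x\in\Omega$ and $s\in[-1,1]$ we have $(sx_1,x_2,\dots,x_N)\in\Omega$. Let $J:\mathbb{R}^N\setminus\{0\}\to[0,\infty)$ be a measurable, even function ($J(-z)=J(z)$) satisfying $(J1)$ $\int_{\mathbb{R}^N\setminus B_1(0)}J(z)\,dz+\int_{B_1(0)}|z|^2J(z)\,dz<\infty$ and $\int_{\mathbb{R}^N}J(z)\,dz=\infty$; $(J2)'$ for all $z'\in\mathbb{R}^{N-1}$, $s,t\in\mathbb{R}$ with $|s|\le|t|$ and $(s,z')\ne0$ we have $J(s,z')\ge J(t,z')$; moreover, there is $r_0>0$ such that $J(s,z')>J(t,z')$ for all $z'\in\mathbb{R}^{N-1}$ and $s,t\in\mathbb{R}$ with $|z'|\le r_0$, $|s|<|t|\le r_0$ and $(s,z')\neq0$. Let $f$ satisfy $(F1)$ $f:\Omega\times\mathbb{R}\to\mathbb{R}$ is a Carathéodory function such that for every bounded set $K\subset\mathbb{R}$ there exists $L=L(K)>0$ with $\sup_{x\in\Omega}|f(x,u)-f(x,v)|\le L|u-v|$ for all $u,v\in K$; $(F2)$ for every $u\in\mathbb{R}$, $x\in\Omega$ and $s\in[-1,1]$ we have $f(sx_1,x_2,\dots,x_N,u)\ge f(x,u)$. Then every solution $u\in L^\infty(\Omega)\cap\mathcal{D}(\Omega)$ of $$(P)\qquad Iu=f(x,u)\ \text{ in }\Omega,\qquad u=0\ \text{ on }\mathbb{R}^N\setminus\Omega$$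 which is positive a.e. in $\Omega$ is symmetric in $x_1$ and strictly decreasing in $|x_1|$ on $\Omega$. Consequently, it satisfies $\operatorname{ess\,inf}_Ku>0$ for every compact set $K\subset\Omega$.
   Context: Functions are identified when they agree almost everywhere. For $J$ as in the claim, put $$\mathcal{J}(u,v)=\frac12\int_{\mathbb{R}^N}\int_{\mathbb{R}^N}(u(x)-u(y))(v(x)-v(y))J(x-y)\,dx\,dy,$$ $$\mathcal{D}(\Omega)=\{u:\mathbb{R}^N\to\mathbb{R}\text{ measurable}:\ \mathcal{J}(u,u)<\infty,\ u\equiv0\text{ on }\mathbb{R}^N\setminus\Omega\}.$$ $L^2(\Omega)$, $L^\infty(\Omega)$ are identified with the spaces of the corresponding functions on $\mathbb{R}^N$ vanishing on $\mathbb{R}^N\setminus\Omega$. $I$ is the self-adjoint operator on $L^2(\Omega)$ associated with $\mathcal{J}$; only the following weak notion of solution is used: $u\in\mathcal{D}(\Omega)$ is a solution of $(P)$ if for every $\varphi\in\mathcal{D}(\Omega)$ the integral $\int_\Omega f(x,u(x))\varphi(x)\,dx$ exists and $\mathcal{J}(u,\varphi)=\int_\Omega f(x,u(x))\varphi(x)\,dx$. Carathéodory: $f(\cdot,u)$ is measurable for every $u\in\mathbb{R}$ and $f(x,\cdot)$ is continuous for a.e. $x\in\Omega$. For measurable $u:\Omega\to\mathbb{R}$ with $\Omega$ satisfying $(D)$ (such functions being extended by $0$ outside $\Omega$): $u$ is symmetric in $x_1$ if $u(-x_1,x')=u(x_1,x')$ for a.e. $x=(x_1,x')\in\Omega$;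 $u$ is strictly decreasing in $|x_1|$ if for every $\lambda\in\mathbb{R}\setminus\{0\}$ and every compact set $K\subset\{x\in\Omega: x_1/\lambda>1\}$ we have $\operatorname{ess\,inf}_{x\in K}[u(2\lambda-x_1,x_2,\dots,x_N)-u(x)]>0$. The essential infimum over a null set is $+\infty$. *)

(* Defs.v *)
From HB Require Import structures.
From mathcomp Require Import all_boot all_order all_algebra.
From mathcomp Require Import all_classical all_reals all_analysis ess_sup_inf.

Set Implicit Arguments.
Unset Strict Implicit.
Unset Printing Implicit Defensive.

Import Order.TTheory GRing.Theory Num.Theory.
Import numFieldNormedType.Exports.

Local Open Scope classical_set_scope.
Local Open Scope ring_scope.

Definition hd (R : realType) (n : nat) (x : 'rV[R]_n.+1) : R := x ord0 ord0.

Definition tl (R : realType) (n : nat) (x : 'rV[R]_n.+1) : 'rV[R]_n :=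
  rsubmx (x : 'rV[R]_(1 + n)).

Definition cons_rV (R : realType) (n : nat) (t : R) (y : 'rV[R]_n) :
    'rV[R]_n.+1 :=
  row_mx (t%:M : 'rV[R]_1) y.

(* The norm that the library puts on matrices is the maximum norm. *)
Definition enorm (R : realType) (n : nat) (x : 'rV[R]_n) : R :=
  Num.sqrt (\sum_(i < n) x ord0 i ^+ 2).

Section lebesgue_rV.
Variable R : realType.

Definition cylinders (n : nat) : set (set 'rV[R]_n) :=
  \bigcup_(i in [set: 'I_n])
    preimage_set_system setT (fun x : 'rV[R]_n => x ord0 i : measurableTypeR R)
      measurable.

Definition borel_rV (n : nat) := g_sigma_algebraType (@cylinders n).

Lemma measurable_coord (n : nat) (i : 'I_n) :
  measurable_fun [set: borel_rV n]
    (fun x : borel_rV n => (x : 'rV[R]_n) ord0 i : measurableTypeR R).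
Proof.
move=> _ A mA; rewrite setTI; apply: sub_sigma_algebra.
by exists i => //; exists A => //; rewrite setTI.
Qed.

Lemma measurable_to_borel_rV (d : measure_display) (T : measurableType d)
    (n : nat) (f : T -> borel_rV n) :
  (forall i, measurable_fun [set: T]
    (fun x => (f x : 'rV[R]_n) ord0 i : measurableTypeR R)) ->
  measurable_fun [set: T] f.
Proof.
move=> mf; apply: (@measurability _ _ _ (borel_rV n) _ _ (@cylinders n)) => //.
move=> _ [_ [i _ [A mA <-]] <-]; rewrite !setTI.
by have := mf i measurableT A mA; rewrite setTI.
Qed.

Definition pair_rV (n : nat) (p : measurableTypeR R * borel_rV n) :
    borel_rV n.+1 :=
  cons_rV p.1 (p.2 : 'rV[R]_n).

Definition unpair_rV (n : nat) (x : borel_rV n.+1) :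
    measurableTypeR R * borel_rV n :=
  (hd (x : 'rV[R]_n.+1), tl (x : 'rV[R]_n.+1)).

Lemma hd_cons_rV (n : nat) (t : R) (y : 'rV[R]_n) : hd (cons_rV t y) = t.
Proof.
rewrite /hd (_ : ord0 = lshift n (ord0 : 'I_1) :> 'I_(1 + n)); last exact/val_inj.
by apply: (etrans (row_mxEl _ _ _ _)); rewrite mxE eqxx mulr1n.
Qed.

Lemma tl_cons_rV (n : nat) (t : R) (y : 'rV[R]_n) : tl (cons_rV t y) = y.
Proof. by rewrite /tl /cons_rV row_mxKr. Qed.

Lemma cons_rV_lift (n : nat) (t : R) (y : 'rV[R]_n) (i : 'I_n) :
  cons_rV t y ord0 (lift ord0 i) = y ord0 i.
Proof.
rewrite (_ : lift ord0 i = rshift 1 i :> 'I_(1 + n)); last exact/val_inj.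
exact: (row_mxEr _ _ _ _).
Qed.

Lemma cons_hd_tl (n : nat) (x : 'rV[R]_n.+1) : cons_rV (hd x) (tl x) = x.
Proof.
have e : (hd x)%:M = lsubmx (x : 'rV[R]_(1 + n)) :> 'rV[R]_1.
  apply/matrixP => i j; rewrite !ord1 !mxE eqxx mulr1n /hd; congr (x _ _).
  exact/val_inj.
by have h := @hsubmxK R 1 1 n x; rewrite /cons_rV e; refine h.
Qed.

Lemma measurable_pair_rV (n : nat) : measurable_fun setT (@pair_rV n).
Proof.
apply: measurable_to_borel_rV => i; rewrite /pair_rV /cons_rV.
case: (@split_ordP 1 n i) => j ->.
  rewrite ord1 (_ : (fun _ => _) = fst); first exact: measurable_fst.
  apply/funext => p; apply: (etrans (row_mxEl _ _ _ _)).
  by rewrite (ord1 j) mxE eqxx mulr1n.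
rewrite (_ : (fun _ => _) = (fun x : borel_rV n => (x : 'rV_n) ord0 j) \o snd).
  by apply: measurableT_comp; [exact: measurable_coord|exact: measurable_snd].
by apply/funext => p; exact: (row_mxEr _ _ _ _).
Qed.

Lemma measurable_unpair_rV (n : nat) : measurable_fun setT (@unpair_rV n).
Proof.
apply: measurable_fun_pair; first exact: measurable_coord.
apply: measurable_to_borel_rV => i.
rewrite (_ : (fun _ => _) =
  fun x : borel_rV n.+1 => (x : 'rV_n.+1) ord0 (rshift 1 i)).
  exact: measurable_coord.
by apply/funext => x; rewrite mxE.
Qed.

Lemma pair_rVK (n : nat) : cancel (@pair_rV n) (@unpair_rV n).
Proof. by move=> [t y]; rewrite /unpair_rV /pair_rV hd_cons_rV tl_cons_rV. Qed.

Section lebesgue_cons.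
Variables (n : nat) (m : {sigma_finite_measure set (borel_rV n) -> \bar R}).

Definition lebesgue_cons : set (borel_rV n.+1) -> \bar R :=
  pushforward (lebesgue_measure \x m)%E (@pair_rV n).

Let lebesgue_cons0 : lebesgue_cons set0 = 0%E.
Proof. by rewrite /lebesgue_cons /pushforward preimage_set0 measure0. Qed.

Let lebesgue_cons_ge0 A : (0 <= lebesgue_cons A)%E.
Proof. exact: (measure_ge0 (lebesgue_measure \x m)%E). Qed.

Let lebesgue_cons_sigma_additive : semi_sigma_additive lebesgue_cons.
Proof.
pose mf := @isMeasurableFun.Build _ _ _ _ (@pair_rV n) (@measurable_pair_rV n).
pose f : {mfun _ >-> _} := HB.pack (@pair_rV n) mf.
exact: (@measure_semi_sigma_additive _ _ _
  (pushforward (lebesgue_measure \x m)%E f)).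
Qed.

HB.instance Definition _ := isMeasure.Build _ _ _ lebesgue_cons
  lebesgue_cons0 lebesgue_cons_ge0 lebesgue_cons_sigma_additive.

Let lebesgue_cons_sigma_finite : sigma_finite setT lebesgue_cons.
Proof.
have /sigma_finiteP[F [FT ndF mF]] := sigma_finiteT (@lebesgue_measure R).
have /sigma_finiteP[G [GT ndG mG]] := sigma_finiteT m.
exists (fun k => @unpair_rV n @^-1` (F k `*` G k)).
  apply/esym; rewrite -subTset => x _.
  have [i _ Fi] : (\bigcup_i F i) (hd (x : 'rV[R]_n.+1)) by rewrite -FT.
  have [j _ Gj] : (\bigcup_i G i) (tl (x : 'rV[R]_n.+1)) by rewrite -GT.
  exists (maxn i j) => //; split.
  - by move: Fi; exact/subsetPset/ndF/leq_maxl.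
  - by move: Gj; exact/subsetPset/ndG/leq_maxr.
move=> k; have [mFk Fk] := mF k; have [mGk Gk] := mG k; split.
  have := @measurable_unpair_rV n measurableT _ (measurableX mFk mGk).
  by rewrite setTI.
rewrite /lebesgue_cons /pushforward -comp_preimage.
rewrite (_ : _ \o _ = id); last by apply/funext => p /=; rewrite pair_rVK.
by rewrite preimage_id product_measure1E// lte_mul_pinfty// ge0_fin_numE.
Qed.

HB.instance Definition _ := @Measure_isSigmaFinite.Build _ _ _ lebesgue_cons
  lebesgue_cons_sigma_finite.

End lebesgue_cons.

Fixpoint borel_lebesgue (n : nat) :
    {sigma_finite_measure set (borel_rV n) -> \bar R} :=
  match n with
  | 0 => \d_((0 : 'rV[R]_0) : borel_rV 0)
  | k.+1 => lebesgue_cons (borel_lebesgue k)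
  end.

Definition box (n : nat) (A : 'I_n -> set R) : set 'rV[R]_n :=
  [set x | forall i, A i (x ord0 i)].

Lemma measurable_box (n : nat) (A : 'I_n -> set (measurableTypeR R)) :
  (forall i, measurable (A i)) -> measurable (box A : set (borel_rV n)).
Proof.
move=> mA; rewrite (_ : box A = \bigcap_(i in [set: 'I_n])
    (fun x : borel_rV n => (x : 'rV[R]_n) ord0 i) @^-1` A i); last first.
  by apply/seteqP; split=> [x Ax i _|x Ax i]; exact: Ax.
apply: fin_bigcap_measurable => // i _.
by have := @measurable_coord n i measurableT _ (mA i); rewrite setTI.
Qed.

Lemma borel_lebesgue_box (n : nat) (A : 'I_n -> set (measurableTypeR R)) :
  (forall i, measurable (A i)) ->
  borel_lebesgue n (box A) = (\prod_(i < n) lebesgue_measure (A i))%E.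
Proof.
elim: n A => [|n IH] A mA.
  by rewrite big_ord0 /= /dirac indicE mem_set// => -[].
rewrite big_ord_recl -IH//= /lebesgue_cons /pushforward.
rewrite -product_measure1E//; last exact: measurable_box.
congr (product_measure1 _ _ _); apply/seteqP; split=> [[t y] Aty|[t y] [At Ay] i].
- split=> [|i] /=.
    by rewrite -(hd_cons_rV t y); exact: (Aty ord0).
  by rewrite -(cons_rV_lift t y); exact: (Aty (lift ord0 i)).
- case: (unliftP ord0 i) => [j ->|->].
    by rewrite [X in A _ X](cons_rV_lift t y); exact: Ay.
  by rewrite [X in A _ X](hd_cons_rV t y); exact: At.
Qed.

(* R^n with the sigma-algebra of Lebesgue measurable sets, i.e. the sets that
   are Caratheodory measurable for the outer measure of [borel_lebesgue n]. *)
Definition lebesgue_rV (n : nat) :=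
  caratheodory_type (borel_lebesgue n)^*%mu.

Definition lebesgue (n : nat) : {measure set (lebesgue_rV n) -> \bar R} :=
  @completed_measure_extension _ _ _ (borel_lebesgue n).

Lemma lebesgue_borelE (n : nat) (A : set (borel_rV n)) :
  measurable A -> lebesgue n A = borel_lebesgue n A.
Proof. exact: measurable_mu_extE. Qed.

End lebesgue_rV.
Arguments lebesgue {R} n.

Section problem.
Variables (R : realType) (n : nat).
Local Notation RN := 'rV[R]_n.+1.
Local Notation LN := (lebesgue_rV R n.+1).
Local Notation mu := (@lebesgue R n.+1).
Implicit Types (Omega K : set RN) (J u v : RN -> R) (f : RN -> R -> R).

Definition condD Omega :=
  [/\ open Omega, bounded_set Omega &
      forall (x : RN) (s : R), Omega x -> -1 <= s <= 1 ->
        Omega (cons_rV (s * hd x) (tl x))].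

(* J is a total function below, but [J 0] is never constrained, and it does not
   contribute to any integral. *)
Definition even_kernel J :=
  [/\ measurable_fun ([set~ 0] : set LN) J,
      forall z : RN, z != 0 -> 0 <= J z &
      forall z : RN, z != 0 -> J (- z) = J z].

Definition unit_ball : set RN := [set z | enorm z < 1].

Definition condJ1 J :=
  (\int[mu]_(z in ~` unit_ball) (J z)%:E +
   \int[mu]_(z in unit_ball) (enorm (z : RN) ^+ 2 * J z)%:E < +oo)%E /\
  (\int[mu]_(z in [set~ 0%R]) (J z)%:E = +oo)%E.

Definition condJ2' J :=
  (forall (z' : 'rV[R]_n) (s t : R), `|s| <= `|t| -> cons_rV s z' != 0 ->
     J (cons_rV t z') <= J (cons_rV s z')) /\
  exists2 r0 : R, 0 < r0 &
    forall (z' : 'rV[R]_n) (s t : R), enorm z' <= r0 -> `|s| < `|t| ->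
      `|t| <= r0 -> cons_rV s z' != 0 ->
      J (cons_rV t z') < J (cons_rV s z').

Definition caratheodory_fun Omega f :=
  (forall a : R, measurable_fun (Omega : set LN) (f ^~ a)) /\
  {ae mu, forall x, Omega x -> continuous (f x)}.

Definition condF1 Omega f :=
  caratheodory_fun Omega f /\
  forall B : set R, bounded_set B -> exists2 L : R, 0 < L &
    forall a b : R, B a -> B b -> forall x : RN, Omega x ->
      `|f x a - f x b| <= L * `|a - b|.

Definition condF2 Omega f :=
  forall (a : R) (x : RN) (s : R), Omega x -> -1 <= s <= 1 ->
    f x a <= f (cons_rV (s * hd x) (tl x)) a.

Definition Jform J u v : \bar R :=
  ((2^-1)%:E * \int[mu]_y \int[mu]_x
    ((u x - u y) * (v x - v y) * J ((x : RN) - (y : RN)))%:E)%E.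

Definition form_domain J Omega u :=
  [/\ measurable_fun [set: LN] u, (Jform J u u < +oo)%E &
      {ae mu, forall x, ~ Omega x -> u x = 0}].

Definition solution J Omega f u :=
  form_domain J Omega u /\
  forall phi : RN -> R, form_domain J Omega phi ->
    mu.-integrable Omega (fun x => (f x (u x) * phi x)%:E) /\
    Jform J u phi = (\int[mu]_(x in Omega) (f x (u x) * phi x)%:E)%E.

(* Equals +oo when K is negligible. *)
Definition ess_inf_on K (g : RN -> R) : \bar R :=
  ess_inf mu (fun x => if x \in K then (g x)%:E else +oo%E).

Definition symmetric_x1 Omega u :=
  {ae mu, forall x, Omega x -> u (cons_rV (- hd x) (tl x)) = u x}.

Definition strictly_decreasing_abs_x1 Omega u :=
  forall lambda : R, lambda != 0 -> forall K, compact K ->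
    K `<=` [set x | Omega x /\ 1 < hd x / lambda] ->
    (0 < ess_inf_on K
           (fun x => (u (cons_rV (2 * lambda - hd x) (tl x)) - u x)%R))%E.

End problem.

(* Main.v *)
From HB Require Import structures.
From mathcomp Require Import all_boot all_order all_algebra.
From mathcomp Require Import all_classical all_reals all_analysis.
From mathcomp Require Import measurable_realfun ess_sup_inf.
From mathcomp Require Import ring lra.
Require Import Defs.

Set Implicit Arguments.
Unset Strict Implicit.
Unset Printing Implicit Defensive.

Import Order.TTheory GRing.Theory Num.Theory.
Import numFieldNormedType.Exports.

Local Open Scope classical_set_scope.
Local Open Scope ring_scope.

(** The proof is a variational version of the method of moving planes. Write
    r_l for the reflection in the hyperplane x_1 = l, H for the half-space
    x_1 > l, and w = u o r_l - u. The shape of Omega, the monotonicity (F2) and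
    the Lipschitz bound (F1) turn the equation into the linear inequality
      B(w, phi) >= - C int |w| phi
    for l > 0 and test functions phi >= 0 supported in the cap of Omega inside
    H, where B is (twice) the energy form. The claim is that w >= 0 on H for
    every l > 0 ([good_all]).

    Everything rests on one inequality for functions v that are odd under r_l.
    Test with phi = 1_H v^- and average the integrand of the double integral over
    the four points obtained by reflecting either variable: since the kernel
    prefers pairs on the same side of the hyperplane,
      B(v, phi) + B(phi, phi)
        + int_H int_H phi(x) v^+(y) (J(x - y) - J(x - r_l y)) dx dy <= 0
    ([form_neg_half]). Two maximum principles follow.
    - Weak form. The kernel has infinite mass, so B(phi, phi) dominates any
      multiple of int phi^2 when phi lives on a sufficiently small set
      ([poincare]). Hence w >= 0 on H as soon as the set where this fails is
      small ([weak_maximum_principle]).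
    - Strong form. If w >= 0 on H, the inequality is applied to w - eps G with G
      an odd bump around x0. The price of G is a multiple of eps, while the double
      integral is bounded below by a fixed multiple of int phi, unless w vanishes
      on H near x0. So w is bounded below by a positive constant near x0. The
      alternative is excluded by looking at rightmost points where it occurs:
      slightly further right one leaves Omega, where w = u o r_l is positive
      ([strong_maximum_principle]).

    The plane then moves in from infinity. The set of l for which w >= 0 is closed
    because translations are continuous in L^1, and it is open to the left
    because, w being locally bounded away from 0, the set where the inequality
    fails for a slightly smaller l has small measure. Letting l decrease to 0, for
    u and for its mirror image, gives the symmetry; the strong maximum principle
    at each l and a compactness argument give the strict monotonicity; and the
    lower bound for u on compact sets follows since u(r_l x) >= u(r_l x) - u(x).

    All of this is carried out for Borel functions, for which products and
    iterated integrals behave well. The passage from Lebesgue to Borel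
    measurability replaces u and J by versions that agree almost everywhere; the
    nonlinearity enters only through the integrable functions f(x, u(x)) phi(x),
    each of which has a Borel version of its own. *)

(** * The completion of a sigma-finite measure *)

(** Turns unions over rationals or pairs of them into unions over nat, where
    countable additivity is stated. *)
Lemma bigcup_countType (I : countType) (T : Type) (F : I -> set T) :
  \bigcup_i F i =
  \bigcup_(k : nat) (if unpickle k is Some i then F i else set0).
Proof.
apply/seteqP; split => [x [q _ Fq]|x [k _]]; last first.
  by case: unpickle => // q Fq; exists q.
by exists (pickle q) => //; rewrite pickleK.
Qed.

Section completion.
Context d (T : measurableType d) (R : realType).
Variable m : {sigma_finite_measure set T -> \bar R}.
Local Notation C := (caratheodory_type m^*%mu).
Local Notation mc := (@completed_measure_extension _ _ _ m).
Local Open Scope ereal_scope.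

Lemma measurable_completion (A : set T) : measurable A -> measurable (A : set C).
Proof. by move=> mA; apply: sub_caratheodory; exact: sub_sigma_algebra. Qed.

Lemma completionE (A : set T) : measurable A -> mc A = m A.
Proof. exact: measurable_mu_extE. Qed.

(** The outer measure is an infimum over Borel coverings, attained by
    intersecting a minimising sequence of them. *)
Lemma outer_hull (A : set T) : (m^*)%mu A < +oo ->
  exists B, [/\ measurable B, A `<=` B & m B = (m^*)%mu A].
Proof.
move=> Aoo.
have Afin : (m^*)%mu A \is a fin_num by rewrite ge0_fin_numE// mu_ext_ge0.
have /choice[B HB] : forall k : nat, exists B, [/\ measurable B, A `<=` B &
    m B <= (m^*)%mu A + k.+1%:R^-1%:E].
  move=> k; have k0 : (0 < k.+1%:R^-1 :> R)%R by rewrite invr_gt0.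
  have [_ [F [mF AF] <-] Flt] := lb_ereal_inf_adherent k0 Afin.
  exists (\bigcup_i F i); split => //; first exact: bigcup_measurable.
  apply: (le_trans _ (ltW Flt)).
  by apply: measure_sigma_subadditive => //; exact: bigcup_measurable.
have mI : measurable (\bigcap_k B k).
  by apply: bigcap_measurable => // k _; case: (HB k).
have AI : A `<=` \bigcap_k B k by move=> x Ax k _; case: (HB k) => _ + _; exact.
exists (\bigcap_k B k); split=> //; apply/eqP; rewrite eq_le; apply/andP; split.
  apply/lee_addgt0Pr => e e0.
  have [k ke] : exists k : nat, (k.+1%:R^-1 < e)%R.
    by exists (Num.truncn e^-1); rewrite invf_plt ?posrE// truncnS_gt.
  case: (HB k) => mB AB Ble.
  apply: (le_trans (le_measure _ _ _ (@bigcap_inf _ _ k _ _ _))) => //.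
  - by rewrite inE.
  - by rewrite inE.
  - by apply: (le_trans Ble); rewrite leeD2l// lee_fin ltW.
by rewrite -(measurable_mu_extE m mI); exact: le_mu_ext.
Qed.

(** A null set of the completion has outer measure 0, so its hull is a Borel null
    set: both measures have the same almost everywhere statements. *)
Lemma completion_negligible (A : set T) :
  mc.-negligible (A : set C) <-> m.-negligible A.
Proof.
split=> [[B [mB B0 AB]]|[B [mB B0 AB]]].
  have Boo : (m^*)%mu B < +oo by rewrite [X in X < _]B0.
  have [G [mG BG GE]] := outer_hull Boo.
  by exists G; split => //; [rewrite GE; exact: B0|exact: subset_trans BG].
exists B; split => //; first exact: measurable_completion.
by rewrite completionE.
Qed.

Lemma completion_ae (P : T -> Prop) :
  {ae mc, forall x, P x} <-> {ae m, forall x, P x}.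
Proof. exact: completion_negligible. Qed.

(** On a piece A of finite measure, the difference between a hull of A and A is
    null, hence contained in a Borel null set. *)
Lemma caratheodory_borel_core (A : set T) : measurable (A : set C) ->
  exists B N, [/\ measurable B, measurable N, m N = 0 &
    forall x, ~ N x -> A x <-> B x].
Proof.
move=> mA; have /sigma_finiteP[F [FT _ mF]] := sigma_finiteT m.
have /choice[B HB] : forall k, exists B : set T * set T,
    [/\ measurable B.1, measurable B.2, m B.2 = 0 &
    forall x, ~ B.2 x -> (A `&` F k) x <-> B.1 x].
  move=> k; have [mFk Fk] := mF k.
  have mAF : measurable (A `&` F k : set C).
    by apply: measurableI => //; exact: measurable_completion.
  have AFoo : mc (A `&` F k) < +oo.
    apply: (le_lt_trans _ Fk); apply: (le_trans (le_mu_ext m (@subIsetr _ A (F k)))).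
    by rewrite measurable_mu_extE.
  have [G [mG AG GE]] := outer_hull AFoo.
  have mGA : measurable (G `\` (A `&` F k) : set C).
    by apply: measurableD => //; exact: measurable_completion.
  have GA0 : mc (G `\` (A `&` F k)) = 0.
    have GE' : mc G = mc (A `&` F k) := etrans (completionE mG) GE.
    have GAE : mc (G `\` (A `&` F k)) = mc G - mc (A `&` F k).
      have Goo : mc G < +oo by rewrite GE'.
      rewrite -[X in _ = _ - mc X](setIidr AG).
      exact: (@measureD _ C _ mc G (A `&` F k) (measurable_completion mG) mAF).
    by rewrite GAE GE' subee// ge0_fin_numE ?mu_ext_ge0.
  have : m.-negligible (G `\` (A `&` F k)).
    by apply/completion_negligible; exists (G `\` (A `&` F k)); split.
  case=> N [mN N0 GN]; exists (G, N); split => //= x nN; split => [/AG//|Gx].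
  by apply: contrapT => nA; apply: nN; apply: GN.
exists (\bigcup_k (B k).1), (\bigcup_k (B k).2); split.
- by apply: bigcup_measurable => k _; case: (HB k).
- by apply: bigcup_measurable => k _; case: (HB k).
- apply/negligibleP; first by apply: bigcup_measurable => k _; case: (HB k).
  apply: negligible_bigcup => k; case: (HB k) => _ m2 m0 _.
  exact/negligibleP.
- move=> x nN; have nNk k : ~ (B k).2 x by move=> Bk; apply: nN; exists k.
  split=> [Ax|[k _ Bk]].
    have : setT x by [].
    rewrite FT => -[k _ Fk]; exists k => //.
    by case: (HB k) => _ _ _ /(_ _ (nNk k))[+ _]; apply; split.
  by case: (HB k) => _ _ _ /(_ _ (nNk k))[_ /(_ Bk)[]].
Qed.

(** It suffices to correct the countably many level sets at rational heights; the
    exceptional sets are collected in N. *)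
Lemma completion_measurable_fun (g : C -> R) : measurable_fun setT g ->
  exists N : set T, [/\ measurable N, m N = 0 &
    measurable_fun [set: T] (fun x => if x \in N then 0%R else g x)].
Proof.
move=> mg.
have /choice[B HB] : forall q : rat, exists B : set T * set T,
    [/\ measurable B.1, measurable B.2, m B.2 = 0 &
    forall x, ~ B.2 x -> (ratr q < g x)%R <-> B.1 x].
  move=> q; have mq : measurable (g @^-1` `]ratr q, +oo[ : set C).
    by rewrite -[X in measurable X]setTI; apply: mg => //; exact: measurable_itv.
  have [B [N [mB mN N0 BN]]] := caratheodory_borel_core mq.
  exists (B, N); split => //= x /BN <-; rewrite /= in_itv/= andbT.
  exact: iff_refl.
have bigT := @bigcupT_measurable_rat _ T.
pose N := \bigcup_q (B q).2.
have mN : measurable N by apply: bigT => q; case: (HB q).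
exists N; split => //.
  apply/negligibleP => //; rewrite /N bigcup_countType.
  apply: negligible_bigcup => k; case: unpickle => [q|].
    by case: (HB q) => _ m2 m0 _; exact/negligibleP.
  exact: negligible_set0.
apply: (measurability _ (RGenOInfty.measurableE R)) => //.
move=> _ [_ [a ->] <-]; rewrite setTI.
rewrite (_ : _ @^-1` _ = (~` N `&` \bigcup_(q : rat)
   (if (a < ratr q)%R then (B q).1 else set0)) `|`
   (if (a < 0)%R then N else set0)).
  apply: measurableU; last by case: ifP.
  apply: measurableI; first exact: measurableC.
  by apply: bigT => q; case: ifP => // _; case: (HB q).
apply/seteqP; split => x /=; rewrite in_itv/= andbT.
  case: ifPn => [xN a0|xN agx]; first by right; rewrite a0; move: xN; rewrite inE.
  left; rewrite notin_setE in xN; split => //.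
  have [q] := @rat_in_itvoo R _ _ agx; rewrite in_itv/= => /andP[aq qg].
  exists q => //; rewrite aq; case: (HB q) => _ _ _ /(_ x)[|+ _]; last exact.
  by move=> Bx; apply: xN; exists q.
move=> [[nN [q _]]|].
  case: ifPn => // aq Bq; rewrite ifF; last by apply/negbTE; rewrite notin_setE.
  apply: (lt_trans aq); case: (HB q) => _ _ _ /(_ x)[|_]; last exact.
  by move=> Bx; apply: nN; exists q.
by case: ifPn => // a0 Nx; rewrite ifT// inE.
Qed.

End completion.

(** * Maps that preserve a measure *)

Section preserving.
Context d (T : measurableType d) (R : realType).
Variables (m : {measure set T -> \bar R}) (f : T -> T).
Hypothesis mf : measurable_fun [set: T] f.
Hypothesis mfE : forall A, measurable A -> m (f @^-1` A) = m A.
Local Open Scope ereal_scope.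

Lemma ge0_preserving_integral (F : T -> \bar R) :
  measurable_fun [set: T] F -> (forall x, 0 <= F x) ->
  \int[m]_x F (f x) = \int[m]_x F x.
Proof.
move=> mF F0; transitivity (\int[pushforward m f]_x F x).
  by rewrite ge0_integral_pushforward.
apply: eq_measure_integral => A mA _; exact: mfE.
Qed.

Lemma preserving_integral (F : T -> \bar R) :
  measurable_fun [set: T] F -> \int[m]_x F (f x) = \int[m]_x F x.
Proof.
move=> mF; rewrite integralE [RHS]integralE; congr (_ - _).
  rewrite -[RHS]ge0_preserving_integral.
  - by apply: eq_integral => x _; rewrite !funeposE.
  - exact: measurable_funepos.
  - by move=> x; exact: funepos_ge0.
rewrite -[RHS]ge0_preserving_integral.
- by apply: eq_integral => x _; rewrite !funenegE.
- exact: measurable_funeneg.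
- by move=> x; exact: funeneg_ge0.
Qed.

Lemma preserving_integrable (F : T -> \bar R) :
  m.-integrable [set: T] F -> m.-integrable [set: T] (F \o f).
Proof.
move=> iF; have mF := measurable_int _ iF; apply/integrableP; split.
  exact: measurableT_comp.
have := @ge0_preserving_integral (abse \o F).
rewrite /= => ->//; last exact: measurableT_comp.
by case/integrableP : iF.
Qed.

Lemma preserving_negligible A : m.-negligible A -> m.-negligible (f @^-1` A).
Proof.
move=> [B [mB B0 AB]]; exists (f @^-1` B); split.
- by rewrite -[X in measurable X]setTI; exact: mf.
- by rewrite mfE.
- by move=> x; exact: AB.
Qed.

Lemma preserving_ae (P : T -> Prop) :
  {ae m, forall x, P x} -> {ae m, forall x, P (f x)}.
Proof. exact: preserving_negligible. Qed.

End preserving.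

(** * Borel sets and Lebesgue measure of R^n *)

Section borel_space.
Variables (R : realType) (n : nat).
Local Notation V := 'rV[R]_n.
Local Notation X := (borel_rV R n).
Local Notation m := (borel_lebesgue R n).
Implicit Types (x y : V) (e : R).

Lemma ball_rVP x e y : 0 < e ->
  ball x e y <-> forall i, `|x ord0 i - y ord0 i| < e.
Proof.
move=> e0; split=> [[_ xy] i|xy]; first exact: xy.
by split => // i j; rewrite (ord1 i); exact: xy.
Qed.

(** Countably many boxes with rational centres generate the topology; this is
    what makes open sets Borel for the product sigma-algebra. *)
Definition rat_ball (p : 'rV[rat]_n * nat) : set V :=
  [set y | forall i, `|ratr (p.1 ord0 i) - y ord0 i| < p.2.+1%:R^-1].

Lemma measurable_rat_ball p : measurable (rat_ball p : set X).
Proof.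
rewrite (_ : rat_ball p = box (fun i => `]ratr (p.1 ord0 i) - p.2.+1%:R^-1,
   ratr (p.1 ord0 i) + p.2.+1%:R^-1[%classic)).
  by apply: measurable_box => i; exact: measurable_itv.
apply/seteqP; split => y Hy i; move: (Hy i); rewrite /= in_itv/= ltr_distlC.
  by [].
by [].
Qed.

Lemma small_rat_ball x e : 0 < e ->
  exists p, rat_ball p x /\ rat_ball p `<=` ball x e.
Proof.
move=> e0; pose k := Num.truncn (2 / e).
have kp : 0 < k.+1%:R^-1 :> R by rewrite invr_gt0.
have ke : k.+1%:R^-1 + k.+1%:R^-1 < e.
  have : k.+1%:R^-1 < (2 / e)^-1.
    by rewrite ltf_pV2 ?posrE ?divr_gt0 ?ltr0n// truncnS_gt.
  by rewrite invf_div; move: (k.+1%:R^-1) => t ht; lra.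
have /choice[q Hq] : forall i, exists q : rat, `|ratr q - x ord0 i| < k.+1%:R^-1.
  move=> i; have : x ord0 i - k.+1%:R^-1 < x ord0 i by rewrite ltrBlDr ltrDl.
  move=> /rat_in_itvoo[q]; rewrite in_itv/= => /andP[q1 q2]; exists q.
  by move: q1 q2; rewrite ltr_norml; move: (k.+1%:R^-1) => t *; apply/andP; split; lra.
exists (\row_i q i, k); split => [i|y Hy]; first by rewrite mxE.
apply/ball_rVP => // i; have := Hy i; have := Hq i; rewrite /= mxE => h1 h2.
move: h1 h2 ke; move: (k.+1%:R^-1) => t; rewrite !ltr_norml.
by move=> /andP[? ?] /andP[? ?] ?; apply/andP; split; lra.
Qed.

Lemma open_measurable_rV (U : set V) : open U -> measurable (U : set X).
Proof.
move=> oU; rewrite (_ : U = \bigcup_p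
    (if `[< rat_ball p `<=` U >] then rat_ball p else set0)).
  rewrite bigcup_countType; apply: bigcup_measurable => k _.
  case: unpickle => // p; case: ifP => // _; exact: measurable_rat_ball.
apply/seteqP; split => [x Ux|x [p _]]; last first.
  by case: ifP => // /asboolP pU /pU.
have /nbhs_ballP[e /= e0 xeU] := open_nbhs_nbhs (conj oU Ux).
have [p [px pe]] := small_rat_ball x e0; exists p => //.
by rewrite ifT//; apply/asboolP; exact: subset_trans pe xeU.
Qed.

(** The Lindelof property of R^n: each point of U has a rational box around it
    in which A is null, and there are only countably many such boxes. *)
Lemma negligible_locally (A U : set V) :
  (forall x, U x -> exists2 e, 0 < e & m.-negligible (ball x e `&` A)) ->
  m.-negligible (U `&` A).
Proof.
move=> UA.
suff UAB : U `&` A `<=` \bigcup_p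
    (if `[< m.-negligible (rat_ball p `&` A) >] then rat_ball p `&` A else set0).
  apply: (@negligibleS _ X R m _ _ UAB); rewrite bigcup_countType.
  apply: negligible_bigcup => k; case: unpickle => [p|].
    by case: ifPn => [/asboolP//|_]; exact: negligible_set0.
  exact: negligible_set0.
move=> x [Ux Ax]; have [e e0 xe] := UA x Ux.
have [p [px pe]] := small_rat_ball x e0; exists p => //.
rewrite ifT//; apply/asboolP; apply: negligibleS xe.
exact: setSI.
Qed.

Lemma measurable_rV_boxes : @measurable _ X =
  <<s [set box A | A in [set A : 'I_n -> set (measurableTypeR R) |
       forall i, measurable (A i)]] >>.
Proof.
apply/seteqP; split; last first.
  apply: smallest_sub; first exact: sigma_algebra_measurable.
  by move=> _ [A mA <-]; exact: measurable_box.
apply: smallest_sub; first exact: smallest_sigma_algebra.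
move=> _ [i _ [A mA <-]]; apply: sub_sigma_algebra.
exists (fun j => if j == i then A else setT) => [j|] /=.
  by case: ifP => // _; exact: measurableT.
apply/seteqP; split => [x /(_ i)|x /=]; first by rewrite eqxx setTI.
by move=> [_ Ax] j; case: ifPn => // /eqP ->.
Qed.

Definition cube (c : R) : set V := [set x | forall i, `|x ord0 i| < c].

Lemma cubeE c : cube c = box (fun=> `]-c, c[%classic).
Proof.
by apply/seteqP; split => x Hx i; have := Hx i; rewrite /= in_itv/= ltr_norml.
Qed.

Lemma measurable_cube c : measurable (cube c : set X).
Proof. by rewrite cubeE; apply: measurable_box => i; exact: measurable_itv. Qed.

Local Open Scope ereal_scope.
Lemma cube_fin c : m (cube c) < +oo.
Proof.
rewrite cubeE borel_lebesgue_box => [|i]; last exact: measurable_itv.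
suff : \prod_(i < n) lebesgue_measure (`](- c)%R, c[%classic : set R) \is a fin_num.
  by rewrite ge0_fin_numE// prode_ge0.
elim/big_ind : _ => //; first exact: fin_numM.
move=> i _; rewrite lebesgue_measure_itv/=; case: ifP => // _.
Qed.

Lemma lebesgue_measure_affine (a s : R) (A : set (measurableTypeR R)) :
  `|s|%R = 1%R -> measurable A ->
  lebesgue_measure ((fun t => a + s * t)%R @^-1` A) = lebesgue_measure A.
Proof.
move=> s1 mA; pose g : measurableTypeR R -> measurableTypeR R := fun t => (a + s * t)%R.
have mg : measurable_fun setT g.
  by apply: measurable_funD => //; exact: measurable_funM.
pose mf := @isMeasurableFun.Build _ _ _ _ g mg.
pose h : {mfun _ >-> _} := HB.pack g mf.
rewrite -[RHS](_ : pushforward lebesgue_measure h A = _)//.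
apply/esym; apply: lebesgue_measure_unique => // _ [[b c] _ <-].
rewrite /pushforward/= lebesgue_measure_itv/= lte_fin.
rewrite /pushforward /g; have [s0|s0] := leP 0%R s.
  have {s0}-> : s = 1%R by rewrite -s1 ger0_norm.
  rewrite (_ : _ @^-1` _ = `](b - a)%R, (c - a)%R]%classic); last first.
    by apply/seteqP; split => t /=; rewrite !in_itv/= => /andP[? ?]; apply/andP; split; lra.
  rewrite lebesgue_measure_itv/= lte_fin ltrD2r; case: ifP => // _.
  by rewrite -!EFinB; congr (_%:E); ring.
have {s0}-> : s = (- 1)%R by rewrite -s1 ltr0_norm// opprK.
rewrite (_ : _ @^-1` _ = `[(a - c)%R, (a - b)%R[%classic); last first.
  by apply/seteqP; split => t /=; rewrite !in_itv/= => /andP[? ?]; apply/andP; split; lra.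
rewrite lebesgue_measure_itv/= lte_fin ltrD2l ltrN2; case: ifP => // _.
by rewrite -!EFinB; congr (_%:E); ring.
Qed.

(** The coordinatewise affine maps, of which translations, reflections and
    x |-> - x are all instances, so that measure preservation is proved once. *)
Definition saff (a s x : V) : V := \row_i (a ord0 i + s ord0 i * x ord0 i)%R.

Lemma measurable_saff (a s : V) : measurable_fun [set: X] (saff a s : X -> X).
Proof.
apply: measurable_to_borel_rV => i.
rewrite (_ : (fun _ => _) =
    (fun x : X => (a ord0 i + s ord0 i * (x : V) ord0 i)%R)); last first.
  by apply/funext => x; rewrite mxE.
apply: measurable_funD => //; apply: measurable_funM => //.
exact: measurable_coord.
Qed.

(** Lebesgue measure is determined by its values on boxes, whose edges are
    mapped by one-dimensional isometries. *)
Lemma saff_preserving (a s : V) : (forall i, `|s ord0 i|%R = 1%R) ->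
  forall A : set X, measurable A -> m (saff a s @^-1` A) = m A.
Proof.
move=> s1 A mA.
pose mf := @isMeasurableFun.Build _ _ _ _ _ (measurable_saff a s).
pose h : {mfun X >-> X} := HB.pack (saff a s : X -> X) mf.
rewrite -[LHS](_ : pushforward m h A = _)//; apply/esym.
apply: (measure_unique _ (fun k => cube k%:R : set X) measurable_rV_boxes);
  last exact: mA.
- move=> _ _ [B mB <-] [C mC <-]; exists (fun i => B i `&` C i).
    by move=> i; apply: measurableI; [exact: mB|exact: mC].
  apply/seteqP; split => [x BC|x [Bx Cx] i]; last by split.
  by split => i; case: (BC i).
- by move=> k; exists (fun=> `](- k%:R)%R, k%:R%R[%classic); [move=> i; exact: measurable_itv|rewrite cubeE].
- apply/seteqP; split => // x _.
  exists (Num.truncn (\sum_i `|x ord0 i|)%R).+1 => // i.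
  by rewrite (le_lt_trans _ (truncnS_gt _))// (bigD1 i)//= lerDl sumr_ge0.
- move=> _ [B mB <-]; transitivity
    (m (box (fun i => (fun t => a ord0 i + s ord0 i * t)%R @^-1` B i))).
    rewrite [LHS]borel_lebesgue_box// [RHS]borel_lebesgue_box; last first.
      move=> i; rewrite -[X in measurable X]setTI.
      have mg : measurable_fun setT (fun t : measurableTypeR R =>
          (a ord0 i + s ord0 i * t)%R : measurableTypeR R).
        by apply: measurable_funD => //; exact: measurable_funM.
      by apply: mg => //; exact: mB.
    by apply: eq_bigr => i _; apply/esym/lebesgue_measure_affine => //; exact: mB.
  apply: (congr1 m).
  by apply/seteqP; split => x Hx i; have := Hx i; rewrite /= mxE.
- by move=> k; exact: cube_fin.
Qed.

End borel_space.

(** * Continuity of translations in L^1 *)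

Section translation_continuity.
Variables (R : realType) (n : nat).
Local Notation V := 'rV[R]_n.
Local Notation X := (borel_rV R n).
Local Notation m := (borel_lebesgue R n).
Local Open Scope ereal_scope.

Lemma ecvg0_lt (v : nat -> \bar R) (e : R) : v @ \oo --> 0 -> (0 < e)%R ->
  exists k, forall j, (k <= j)%N -> v j < e%:E.
Proof.
move=> v0 e0; have : nbhs (0 : \bar R) [set y | y < e%:E].
  by apply: open_nbhs_nbhs; split; [exact: open_ereal_lt_ereal|rewrite /= lte_fin].
by move=> /v0 [k _ kP]; exists k => j; exact: kP.
Qed.

Lemma saff_shift (a x : V) : saff a (const_mx 1%R) x = (x + a)%R.
Proof. by apply/rowP => i; rewrite !mxE mul1r addrC. Qed.

Lemma measurable_shift (a : V) : measurable_fun [set: X] (fun x : X => (x + a)%R : X).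
Proof.
have := measurable_saff a (const_mx 1%R); rewrite (_ : saff _ _ = +%R^~ a)//.
by apply/funext => x; rewrite saff_shift.
Qed.

Lemma shift_preserving (a : V) (A : set X) :
  measurable A -> m ((fun x : X => (x + a)%R : X) @^-1` A) = m A.
Proof.
move=> mA; rewrite -[RHS](@saff_preserving _ _ a (const_mx 1%R))//; last first.
  by move=> i; rewrite mxE normr1.
by congr (m _); apply/seteqP; split => x /=; rewrite saff_shift.
Qed.

Lemma ge0_integral_shift (a : V) (F : X -> \bar R) :
  measurable_fun [set: X] F -> (forall x, 0 <= F x) ->
  \int[m]_x F (x + a)%R = \int[m]_x F x.
Proof.
exact: (ge0_preserving_integral (measurable_shift a) (@shift_preserving a)).
Qed.

Definition translation_continuous (F : X -> R) :=
  measurable_fun [set: X] F /\ forall e : R, (0 < e)%R -> exists2 d : R, (0 < d)%R &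
    forall a : V, (forall i, `|a ord0 i| < d)%R ->
    \int[m]_x `|F (x + a)%R - F x|%:E <= e%:E.

Lemma measurable_shift_fun (F : X -> R) (a : V) :
  measurable_fun [set: X] F -> measurable_fun [set: X] (fun x => F (x + a)%R).
Proof. by move=> mF; exact: (measurableT_comp mF (measurable_shift a)). Qed.

Lemma le_int (d : measure_display) (T : measurableType d)
    (mu : {measure set T -> \bar R}) (F G : T -> R) :
  measurable_fun [set: T] F -> measurable_fun [set: T] G ->
  (forall x, 0 <= F x)%R -> (forall x, F x <= G x)%R ->
  \int[mu]_x (F x)%:E <= \int[mu]_x (G x)%:E.
Proof.
move=> mF mG F0 FG; apply: ge0_le_integral => //.
- by move=> x _; rewrite lee_fin.
- exact/measurable_EFinP.
- exact/measurable_EFinP.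
- by move=> x _; rewrite lee_fin.
Qed.

Lemma intD (d : measure_display) (T : measurableType d)
    (mu : {measure set T -> \bar R}) (F G : T -> R) :
  measurable_fun [set: T] F -> measurable_fun [set: T] G ->
  (forall x, 0 <= F x)%R -> (forall x, 0 <= G x)%R ->
  \int[mu]_x (F x + G x)%:E = \int[mu]_x (F x)%:E + \int[mu]_x (G x)%:E.
Proof.
move=> mF mG F0 G0; under eq_integral do rewrite EFinD.
apply: ge0_integralD => //.
- by move=> x _; rewrite lee_fin.
- exact/measurable_EFinP.
- by move=> x _; rewrite lee_fin.
- exact/measurable_EFinP.
Qed.

(** A three-epsilon argument: translation is an isometry of L^1. *)
Lemma translation_continuous_lim (F : X -> R) : measurable_fun [set: X] F ->
  (forall e : R, (0 < e)%R -> exists2 G, translation_continuous G &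
     \int[m]_x `|F x - G x|%:E <= e%:E) ->
  translation_continuous F.
Proof.
move=> mF FG; split => // e e0.
have e3 : (0 < e / 3)%R by rewrite divr_gt0.
have [G [mG tG] FGe] := FG _ e3; have [d d0 Gd] := tG _ e3.
exists d => // a ad.
have mFa := measurable_shift_fun a mF; have mGa := measurable_shift_fun a mG.
have mn (f g : X -> R) : measurable_fun [set: X] f -> measurable_fun [set: X] g ->
    measurable_fun [set: X] (fun x => `|f x - g x|%R).
  by move=> mf mg; apply: measurableT_comp => //; exact: measurable_funB.
apply: (@le_trans _ _ (\int[m]_x (`|F (x + a)%R - G (x + a)%R| +
    (`|G (x + a)%R - G x| + `|F x - G x|))%:E)).
  apply: le_int => [||//|x]; first exact: mn.
    by apply: measurable_funD; [exact: mn|apply: measurable_funD; exact: mn].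
  rewrite (_ : (F (x + a) - F x = (F (x + a) - G (x + a)) +
     ((G (x + a) - G x) - (F x - G x)))%R); last by ring.
  by apply: (le_trans (ler_normD _ _)); rewrite lerD2l ler_normB.
rewrite intD//; [|exact: mn|by apply: measurable_funD; exact: mn].
rewrite intD//; [|exact: mn|exact: mn].
rewrite (ge0_integral_shift a (F := fun x => `|F x - G x|%:E))//; last first.
  by apply/measurable_EFinP; exact: mn.
rewrite (_ : e = (e / 3 + (e / 3 + e / 3))%R); last by lra.
by rewrite !EFinD leeD// leeD// Gd.
Qed.

Lemma translation_continuousD (F G : X -> R) :
  translation_continuous F -> translation_continuous G ->
  translation_continuous (fun x => F x + G x)%R.
Proof.
move=> [mF tF] [mG tG]; split; first exact: measurable_funD.
move=> e e0; have e2 : (0 < e / 2)%R by rewrite divr_gt0.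
have [d d0 Fd] := tF _ e2; have [d' d'0 Gd] := tG _ e2.
exists (Num.min d d'); first by rewrite lt_min d0.
move=> a ad.
have mFa := measurable_shift_fun a mF; have mGa := measurable_shift_fun a mG.
have mn (f g : X -> R) : measurable_fun [set: X] f -> measurable_fun [set: X] g ->
    measurable_fun [set: X] (fun x => `|f x - g x|%R).
  by move=> mf mg; apply: measurableT_comp => //; exact: measurable_funB.
apply: (@le_trans _ _ (\int[m]_x (`|F (x + a)%R - F x| +
    `|G (x + a)%R - G x|)%:E)).
  apply: le_int => [||//|x]; first by apply: mn; exact: measurable_funD.
    by apply: measurable_funD; exact: mn.
  rewrite (_ : (F (x + a) + G (x + a) - (F x + G x) = (F (x + a) - F x) +
     (G (x + a) - G x))%R); last by ring.
  exact: ler_normD.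
rewrite intD//; [|exact: mn|exact: mn].
rewrite (_ : e = (e / 2 + e / 2)%R); last by lra.
rewrite EFinD leeD// (Fd, Gd)// => i; move: (ad i); rewrite lt_min => /andP[//].
Qed.

Lemma translation_continuousZ (c : R) (F : X -> R) :
  translation_continuous F -> translation_continuous (fun x => c * F x)%R.
Proof.
move=> [mF tF]; split; first exact: measurable_funM.
move=> e e0; have ec : (0 < e / (`|c| + 1))%R.
  by rewrite divr_gt0// ltr_wpDl.
have [d d0 Fd] := tF _ ec; exists d => // a /Fd h.
have mn : measurable_fun [set: X] (fun x => `|F (x + a)%R - F x|%R).
  apply: measurableT_comp => //; apply: measurable_funB => //.
  exact: measurable_shift_fun.
rewrite (eq_integral (fun x : X => (`|c|)%R%:E * (`|F (x + a)%R - F x|)%R%:E)); last first.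
  by move=> x _; rewrite -EFinM -normrM mulrBr.
rewrite ge0_integralZl//; last exact/measurable_EFinP.
apply: (le_trans (lee_wpmul2l _ h)); first by rewrite lee_fin.
rewrite -EFinM lee_fin mulrA ler_pdivrMr ?ltr_wpDl//.
by rewrite mulrC ler_pM2l// lerDl.
Qed.

(** A point of the symmetric difference of U and U - a lies, up to a translation
    by a, in U within distance |a| of the complement of U; these layers decrease
    to the empty set. *)
Lemma translation_continuous_open (U : set V) : open U -> m U < +oo ->
  translation_continuous (\1_U).
Proof.
move=> oU Uoo; have mU := open_measurable_rV oU.
split; first exact: measurable_indic.
move=> e e0.
pose W (k : nat) : set V := \bigcup_(y in ~` U) ball y k.+1%:R^-1.
pose D k : set X := U `&` W k.
have oW k : open (W k) by apply: bigcup_open => y _; exact: ball_open.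
have mD k : measurable (D k).
  by apply: measurableI => //; exact: open_measurable_rV.
have D0 : \bigcap_k D k = set0.
  apply/seteqP; split => // x Dx; have [Ux _] := Dx 0%N I.
  have /nbhs_ballP[r /= r0 xrU] := open_nbhs_nbhs (conj oU Ux).
  have [_ [y /= nUy]] := Dx (Num.truncn r^-1) I.
  move=> yx; apply: nUy; apply: xrU; apply: ball_sym; apply: le_ball yx.
  by rewrite ltW// invf_plt ?posrE// truncnS_gt.
have niD : nonincreasing_seq D.
  apply/nonincreasing_seqP => k; apply/subsetPset => x [Ux [y nUy yx]].
  split => //; exists y => //; apply: le_ball yx.
  by rewrite lef_pV2 ?posrE// ler_nat.
have Doo : m (D 0%N) < +oo.
  by apply: le_lt_trans Uoo; apply: le_measure; rewrite ?inE//; exact: subIsetl.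
have mI : measurable (\bigcap_k D k) by rewrite D0.
have := @nonincreasing_cvg_mu _ X _ m D Doo mD mI niD.
rewrite D0 measure0 => cvD.
have e2 : (0 < e / 2)%R by rewrite divr_gt0.
have [k /(_ k (leqnn k)) Dk] := ecvg0_lt cvD e2.
exists k.+1%:R^-1%R => [|a ad]; first by rewrite invr_gt0.
have k0 : (0 < k.+1%:R^-1 :> R)%R by rewrite invr_gt0.
have mDk : measurable_fun [set: X] (\1_(D k) : X -> R) by exact: measurable_indic.
apply: (@le_trans _ _ (\int[m]_x (\1_(D k) (x + a)%R + \1_(D k) x)%:E)).
  apply: le_int => [||//|x].
  - apply: measurableT_comp => //; apply: measurable_funB; last exact: measurable_indic.
    by apply: measurable_shift_fun; exact: measurable_indic.
  - by apply: measurable_funD => //; exact: measurable_shift_fun.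
  - rewrite !indicE.
    have [xaU|xaU] := boolP (_ \in U); have [xU|xU] := boolP (_ \in U).
    + by rewrite subrr normr0 addr_ge0.
    + rewrite subr0 normr1 (_ : (x + a)%R \in D k) ?lerDl//.
      rewrite inE; split; first by rewrite inE in xaU.
      exists x; first by rewrite notin_setE in xU.
      by apply/ball_rVP => // i; rewrite !mxE opprD addrA subrr add0r normrN.
    + rewrite sub0r normrN normr1 (_ : x \in D k) ?lerDr//.
      rewrite inE; split; first by rewrite inE in xU.
      exists (x + a)%R; first by rewrite notin_setE in xaU.
      by apply/ball_rVP => // i; rewrite !mxE addrAC subrr add0r.
    + by rewrite subrr normr0 addr_ge0.
rewrite intD//; last exact: measurable_shift_fun.
rewrite (ge0_integral_shift a (F := fun x => (\1_(D k) x)%:E)) => [||x]; last 2 first.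
- exact/measurable_EFinP.
- by rewrite lee_fin.
rewrite integral_indic// setIT (_ : e = (e / 2 + e / 2)%R); last by lra.
by rewrite EFinD leeD// ltW.
Qed.

Lemma indicDl (A B : set X) : A `<=` B -> forall x, \1_(B `\` A) x = (\1_B x + (-1) * \1_A x :> R)%R.
Proof.
move=> AB x; rewrite !indicE in_setD; have [xA|xA] := boolP (x \in A).
  have -> : x \in B by rewrite inE; apply: AB; rewrite inE in xA.
  by rewrite /= mulr1 subrr.
by rewrite andbT mulr0 addr0.
Qed.

(** Open sets are stable under intersection and generate the Borel sets, and the
    property passes to differences and monotone limits: Dynkin's lemma. *)
Lemma translation_continuous_set (c : R) (A : set X) : (0 < c)%R -> measurable A ->
  translation_continuous (\1_(A `&` cube c)).
Proof.
move=> c0; pose H := [set A : set X | measurable A /\ translation_continuous (\1_(A `&` cube c))].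
pose G := [set U : set V | open U].
have sG : @measurable _ X `<=` <<s G >>.
  apply: smallest_sub; first exact: smallest_sigma_algebra.
  move=> _ [i _ [B mB <-]]; rewrite setTI.
  pose p (x : g_sigma_algebraType G) : measurableTypeR R := (x : V) ord0 i.
  have mp : measurable_fun setT p.
    apply: (measurability _ (RGenOpens.measurableE R)) => //.
    move=> _ [_ [b [d ->]] <-]; rewrite setTI; apply: sub_sigma_algebra.
    apply: (@open_comp _ _ (fun x : V => x ord0 i)); last exact: itv_open.
    by move=> x _; exact: coord_continuous.
  by have := mp measurableT B mB; rewrite setTI.
have ocube : open (cube c : set V).
  rewrite (_ : cube c = ball (0%R : V) c); first exact: ball_open.
  apply/seteqP; split => x; first by move=> xc; apply/ball_rVP => // i; rewrite mxE sub0r normrN.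
  by move/ball_rVP => /(_ c0) xc i; have := xc i; rewrite mxE sub0r normrN.
move=> mA; suff : H A by case.
move/sG : mA; apply: (@lambda_system_subset _ G _ setT) => //.
- by move=> U W; exact: openI.
- split => //.
  + split; first exact: measurableT.
    rewrite setTI; apply: translation_continuous_open => //; exact: cube_fin.
  + move=> B C CB [mB tB] [mC tC]; split; first exact: measurableD.
    rewrite (_ : \1_ _ = fun x => (\1_(B `&` cube c) x + (-1) * \1_(C `&` cube c) x)%R).
      by apply: translation_continuousD => //; exact: translation_continuousZ.
    apply/funext => x; rewrite -indicDl; last exact: setSI.
    congr (\1_ _ x); apply/seteqP; split => y /=; tauto.
  + suff K (F : nat -> set X) : nondecreasing_seq F -> (forall i, H (F i)) ->
        H (\bigcup_i F i) by exact: K.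
    move=> ndF HF; split; first by apply: bigcup_measurable => k _; case: (HF k).
    have mF k : measurable (F k) by case: (HF k).
    have mU : measurable (\bigcup_k F k) by exact: bigcup_measurable.
    have sF k : F k `&` cube c `<=` \bigcup_k F k `&` cube c.
      by apply: setSI; exact: bigcup_sup.
    apply: translation_continuous_lim => [|e e0].
      by apply: measurable_indic; apply: measurableI => //; exact: measurable_cube.
    pose D k : set X := (\bigcup_k F k `&` cube c) `\` (F k `&` cube c).
    have mD k : measurable (D k).
      by apply: measurableD; apply: measurableI => //; exact: measurable_cube.
    have D0 : \bigcap_k D k = set0.
      apply/seteqP; split => // x Dx; have [[[k _ Fk] xc] _] := Dx 0%N I.
      by have [_] := Dx k I; apply.
    have niD : nonincreasing_seq D.
      apply/nonincreasing_seqP => k; apply/subsetPset => x [Ux nF]; split => //.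
      move=> [Fkx cx]; apply: nF; split => //; move: Fkx; apply/subsetPset.
      by apply: ndF.
    have Doo : m (D 0%N) < +oo.
      apply: le_lt_trans (cube_fin _ c); apply: le_measure; rewrite ?inE//.
      + exact: measurable_cube.
      + by move=> x [[]].
    have mI : measurable (\bigcap_k D k) by rewrite D0.
    have := @nonincreasing_cvg_mu _ X _ m D Doo mD mI niD.
    rewrite D0 measure0 => cvD.
    have [k /(_ k (leqnn k)) Dk] := ecvg0_lt cvD e0.
    exists (\1_(F k `&` cube c)); first by case: (HF k).
    rewrite (eq_integral (fun x : X => (\1_(D k) x)%:E)); last first.
      move=> x _; rewrite /D indicDl// mulN1r ger0_norm// subr_ge0.
      by rewrite !indicE ler_nat; case: (boolP (x \in F k `&` _)) => // /set_mem/sF/mem_set ->.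
    by rewrite integral_indic// setIT ltW.
- move=> U oU; split; first exact: open_measurable_rV.
  apply: translation_continuous_open; first exact: openI.
  apply: le_lt_trans (cube_fin _ c); apply: le_measure; rewrite ?inE.
  + by apply: measurableI; [exact: open_measurable_rV|exact: measurable_cube].
  + exact: measurable_cube.
  + exact: subIsetr.
Qed.

Import HBSimple.

Lemma translation_continuous_integrable (c : R) (F : X -> R) :
  (0 < c)%R -> m.-integrable [set: X] (EFin \o F) ->
  (forall x, ~ cube c x -> F x = 0%R) -> translation_continuous F.
Proof.
move=> c0 iF F0; have mF : measurable_fun [set: X] F.
  by apply/measurable_EFinP; exact: measurable_int iF.
apply: translation_continuous_lim => // e e0.
have [g [ig _ gF]] := approximation_sfun_integrable measurableT iF.
have [k /(_ k (leqnn k)) Fk] := ecvg0_lt gF e0.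
have mg : measurable_fun [set: X] (g k) by [].
have mc : measurable_fun [set: X] (\1_(cube c) : X -> R).
  by apply: measurable_indic; exact: measurable_cube.
exists (fun x => g k x * \1_(cube c) x)%R.
  rewrite (_ : (fun x => _) = (fun x => \sum_(y <- finmap.enum_fset (fset_set (range (g k))))
     (y * \1_((g k) @^-1` [set y] `&` cube c) x))%R).
    elim: (finmap.enum_fset _) => [|y s ih].
      rewrite (_ : (fun x => _) = fun x => (0 * \1_(setT `&` cube c) x)%R).
        by apply: translation_continuousZ; exact: translation_continuous_set.
      by apply/funext => x; rewrite big_nil mul0r.
    rewrite (_ : (fun x => _) = fun x => (y * \1_((g k) @^-1` [set y] `&` cube c) x +
        \sum_(y <- s) (y * \1_((g k) @^-1` [set y] `&` cube c) x))%R).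
      apply: translation_continuousD => //; apply: translation_continuousZ.
      by apply: translation_continuous_set => //; exact: measurable_sfunP.
    by apply/funext => x; rewrite big_cons.
  apply/funext => x; rewrite fimfunE fsbig_finite//= mulr_suml.
  by apply: eq_bigr => y _; rewrite indicI/= mulrA.
apply: le_trans (ltW Fk); apply: ge0_le_integral => //.
- by apply/measurable_EFinP; apply: measurableT_comp => //; apply: measurable_funB => //; exact: measurable_funM.
- by apply/measurable_EFinP; apply: measurableT_comp => //; exact: measurable_funB.
- move=> x _; rewrite lee_fin indicE; case: (boolP (x \in _)) => xc; first by rewrite mulr1.
  by rewrite mulr0 F0 ?subr0 ?normr0//; rewrite notin_setE in xc.
Qed.

End translation_continuity.

(** * Integrals of real-valued functions *)

Section real_integral.
Context d (T : measurableType d) (R : realType).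
Variable mu : {measure set T -> \bar R}.
Implicit Types F G : T -> R.

Lemma ae_and (A B : T -> Prop) : {ae mu, forall x, A x} ->
  {ae mu, forall x, B x} -> {ae mu, forall x, A x /\ B x}.
Proof. by apply: filterS2 => x. Qed.

Definition intble F := mu.-integrable [set: T] (EFin \o F).

Lemma intble_measurable F : intble F -> measurable_fun [set: T] F.
Proof. by move=> iF; apply/measurable_EFinP; exact: measurable_int iF. Qed.

Lemma intbleD F G : intble F -> intble G -> intble (fun x => F x + G x).
Proof. by move=> iF iG; exact: (integrableD measurableT iF iG). Qed.

Lemma intbleZ c F : intble F -> intble (fun x => c * F x).
Proof. by move=> iF; exact: (integrableZl measurableT c iF). Qed.

Lemma intbleN F : intble F -> intble (fun x => - F x).
Proof. by move=> /(intbleZ (-1)); under [X in intble X]eq_fun do rewrite mulN1r. Qed.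

Lemma intbleB F G : intble F -> intble G -> intble (fun x => F x - G x).
Proof. by move=> iF /intbleN; exact: intbleD. Qed.

Lemma EFin_Rintegral F : intble F ->
  ((\int[mu]_x F x)%:E = \int[mu]_x (F x)%:E)%E.
Proof. by move=> iF; rewrite /Rintegral fineK//; exact: integrable_fin_num. Qed.

Lemma ge0_intble F : measurable_fun [set: T] F -> (forall x, 0 <= F x) ->
  (\int[mu]_x (F x)%:E < +oo)%E -> intble F.
Proof.
move=> mF F0 Foo; apply/integrableP; split; first exact/measurable_EFinP.
by under eq_integral do rewrite /= ger0_norm//.
Qed.

Lemma intble_ge0_fin F : intble F -> (forall x, 0 <= F x) ->
  (\int[mu]_x (F x)%:E < +oo)%E.
Proof.
by move=> /integrableP[_ +] F0; under eq_integral do rewrite /= ger0_norm//.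
Qed.

Lemma le_intble F G : measurable_fun [set: T] F -> (forall x, `|F x| <= G x) ->
  intble G -> intble F.
Proof.
move=> mF FG; apply: le_integrable => //; first exact/measurable_EFinP.
by move=> x _; rewrite lee_fin (le_trans (FG x))// ler_norm.
Qed.

Lemma Rintegral_ae_eq F G : intble F -> intble G ->
  {ae mu, forall x, F x = G x} -> \int[mu]_x F x = \int[mu]_x G x.
Proof.
move=> iF iG FG; congr fine; apply: ae_eq_integral => //.
- exact: measurable_int iF.
- exact: measurable_int iG.
- by apply: filterS FG => x /= -> _.
Qed.

Lemma intble_norm F : intble F -> intble (fun x => `|F x|).
Proof.
move=> iF; have mF := intble_measurable iF; apply/integrableP; split.
  by apply/measurable_EFinP; exact: measurableT_comp.
under eq_integral do rewrite /= normr_id.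
by case/integrableP : iF.
Qed.

Lemma le_Rintegral_ae F G : intble F -> intble G ->
  {ae mu, forall x, F x <= G x} -> \int[mu]_x F x <= \int[mu]_x G x.
Proof.
move=> iF iG FG; have mF := intble_measurable iF; have mG := intble_measurable iG.
have iM : intble (fun x => Num.max (F x) (G x)).
  apply: (@le_intble _ (fun x => `|F x| + `|G x|)).
  - exact: measurable_maxr.
  - by move=> x; case: (leP (F x) (G x)) => _; rewrite ?lerDl ?lerDr.
  - by apply: intbleD; exact: intble_norm.
rewrite [leRHS](@Rintegral_ae_eq _ (fun x => Num.max (F x) (G x)))//; last first.
  by apply: filterS FG => x /= ?; apply/esym/max_idPr.
by apply: le_Rintegral => // x _; rewrite le_max lexx.
Qed.

Lemma Rintegral_ge0_ae F : intble F -> {ae mu, forall x, 0 <= F x} ->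
  0 <= \int[mu]_x F x.
Proof.
move=> iF F0; have i0 : intble (fun=> 0) by exact: integrable0.
suff -> : 0 = \int[mu]_x (0 : R) by exact: le_Rintegral_ae.
by rewrite /Rintegral integral0.
Qed.

Lemma Rintegral_eq0_ae F : intble F -> {ae mu, forall x, 0 <= F x} ->
  \int[mu]_x F x <= 0 -> {ae mu, forall x, F x = 0}.
Proof.
move=> iF F0 IF; have iN := intble_norm iF.
have mF : measurable_fun [set: T] (EFin \o F) by exact: measurable_int iF.
have I0 : (\int[mu]_x `|(F x)%:E| = 0)%E.
  rewrite -[LHS](EFin_Rintegral iN); congr (_%:E); apply/eqP.
  rewrite eq_le Rintegral_ge0// andbT; apply: le_trans IF.
  by apply: le_Rintegral_ae => //; apply: filterS F0 => x /ger0_norm ->.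
have := (ae_eq_integral_abs mu measurableT mF).1 I0.
by apply: filterS => x /(_ I) [].
Qed.

Variable f : T -> T.
Hypothesis mf : measurable_fun [set: T] f.
Hypothesis mfE : forall A, measurable A -> mu (f @^-1` A) = mu A.

Lemma preserving_intble F : intble F -> intble (F \o f).
Proof. by move=> iF; exact: (preserving_integrable mf mfE iF). Qed.

Lemma preserving_Rintegral F : intble F -> \int[mu]_x F (f x) = \int[mu]_x F x.
Proof.
move=> iF; congr fine; apply: (preserving_integral mf mfE (F := EFin \o F)).
exact: measurable_int iF.
Qed.

End real_integral.

(** * Products of a measure with itself *)

Section product.
Context d (T : measurableType d) (R : realType).
Variable m : {sigma_finite_measure set T -> \bar R}.
Local Notation P := (m \x m)%E.

Lemma ae_fst (Q : T -> Prop) : {ae m, forall x, Q x} -> {ae P, forall z, Q z.1}.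
Proof.
move=> [B [mB B0 QB]]; exists (B `*` setT); split.
- exact: measurableX.
- by rewrite product_measure1E// [X in (X * _)%E]B0 mul0e.
- by move=> z Qz; split => //; exact: QB.
Qed.

Lemma ae_snd (Q : T -> Prop) : {ae m, forall x, Q x} -> {ae P, forall z, Q z.2}.
Proof.
move=> [B [mB B0 QB]]; exists (setT `*` B); split.
- exact: measurableX.
- by rewrite product_measure1E// [X in (_ * X)%E]B0 mule0.
- by move=> z Qz; split => //; exact: QB.
Qed.

Lemma product_preserving (f g : T -> T) :
  measurable_fun [set: T] f -> measurable_fun [set: T] g ->
  (forall A, measurable A -> m (f @^-1` A) = m A) ->
  (forall A, measurable A -> m (g @^-1` A) = m A) ->
  let h := fun z : T * T => (f z.1, g z.2) in
  measurable_fun [set: T * T] h /\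
  forall A, measurable A -> P (h @^-1` A) = P A.
Proof.
move=> mf mg fE gE h.
have mh : measurable_fun [set: T * T] h.
  by apply: measurable_fun_pair; apply: measurableT_comp.
split => // A mA; apply/esym.
pose mh' := @isMeasurableFun.Build _ _ _ _ h mh.
pose k : {mfun (T * T)%type >-> (T * T)%type} := HB.pack h mh'.
rewrite -[RHS](_ : pushforward P k A = _)//.
apply: product_measure_unique => // B C mB mC.
rewrite -(fE _ mB) -(gE _ mC); apply: product_measure1E.
  by rewrite -[X in measurable X]setTI; exact: mf.
by rewrite -[X in measurable X]setTI; exact: mg.
Qed.

End product.

(** * Reflections in the hyperplanes orthogonal to the first axis *)

Section reflections.
Variables (R : realType) (n : nat).
Local Notation V := 'rV[R]_n.+1.
Local Notation X := (borel_rV R n.+1).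
Local Notation m := (borel_lebesgue R n.+1).
Implicit Types x y z : V.

Lemma hdD x y : hd (x + y) = hd x + hd y. Proof. by rewrite /hd mxE. Qed.
Lemma hdN x : hd (- x) = - hd x. Proof. by rewrite /hd mxE. Qed.
Lemma hdB x y : hd (x - y) = hd x - hd y. Proof. by rewrite hdD hdN. Qed.
Lemma tlD x y : tl (x + y) = tl x + tl y.
Proof. by apply/rowP => i; rewrite !mxE. Qed.
Lemma tlN x : tl (- x) = - tl x.
Proof. by apply/rowP => i; rewrite !mxE. Qed.
Lemma tlB x y : tl (x - y) = tl x - tl y. Proof. by rewrite tlD tlN. Qed.

Lemma rV_ext x y : hd x = hd y -> tl x = tl y -> x = y.
Proof. by move=> h t; rewrite -(cons_hd_tl x) -(cons_hd_tl y) h t. Qed.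

Lemma cons_rV_scale x (t : R) : `|t| <= `|hd x| ->
  exists2 s, -1 <= s <= 1 & cons_rV t (tl x) = cons_rV (s * hd x) (tl x).
Proof.
move=> tx; have [hx0|hx0] := eqVneq (hd x) 0.
  move: tx; rewrite hx0 normr0 normr_le0 => /eqP ->; exists 0; last by rewrite mul0r.
  by rewrite lerN10 ler01.
exists (t / hd x); last by rewrite divfK.
by rewrite -ler_norml normrM normfV ler_pdivrMr ?normr_gt0// mul1r.
Qed.

Lemma tl_coord x i : tl x ord0 i = x ord0 (lift ord0 i).
Proof. by rewrite -[in RHS](cons_hd_tl x) cons_rV_lift. Qed.

Definition refl (l : R) x : V := cons_rV (2 * l - hd x) (tl x).

Lemma hd_refl l x : hd (refl l x) = 2 * l - hd x.
Proof. exact: hd_cons_rV. Qed.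
Lemma tl_refl l x : tl (refl l x) = tl x. Proof. exact: tl_cons_rV. Qed.
Definition hdtlE := (hd_refl, tl_refl, hdB, tlB, hdD, tlD, hdN, tlN).

Lemma reflK l : involutive (refl l).
Proof. by move=> x; apply: rV_ext; rewrite !hdtlE//; ring. Qed.

Lemma refl_sub l x y : refl l x - refl l y = refl 0 (x - y).
Proof. by apply: rV_ext; rewrite !hdtlE//; ring. Qed.

Lemma refl_subl l x y : refl l x - y = refl 0 (x - refl l y).
Proof. by apply: rV_ext; rewrite !hdtlE//; ring. Qed.

Lemma refl_shift l k x : refl k x = refl l x + cons_rV (2 * (k - l)) 0.
Proof.
by apply: rV_ext; rewrite !hdtlE ?hd_cons_rV ?tl_cons_rV ?addr0//; ring.
Qed.

Lemma reflE l : refl l = saff (cons_rV (2 * l) 0) (cons_rV (-1) (const_mx 1)).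
Proof.
apply/funext => x; apply/rowP => i; rewrite [RHS]mxE.
case: (unliftP ord0 i) => [k ->|->].
  rewrite /refl !cons_rV_lift tl_coord [X in _ = X + _]mxE.
  by rewrite [X in _ = _ + X * _]mxE add0r mul1r.
rewrite -[LHS]/(hd (refl l x)) -[X in _ = X + _]/(hd (cons_rV (2 * l) 0)).
rewrite -[X in _ = _ + X * _]/(hd (cons_rV (-1) (const_mx 1))) hd_refl !hd_cons_rV.
by rewrite mulN1r.
Qed.

Lemma measurable_refl l : measurable_fun [set: X] (refl l : X -> X).
Proof. by rewrite reflE; exact: measurable_saff. Qed.

Lemma refl_preserving l (A : set X) : measurable A -> m (refl l @^-1` A) = m A.
Proof.
rewrite reflE; apply: saff_preserving => i.
case: (unliftP ord0 i) => [k ->|->]; first by rewrite cons_rV_lift mxE normr1.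
by rewrite -[X in `|X|]/(hd (cons_rV (-1) (const_mx 1))) hd_cons_rV normrN1.
Qed.

Lemma measurable_opp : measurable_fun [set: X] (fun x : X => (- (x : V)) : X).
Proof.
rewrite (_ : (fun x => _) = saff 0 (const_mx (-1))); first exact: measurable_saff.
by apply/funext => x; apply/rowP => i; rewrite !mxE add0r mulN1r.
Qed.

Lemma opp_preserving (A : set X) : measurable A ->
  m ((fun x : X => (- (x : V)) : X) @^-1` A) = m A.
Proof.
rewrite (_ : (fun x => _) = saff 0 (const_mx (-1))).
  by apply: saff_preserving => i; rewrite mxE normrN1.
by apply/funext => x; apply/rowP => i; rewrite !mxE add0r mulN1r.
Qed.

Lemma sub_measurable y : measurable_fun [set: X] (fun x : X => y - (x : V) : X).
Proof.
have := measurableT_comp (measurable_shift y) measurable_opp.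
by congr measurable_fun; apply/funext => x /=; rewrite addrC.
Qed.

Lemma sub_preserving y (A : set X) : measurable A ->
  m ((fun x : X => y - (x : V) : X) @^-1` A) = m A.
Proof.
move=> mA; rewrite -[RHS](shift_preserving y mA) -[RHS]opp_preserving.
  by congr (m _); apply/seteqP; split => x /=; rewrite addrC.
by rewrite -[X in measurable X]setTI; exact: measurable_shift.
Qed.

Lemma measurable_hd : measurable_fun [set: X] (@hd R n : X -> measurableTypeR R).
Proof. exact: measurable_coord. Qed.

Lemma hyperplane_ae (l : R) : {ae m, forall x, hd (x : V) <> l}.
Proof.
exists (box (fun i : 'I_n.+1 => if i == ord0 then [set l] else setT)); split.
- apply: measurable_box => i; case: ifP => _; last exact: measurableT.
  exact: measurable_set1.
- rewrite borel_lebesgue_box; last first.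
    by move=> i; case: ifP => _; [exact: measurable_set1|exact: measurableT].
  by rewrite big_ord_recl eqxx lebesgue_measure_set1 mul0e.
- move=> x /contrapT xl i; case: ifPn => // /eqP ->; exact: xl.
Qed.

Local Notation P := (m \x m)%E.

Lemma measurable_diff : measurable_fun [set: X * X]
  (fun z : X * X => ((z.1 : V) - (z.2 : V))%R : X).
Proof.
apply: measurable_to_borel_rV => i.
rewrite (_ : (fun _ => _) = (fun z : X * X => (z.1 : V) ord0 i - (z.2 : V) ord0 i)).
  apply: measurable_funB.
  - apply: (measurableT_comp (measurable_coord i)); exact: measurable_fst.
  - apply: (measurableT_comp (measurable_coord i)); exact: measurable_snd.
by apply/funext => z; rewrite !mxE.
Qed.

Lemma ae_diff (Q : V -> Prop) : {ae m, forall z, Q z} ->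
  {ae P, forall z : X * X, Q ((z.1 : V) - (z.2 : V))}.
Proof.
move=> [B [mB B0 QB]]; exists ((fun z : X * X => ((z.1 : V) - (z.2 : V)) : X) @^-1` B).
split; last by move=> z; exact: QB.
  by rewrite -[X in measurable X]setTI; exact: measurable_diff.
rewrite /product_measure1 integral0_eq//= => x _.
have -> : xsection ((fun z : X * X => ((z.1 : V) - (z.2 : V)) : X) @^-1` B) x =
    (fun y : X => - (y : V) : X) @^-1` ((fun y : X => (y + x : V) : X) @^-1` B).
  by apply/seteqP; split => y; rewrite /xsection/= inE/= addrC.
rewrite opp_preserving ?shift_preserving//.
by rewrite -[X in measurable X]setTI; exact: measurable_shift.
Qed.

End reflections.

(** * The energy form and its behaviour under reflections *)

Lemma max0P (R : realDomainType) (a : R) :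
  [/\ 0 <= a, Num.max (- a) 0 = 0 & Num.max a 0 = a] \/
  [/\ a < 0, Num.max (- a) 0 = - a & Num.max a 0 = 0].
Proof.
have [a0|a0] := leP 0 a; [left|right]; split => //.
- by apply/max_idPr; rewrite oppr_le0.
- by apply/max_idPl; rewrite oppr_ge0 ltW.
Qed.

Section energy.
Variables (R : realType) (n : nat).
Local Notation V := 'rV[R]_n.+1.
Local Notation X := (borel_rV R n.+1).
Local Notation m := (borel_lebesgue R n.+1).
Local Notation P := (m \x m)%E.
Implicit Types (x y : V) (u v w phi : X -> R).

(** The hypotheses on the kernel, for a Borel version of it. The symmetries hold
    everywhere, so that they can be used inside integrands; the monotonicity holds
    for almost every first argument, which is what a change on a null set
    preserves. The integrals of the kernel near 0 and at infinity are merged. *)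
Record kernel_spec (j : X -> R) (r0 : R) : Prop := KernelSpec {
  kernel_measurable : measurable_fun [set: X] j;
  kernel_ge0 : forall z, 0 <= j z;
  kernel_opp : forall z : V, j (- z) = j z;
  kernel_flip : forall z : V, j (refl 0 z) = j z;
  kernel_mono : {ae m, forall z : V, forall z', tl z' = tl z ->
    `|hd z| <= `|hd z'| -> j z' <= j z};
  kernel_strict : {ae m, forall z : V, forall z', tl z' = tl z ->
    `|hd z| < `|hd z'| -> `|hd z| < r0 -> enorm (tl z) <= r0 -> j z' < j z};
  kernel_levy : (\int[m]_z (Num.min 1 (enorm (z : V) ^+ 2) * j z)%:E < +oo)%E;
  kernel_infinite : (\int[m]_z (j z)%:E = +oo)%E }.

Variables (j : X -> R) (r0 : R).
Hypothesis jP : kernel_spec j r0.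

Definition energy_density u v (z : X * X) : R :=
  (u z.1 - u z.2) * (v z.1 - v z.2) * j ((z.1 : V) - (z.2 : V)).

(** Twice the energy form of the problem. *)
Definition form u v : R := \int[P]_z energy_density u v z.

Definition fin_energy u := measurable_fun [set: X] u /\ intble P (energy_density u u).

Lemma measurable_arg1 u : measurable_fun [set: X] u ->
  measurable_fun [set: X * X] (fun z => u z.1).
Proof. by move=> mu; apply: measurableT_comp => //; exact: measurable_fst. Qed.

Lemma measurable_arg2 u : measurable_fun [set: X] u ->
  measurable_fun [set: X * X] (fun z => u z.2).
Proof. by move=> mu; apply: measurableT_comp => //; exact: measurable_snd. Qed.

Lemma measurable_kernel_diff :
  measurable_fun [set: X * X] (fun z : X * X => j ((z.1 : V) - (z.2 : V))).
Proof.
exact: (measurableT_comp (kernel_measurable jP) (@measurable_diff R n)).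
Qed.

Lemma measurable_energy_density u v : measurable_fun [set: X] u ->
  measurable_fun [set: X] v -> measurable_fun [set: X * X] (energy_density u v).
Proof.
move=> mu mv; apply: measurable_funM; last exact: measurable_kernel_diff.
apply: measurable_funM; apply: measurable_funB.
- exact: measurable_arg1.
- exact: measurable_arg2.
- exact: measurable_arg1.
- exact: measurable_arg2.
Qed.

Lemma energy_density_ge0 u z : 0 <= energy_density u u z.
Proof. by rewrite mulr_ge0 ?(kernel_ge0 jP)// -expr2 sqr_ge0. Qed.

Lemma energy_density_intble u v : fin_energy u -> fin_energy v ->
  intble P (energy_density u v).
Proof.
move=> [mu iu] [mv iv].
apply: (@le_intble _ _ _ _ _ (fun z => energy_density u u z + energy_density v v z)).
- exact: measurable_energy_density.
- move=> z; rewrite /energy_density; have := kernel_ge0 jP ((z.1 : V) - (z.2 : V)).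
  move: (j _) (u _ - _) (v _ - _) => k a b k0.
  rewrite -mulrDl normrM (ger0_norm k0) ler_wpM2r// ler_norml; nra.
- exact: intbleD.
Qed.

Lemma fin_energy_dominated u v w : measurable_fun [set: X] w ->
  fin_energy u -> fin_energy v ->
  (forall x y, (w x - w y) ^+ 2 <= 2 * (u x - u y) ^+ 2 + 2 * (v x - v y) ^+ 2) ->
  fin_energy w.
Proof.
move=> mw [mu iu] [mv iv] le_w; split => //.
apply: (@le_intble _ _ _ _ _
  (fun z => 2 * energy_density u u z + 2 * energy_density v v z)).
- exact: measurable_energy_density.
- move=> z; rewrite ger0_norm ?energy_density_ge0//.
  rewrite /energy_density !mulrA -mulrDl ler_wpM2r ?(kernel_ge0 jP)//.
  by have := le_w z.1 z.2; rewrite !expr2 !mulrA.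
- by apply: intbleD; exact: intbleZ.
Qed.

Lemma fin_energyD u v : fin_energy u -> fin_energy v ->
  fin_energy (fun x => u x + v x).
Proof.
move=> fu fv; apply: (fin_energy_dominated _ fu fv).
  by apply: measurable_funD; [case: fu|case: fv].
move=> x y; rewrite (_ : _ - _ = (u x - u y) + (v x - v y)); last by ring.
by move: (u x - u y) (v x - v y) => a b; have := sqr_ge0 (a - b); rewrite !expr2; lra.
Qed.

Lemma fin_energyZ c u : fin_energy u -> fin_energy (fun x => c * u x).
Proof.
move=> [mu iu]; split; first exact: measurable_funM.
rewrite (_ : energy_density _ _ = fun z => c ^+ 2 * energy_density u u z).
  exact: intbleZ.
by apply/funext => z; rewrite /energy_density; ring.
Qed.

Lemma fin_energyB u v : fin_energy u -> fin_energy v ->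
  fin_energy (fun x => u x - v x).
Proof.
move=> fu /(fin_energyZ (-1)) /(fin_energyD fu); congr fin_energy.
by apply/funext => x; rewrite mulN1r.
Qed.

Lemma formB u v phi : fin_energy u -> fin_energy v -> fin_energy phi ->
  form (fun x => u x - v x) phi = form u phi - form v phi.
Proof.
move=> fu fv fp; rewrite /form -RintegralB//; [|exact: energy_density_intble..].
by apply: eq_Rintegral => z _; rewrite /energy_density; ring.
Qed.

Lemma formZ c u phi : fin_energy u -> fin_energy phi ->
  form (fun x => c * u x) phi = c * form u phi.
Proof.
move=> fu fp; rewrite /form -RintegralZl//; last exact: energy_density_intble.
by apply: eq_Rintegral => z _; rewrite /energy_density; ring.
Qed.

Section reflection_group.
Variable l : R.
Local Notation r := (refl l).
Definition refl1 (z : X * X) : X * X := (r z.1, z.2).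
Definition refl2 (z : X * X) : X * X := (z.1, r z.2).
Definition refl12 (z : X * X) : X * X := (r z.1, r z.2).
Definition sum4 (F : X * X -> R) z := F z + F (refl1 z) + F (refl2 z) + F (refl12 z).

Lemma refl1_preserving : measurable_fun [set: X * X] refl1 /\
  forall A, measurable A -> P (refl1 @^-1` A) = P A.
Proof.
exact: (@product_preserving _ X R m r idfun (@measurable_refl R n l)
  (@measurable_id _ X setT) (@refl_preserving R n l) (fun _ _ => erefl)).
Qed.

Lemma refl2_preserving : measurable_fun [set: X * X] refl2 /\
  forall A, measurable A -> P (refl2 @^-1` A) = P A.
Proof.
exact: (@product_preserving _ X R m idfun r (@measurable_id _ X setT)
  (@measurable_refl R n l) (fun _ _ => erefl) (@refl_preserving R n l)).
Qed.

Lemma refl12_preserving : measurable_fun [set: X * X] refl12 /\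
  forall A, measurable A -> P (refl12 @^-1` A) = P A.
Proof.
exact: (@product_preserving _ X R m r r (@measurable_refl R n l)
  (@measurable_refl R n l) (@refl_preserving R n l) (@refl_preserving R n l)).
Qed.

(** Up to a null set every pair is the image, under reflection of one or both
    variables, of a pair in the half-space. *)
Lemma half_space_ae (Q : X * X -> Prop) :
  (forall z, Q (refl1 z) -> Q z) -> (forall z, Q (refl2 z) -> Q z) ->
  {ae P, forall z, l < hd (z.1 : V) -> l < hd (z.2 : V) -> Q z} ->
  {ae P, forall z, Q z}.
Proof.
move=> Q1 Q2 QH.
have [m1 p1] := refl1_preserving; have [m2 p2] := refl2_preserving.
have [m12 p12] := refl12_preserving.
have Q12 z : Q (refl12 z) -> Q z by move=> ?; apply: Q1; exact: Q2.
have h1 := ae_fst (@hyperplane_ae R n l); have h2 := ae_snd (@hyperplane_ae R n l).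
move: (ae_and (ae_and h1 h2) (ae_and (ae_and QH (preserving_ae m1 p1 QH))
  (ae_and (preserving_ae m2 p2 QH) (preserving_ae m12 p12 QH)))).
apply: filterS => z [[/eqP n1 /eqP n2] [[q0 q1] [q2 q12]]].
rewrite /= !hd_refl in n1 n2 q0 q1 q2 q12.
case: (ltrgtP (hd (z.1 : V)) l) n1 => // h1' _;
  case: (ltrgtP (hd (z.2 : V)) l) n2 => // h2' _.
- by apply: Q12; apply: q12; lra.
- by apply: Q1; apply: q1 => //; lra.
- by apply: Q2; apply: q2 => //; lra.
- exact: q0.
Qed.

Lemma sum4_refl1 (F : X * X -> R) z : sum4 F (refl1 z) = sum4 F z.
Proof.
by case: z => x y; rewrite /sum4 /refl1 /refl2 /refl12/= reflK; ring.
Qed.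

Lemma sum4_refl2 (F : X * X -> R) z : sum4 F (refl2 z) = sum4 F z.
Proof.
by case: z => x y; rewrite /sum4 /refl1 /refl2 /refl12/= reflK; ring.
Qed.

(** The four reflections preserve the product measure, so the integral of F is a
    quarter of that of the reflection-invariant function [sum4 F]. *)
Lemma sum4_Rintegral_ge0 (F : X * X -> R) : intble P F ->
  {ae P, forall z, l < hd (z.1 : V) -> l < hd (z.2 : V) -> 0 <= sum4 F z} ->
  0 <= \int[P]_z F z.
Proof.
move=> iF F0.
have [m1 p1] := refl1_preserving; have [m2 p2] := refl2_preserving.
have [m12 p12] := refl12_preserving.
have i1 := preserving_intble m1 p1 iF; have i2 := preserving_intble m2 p2 iF.
have i12 := preserving_intble m12 p12 iF.
have iS2 := intbleD iF i1; have iS3 := intbleD iS2 i2.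
have iS : intble P (sum4 F) := intbleD iS3 i12.
suff : 0 <= \int[P]_z sum4 F z.
  rewrite /sum4 (RintegralD _ iS3 i12)// (RintegralD _ iS2 i2)// (RintegralD _ iF i1)//.
  rewrite (preserving_Rintegral m1 p1 iF) (preserving_Rintegral m2 p2 iF).
  rewrite (preserving_Rintegral m12 p12 iF); lra.
apply: Rintegral_ge0_ae => //; apply: half_space_ae F0 => z.
  by rewrite sum4_refl1.
by rewrite sum4_refl2.
Qed.

Lemma measurable_sum4 (F : X * X -> R) : measurable_fun [set: X * X] F ->
  measurable_fun [set: X * X] (sum4 F).
Proof.
move=> mF; have [m1 _] := refl1_preserving; have [m2 _] := refl2_preserving.
have [m12 _] := refl12_preserving.
by do 3 (apply: measurable_funD; last exact: measurableT_comp).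
Qed.

Lemma sum4_integral (F : X * X -> R) : measurable_fun [set: X * X] F -> (forall z, 0 <= F z) ->
  (\int[P]_z (sum4 F z)%:E = 4%:E * \int[P]_z (F z)%:E)%E.
Proof.
move=> mF F0.
have [m1 p1] := refl1_preserving; have [m2 p2] := refl2_preserving.
have [m12 p12] := refl12_preserving.
have mF' : measurable_fun [set: X * X] (fun z => (F z)%:E) by exact/measurable_EFinP.
have F0' z : (0 <= (F z)%:E)%E by rewrite lee_fin.
have mc (h : X * X -> X * X) : measurable_fun [set: X * X] h ->
  measurable_fun [set: X * X] (fun z => F (h z)) by move=> mh; exact: measurableT_comp.
have mF1 := mc _ m1; have mF2 := mc _ m2; have mF12 := mc _ m12.
have mS2 := measurable_funD mF mF1; have mS3 := measurable_funD mS2 mF2.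
rewrite /sum4 (intD _ mS3 mF12)//; last by move=> z; rewrite !addr_ge0.
rewrite (intD _ mS2 mF2)//; last by move=> z; rewrite !addr_ge0.
rewrite (intD _ mF mF1)//.
have -> := ge0_preserving_integral m1 p1 mF' F0'.
have -> := ge0_preserving_integral m2 p2 mF' F0'.
have -> := ge0_preserving_integral m12 p12 mF' F0'.
move: (\int[P]_z (F z)%:E)%E (integral_ge0 P (D := setT) (fun z _ => F0' z)) => I.
case: I => [I I0||] //=; last by rewrite !addye// gt0_muley.
by rewrite -EFinM -!EFinD; congr (_%:E); ring.
Qed.

(** Integrability can be tested after averaging over reflections, which is where
    oddness and the monotonicity of the kernel become visible. *)
Lemma sum4_intble (F G : X * X -> R) : measurable_fun [set: X * X] F -> (forall z, 0 <= F z) ->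
  (forall z, 0 <= G z) -> intble P G ->
  {ae P, forall z, l < hd (z.1 : V) -> l < hd (z.2 : V) -> sum4 F z <= sum4 G z} ->
  intble P F.
Proof.
move=> mF F0 G0 iG FG; apply: ge0_intble => //.
have mG := intble_measurable iG.
have s0 K z : (forall z, 0 <= K z) -> 0 <= sum4 K z by move=> K0; rewrite /sum4 !addr_ge0.
have : (\int[P]_z (sum4 F z)%:E <= \int[P]_z (sum4 G z)%:E)%E.
  apply: ae_ge0_le_integral => //.
  - by move=> z _; rewrite lee_fin s0.
  - by apply/measurable_EFinP; exact: measurable_sum4.
  - by move=> z _; rewrite lee_fin s0.
  - by apply/measurable_EFinP; exact: measurable_sum4.
  - have : {ae P, forall z, sum4 F z <= sum4 G z}.
      by apply: half_space_ae FG => z; rewrite ?sum4_refl1 ?sum4_refl2.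
    by apply: filterS => z Fz _; rewrite lee_fin.
rewrite !sum4_integral// lee_pmul2l// => /le_lt_trans; apply.
exact: intble_ge0_fin.
Qed.

End reflection_group.

Lemma kernel_refl12 l x y : j (refl l x - refl l y) = j (x - y).
Proof. by rewrite refl_sub (kernel_flip jP). Qed.

Lemma kernel_refl1 l x y : j (refl l x - y) = j (x - refl l y).
Proof. by rewrite refl_subl (kernel_flip jP). Qed.

Lemma energy_density_refl l u v z : energy_density (u \o refl l) (v \o refl l) z =
  energy_density u v (refl12 l z).
Proof. by rewrite /energy_density /= kernel_refl12. Qed.

Lemma fin_energy_refl l u : fin_energy u -> fin_energy (u \o refl l).
Proof.
move=> [mu iu]; split; first exact: (measurableT_comp mu (measurable_refl l)).
have [m12 p12] := refl12_preserving l.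
have := preserving_intble m12 p12 iu; congr intble.
by apply/funext => z /=; rewrite energy_density_refl.
Qed.

Lemma form_refl l u v : fin_energy u -> fin_energy v ->
  form (u \o refl l) v = form u (v \o refl l).
Proof.
move=> fu fv; have [m12 p12] := refl12_preserving l.
rewrite /form -[RHS](preserving_Rintegral m12 p12); last first.
  by apply: energy_density_intble => //; exact: fin_energy_refl.
apply: eq_Rintegral => z _; rewrite /energy_density/= !reflK.
by rewrite kernel_refl12.
Qed.

(** The analytic content of the monotonicity of the kernel: two points on the same
    side of the hyperplane interact more than a point and a mirror image. *)
Lemma kernel_half_space_ae l : {ae P, forall z : X * X,
  l < hd (z.1 : V) -> l < hd (z.2 : V) ->
  j ((z.1 : V) - refl l z.2) <= j ((z.1 : V) - (z.2 : V))}.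
Proof.
have := ae_diff (kernel_mono jP); apply: filterS => z /= jz h1 h2.
apply: jz; rewrite !hdtlE// [leRHS]ger0_norm ?ler_norml; last by lra.
by apply/andP; split; lra.
Qed.

Section negative_part.
Variables (l : R) (v : X -> R).
Hypothesis v_anti : forall x, v (refl l x) = - v x.

(** The test function 1_H v^-, which is not the negative part of v: it vanishes
    on the other side of the hyperplane. *)
Definition neg_half (x : X) : R := if l < hd (x : V) then Num.max (- v x) 0 else 0.

Lemma neg_half_ge0 x : 0 <= neg_half x.
Proof. by rewrite /neg_half; case: ifP => // _; rewrite le_max lexx orbT. Qed.

Lemma neg_half_refl x : l < hd (x : V) -> neg_half (refl l x) = 0.
Proof. by move=> lx; rewrite /neg_half hd_refl ifF//; apply/negbTE; lra. Qed.

Lemma measurable_neg_half : measurable_fun [set: X] v ->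
  measurable_fun [set: X] neg_half.
Proof.
move=> mv; apply: measurable_fun_ifT => //.
  by apply: measurable_fun_ltr => //; exact: measurable_hd.
by apply: measurable_maxr => //; exact: measurableT_comp.
Qed.

Hypothesis fv : fin_energy v.

(** Although 1_H cuts v along the hyperplane, the oddness of v makes the averaged
    energy density of v large enough to control that of
    1_H v^-, pointwise on pairs in H. *)
Lemma fin_energy_neg_half : fin_energy neg_half.
Proof.
have [mv iv] := fv; have mn := measurable_neg_half mv; split => //.
apply: (@sum4_intble l _ (energy_density v v)) => //.
- exact: measurable_energy_density.
- exact: energy_density_ge0.
- exact: energy_density_ge0.
have := kernel_half_space_ae l; apply: filterS => -[x y] /= jxy lx ly.
have {jxy} := jxy lx ly; have := kernel_ge0 jP ((x : V) - refl l y).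
rewrite /sum4 /refl1 /refl2 /refl12 /energy_density/= !neg_half_refl// !v_anti.
rewrite kernel_refl12 kernel_refl1 /neg_half lx ly.
move: (j _) (j _) (v x) (v y) => k k' a b k'0 kk'.
have pa : (Num.max (- a) 0) ^+ 2 <= a ^+ 2 by case: (leP (- a) 0) => _; rewrite ?expr0n ?sqr_ge0// sqrrN.
have pb : (Num.max (- b) 0) ^+ 2 <= b ^+ 2 by case: (leP (- b) 0) => _; rewrite ?expr0n ?sqr_ge0// sqrrN.
have pab : (Num.max (- a) 0 - Num.max (- b) 0) ^+ 2 <= (a - b) ^+ 2.
  rewrite !expr2; case: (max0P a) => -[ha -> _]; case: (max0P b) => -[hb -> _].
  - by have := sqr_ge0 (a - b); rewrite expr2; lra.
  - have : 0 <= a * - b by rewrite mulr_ge0//; lra.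
    have := sqr_ge0 a; rewrite expr2; lra.
  - have : 0 <= (- a) * b by rewrite mulr_ge0//; lra.
    have := sqr_ge0 b; rewrite expr2; lra.
  - lra.
move: (Num.max _ _) (Num.max _ _) pa pb pab => p q pa pb pab.
have h1 : (p - q) ^+ 2 * k <= (a - b) ^+ 2 * k by rewrite ler_wpM2r//; lra.
have h2 : (p ^+ 2 + q ^+ 2) * k' <= (a ^+ 2 + b ^+ 2) * k' by rewrite ler_wpM2r//; lra.
have h3 : (a - b) ^+ 2 * k' <= (a - b) ^+ 2 * k by rewrite ler_wpM2l// sqr_ge0.
have h4 : 0 <= (a + b) ^+ 2 * k' by rewrite mulr_ge0// sqr_ge0.
have h5 : 0 <= (a - b) ^+ 2 * k' by rewrite mulr_ge0// sqr_ge0.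
by rewrite !expr2 in h1 h2 h3 h4 h5; nra.
Qed.

(** The basic inequality. After summation over the four reflected pairs the claim is
    pointwise: for x, y in H with k = J(x - y), k' = J(x - r y) <= k, and the
    values a = v x, b = v y, it is a polynomial inequality in each sign case. D
    stands for (part of) the gain v^+(y) 1_H v^-(x) (k - k') from
    pairs with opposite signs. *)
Lemma form_neg_half (D : X * X -> R) : intble P D ->
  (forall z, ~~ ((l < hd (z.1 : V)) && (l < hd (z.2 : V))) -> D z = 0) ->
  {ae P, forall z : X * X, l < hd (z.1 : V) -> l < hd (z.2 : V) ->
    D z <= neg_half z.1 * Num.max (v z.2) 0 *
      (j ((z.1 : V) - (z.2 : V)) - j ((z.1 : V) - refl l z.2))} ->
  form v neg_half + form neg_half neg_half + \int[P]_z D z <= 0.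
Proof.
move=> iD D0 leD; have fn := fin_energy_neg_half.
have i1 := energy_density_intble fv fn; have i2 := energy_density_intble fn fn.
have i12 := intbleD i1 i2; have i := intbleD i12 iD.
rewrite -oppr_ge0 /form -RintegralD// -RintegralD// -mulN1r -RintegralZl//.
apply: (@sum4_Rintegral_ge0 l); first exact: intbleZ.
move: (ae_and (kernel_half_space_ae l) leD).
apply: filterS => -[x y] /= [jxy Dxy] lx ly.
have {jxy} := jxy lx ly; have {Dxy} := Dxy lx ly.
have := kernel_ge0 jP ((x : V) - refl l y).
rewrite /sum4 /refl1 /refl2 /refl12 /energy_density/= !neg_half_refl// !v_anti.
rewrite kernel_refl12 kernel_refl1 /neg_half lx ly.
rewrite (D0 (refl l x, y)) ?(D0 (x, refl l y)) ?(D0 (refl l x, refl l y))/= ?hd_refl; last 3 first.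
- by rewrite negb_and -!leNgt; apply/orP; left; lra.
- by rewrite negb_and -!leNgt; apply/orP; right; lra.
- by rewrite negb_and -!leNgt; apply/orP; left; lra.
move: (j _) (j _) (v x) (v y) (D _) => k k' a b d k'0 dle kk'.
move: dle; case: (max0P a) => -[ha -> _]; case: (max0P b) => -[hb -> ->].
- by rewrite !mul0r => *; lra.
- rewrite !mul0r => ?; have : 0 <= a * (- b) * (k - k') by rewrite !mulr_ge0//; lra.
  lra.
- by move=> ?; lra.
- rewrite mulr0 mul0r => ?; have : 0 <= (- a) * (- b) * k' by rewrite !mulr_ge0//; lra.
  lra.
Qed.

End negative_part.

End energy.

(** * Poincare inequality and second differences *)

Lemma measurable_EFin (d : measure_display) (T : measurableType d)
    (R : realType) (F : T -> R) :
  measurable_fun [set: T] F -> measurable_fun [set: T] (fun x => (F x)%:E).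
Proof. by move=> mF; exact/measurable_EFinP. Qed.

Section poincare.
Variables (R : realType) (n : nat).
Local Notation V := 'rV[R]_n.+1.
Local Notation X := (borel_rV R n.+1).
Local Notation m := (borel_lebesgue R n.+1).
Local Notation P := (m \x m)%E.
Implicit Types (x y : V) (u v w phi G : X -> R).
Variables (j : X -> R) (r0 : R).
Hypothesis jP : kernel_spec j r0.

Lemma tonelli1 (F : X * X -> R) : measurable_fun [set: X * X] F ->
  (forall z, 0 <= F z) ->
  (\int[P]_z (F z)%:E = \int[m]_x \int[m]_y (F (x, y))%:E)%E.
Proof.
move=> mF F0; have F0' z : (0 <= (F z)%:E)%E by rewrite lee_fin.
exact: (@fubini_tonelli1 _ _ X X R m m _ (measurable_EFin mF) F0').
Qed.

Lemma tonelli2 (F : X * X -> R) : measurable_fun [set: X * X] F ->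
  (forall z, 0 <= F z) ->
  (\int[P]_z (F z)%:E = \int[m]_y \int[m]_x (F (x, y))%:E)%E.
Proof.
move=> mF F0; have F0' z : (0 <= (F z)%:E)%E by rewrite lee_fin.
rewrite tonelli1//.
exact: (@fubini_tonelli _ _ X X R m m _ (measurable_EFin mF) F0').
Qed.

Lemma integral_reflected_shift (F : X -> \bar R) x : measurable_fun [set: X] F ->
  (forall z, 0 <= F z)%E ->
  (\int[m]_y F (x - (y : V))%R = \int[m]_z F z)%E.
Proof. exact: (ge0_preserving_integral (sub_measurable x) (@sub_preserving R n x)). Qed.

(** Truncation gives a bounded kernel that still has as much mass as desired. *)
Lemma truncated_kernel_mass (C : R) : exists k : nat,
  (C%:E < \int[m]_z (Num.min (j z) k%:R)%:E)%E.
Proof.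
have mj := kernel_measurable jP.
have mg k : measurable_fun [set: X] (fun z => (Num.min (j z) k%:R)%:E).
  by apply: measurable_EFin; exact: measurable_minr.
have cvgI : (fun k => \int[m]_z (Num.min (j z) k%:R)%:E)%E @ \oo --> (+oo)%E.
  rewrite -(kernel_infinite jP).
  rewrite (_ : (\int[m]_z (j z)%:E = \int[m]_z limn (fun k => (Num.min (j z) k%:R)%:E))%E).
    apply: cvg_monotone_convergence => //.
    - by move=> k z _; rewrite lee_fin le_min (kernel_ge0 jP) ler0n.
    - move=> z _ a b ab; rewrite lee_fin le_min ge_min lexx/=.
      by rewrite ge_min ler_nat ab orbT.
  apply: eq_integral => z _; apply/esym/cvg_lim => //.
  apply: cvg_near_cst; exists (Num.truncn (j z)).+1 => // k /= jk.
  congr (_%:E); apply/min_idPl; apply: (le_trans (ltW (truncnS_gt (j z)))).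
  by rewrite ler_nat.
have /cvgeyPgt/(_ C)[k _ kP] := cvgI.
by exists k; exact: (kP k (leqnn k)).
Qed.

(** For x in A, the part of the kernel that sees the complement of A has mass at
    least C: truncating the kernel at height k, a set A of measure below
    1/(k + 1) hides mass less than 1. *)
Lemma poincare (C : R) : 0 <= C -> exists2 delta : R, 0 < delta &
  forall (A : set X) (phi : X -> R), measurable A -> (m A < delta%:E)%E ->
  fin_energy j phi -> (forall x, ~ A x -> phi x = 0) ->
  (\int[m]_x (C * phi x ^+ 2)%:E <= (form j phi phi)%:E)%E.
Proof.
move=> C0; have [k kC] := truncated_kernel_mass (C + 1).
exists k.+1%:R^-1 => [|A phi mA Ad fp phi0]; first by rewrite invr_gt0.
have mj := kernel_measurable jP; have [mp ip] := fp.
pose g : X -> R := fun z => Num.min (j z) k%:R.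
have g0 z : 0 <= g z by rewrite le_min (kernel_ge0 jP) ler0n.
have mg : measurable_fun [set: X] g by exact: measurable_minr.
have mdiff (F : X -> R) (x : V) : measurable_fun [set: X] F ->
    measurable_fun [set: X] (fun y : X => F (x - (y : V))).
  by move=> mF; exact: (measurableT_comp mF (sub_measurable x)).
have mAc : measurable_fun [set: X] (\1_(~` A) : X -> R).
  by apply: measurable_indic; exact: measurableC.
have mA1 : measurable_fun [set: X] (\1_A : X -> R) by exact: measurable_indic.
have kill x : (C%:E <= \int[m]_y (\1_(~` A) y * j (x - (y : V)))%:E)%E.
  rewrite -(@leeD2rE _ 1%:E)//.
  apply: (@le_trans _ _ (\int[m]_z (g z)%:E)%E); first by rewrite -EFinD ltW.
  rewrite -(integral_reflected_shift x (measurable_EFin mg)) => [|z]; last by rewrite lee_fin.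
  apply: (@le_trans _ _ (\int[m]_y (\1_(~` A) y * j (x - (y : V)) + k%:R * \1_A y)%:E)%E).
    apply: le_int.
    - exact: mdiff.
    - apply: measurable_funD; apply: measurable_funM => //; exact: mdiff.
    - by move=> y.
    - move=> y; rewrite !indicE in_setC; case: (y \in A) => /=.
        by rewrite mul0r add0r mulr1 ge_min lexx orbT.
      by rewrite mul1r mulr0 addr0 ge_min lexx.
  rewrite intD; last 4 first.
  - by apply: measurable_funM => //; exact: mdiff.
  - exact: measurable_funM.
  - by move=> y; rewrite mulr_ge0// (kernel_ge0 jP).
  - by move=> y; rewrite mulr_ge0.
  apply: leeD2l; under eq_integral do rewrite EFinM.
  rewrite ge0_integralZl//; last exact: measurable_EFin.
  rewrite integral_indic// setIT.
  apply: (@le_trans _ _ (k%:R%:E * k.+1%:R^-1%:E)%E).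
    by apply: lee_wpmul2l; [rewrite lee_fin|exact: ltW].
  by rewrite -EFinM lee_fin ler_pdivrMr// mul1r ler_nat.
rewrite /form EFin_Rintegral//.
pose F (z : X * X) : R := phi z.1 ^+ 2 * (\1_(~` A) z.2 * j ((z.1 : V) - (z.2 : V))).
have mF : measurable_fun [set: X * X] F.
  apply: measurable_funM; first by apply: measurable_funX; exact: measurable_arg1.
  by apply: measurable_funM; [exact: measurable_arg2|exact: measurable_kernel_diff jP].
have F0 z : 0 <= F z.
  by rewrite mulr_ge0 ?sqr_ge0// mulr_ge0// (kernel_ge0 jP).
apply: (@le_trans _ _ (\int[P]_z (F z)%:E)%E); last first.
  apply: le_int => //; first exact: measurable_energy_density jP _ _ _ _.
  move=> [x y]; rewrite /F /energy_density/= mulrA ler_wpM2r ?(kernel_ge0 jP)//.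
  rewrite indicE in_setC; case: (boolP (y \in A)) => yA /=.
    by rewrite mulr0 -expr2 sqr_ge0.
  by rewrite notin_setE in yA; rewrite (phi0 y yA) subr0 mulr1 expr2.
rewrite tonelli1//.
apply: ge0_le_integral => //.
- by move=> x _; rewrite lee_fin mulr_ge0// sqr_ge0.
- by apply: measurable_EFin; apply: measurable_funM => //; exact: measurable_funX.
- have F0' z : (0 <= (F z)%:E)%E by rewrite lee_fin.
  exact: (@measurable_fun_fubini_tonelli_F _ _ X X R m _ (measurable_EFin mF) F0').
move=> x _; under eq_integral do rewrite /F/= EFinM.
rewrite ge0_integralZl//.
- by rewrite mulrC EFinM lee_wpmul2l// lee_fin sqr_ge0.
- by apply: measurable_EFin; apply: measurable_funM => //; exact: mdiff.
- by move=> y _; rewrite lee_fin mulr_ge0// (kernel_ge0 jP).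
- by rewrite lee_fin sqr_ge0.
Qed.

(** Summation by parts: translations move the difference from phi onto G. *)
Lemma second_difference G phi (M : R) (z : V) : measurable_fun [set: X] G ->
  (forall x, `|G x| <= M) -> intble m phi ->
  intble m (fun x : X => (G (x + z) - G x) * (phi (x + z) - phi x)) /\
  \int[m]_x ((G (x + z) - G x) * (phi (x + z) - phi x)) =
  \int[m]_x (phi x * (2 * G x - G (x + z) - G (x - z))).
Proof.
move=> mG GM ip; have mp := intble_measurable ip.
have prod (H : X -> R) : measurable_fun [set: X] H -> (forall x, `|H x| <= M) ->
    intble m (fun x : X => H x * phi x).
  move=> mH HM; apply: (@le_intble _ _ _ _ _ (fun x : X => M * `|phi x|)).
  - exact: measurable_funM.
  - by move=> x; rewrite normrM ler_wpM2r.
  - by apply: intbleZ; exact: intble_norm.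
have sp := @measurable_shift R n.+1 z; have se := @shift_preserving R n.+1 z.
have mGs (a : V) := measurable_shift_fun a mG.
have i1 := prod _ mG GM.
have i2 := prod _ (mGs z) (fun x => GM _).
have i3 := prod _ (mGs (- z)) (fun x => GM _).
have i1s := preserving_intble sp se i1; have i3s := preserving_intble sp se i3.
have E : (fun x : X => (G (x + z) - G x) * (phi (x + z) - phi x)) =
  (fun x : X => ((fun x => G x * phi x) \o (fun x : X => x + z : X)) x - G (x + z) * phi x
    - ((fun x => G (x - z) * phi x) \o (fun x : X => x + z : X)) x + G x * phi x).
  by apply/funext => x /=; rewrite addrK; ring.
have ia := intbleB i1s i2; have ib := intbleB ia i3s.
rewrite E; split; first exact: intbleD.
rewrite (RintegralD _ ib i1)// (RintegralB _ ia i3s)// (RintegralB _ i1s i2)//.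
rewrite (preserving_Rintegral sp se i1) (preserving_Rintegral sp se i3).
have ja := intbleD i1 i1; have jb := intbleB ja i2; have jc := intbleB jb i3.
transitivity (\int[m]_x (G x * phi x + G x * phi x - G (x + z) * phi x - G (x - z) * phi x)).
  rewrite (RintegralB _ jb i3)// (RintegralB _ ja i2)// (RintegralD _ i1 i1)//.
  by ring.
by apply: eq_Rintegral => x _; ring.
Qed.

(** The shear (z, x) |-> (x + z, x) turns the difference of the two arguments
    of the kernel into an integration variable of its own. *)
Definition shear (p : X * X) : X * X := ((p.2 : V) + (p.1 : V), p.2).

Lemma measurable_shear : measurable_fun [set: X * X] shear.
Proof.
apply: measurable_fun_pair; last exact: measurable_snd.
apply: measurable_to_borel_rV => i.
rewrite (_ : (fun _ => _) = (fun z : X * X => (z.2 : V) ord0 i + (z.1 : V) ord0 i)).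
  apply: measurable_funD.
  - apply: (measurableT_comp (measurable_coord i)); exact: measurable_snd.
  - apply: (measurableT_comp (measurable_coord i)); exact: measurable_fst.
by apply/funext => z; rewrite !mxE.
Qed.

(** By Tonelli, slice by slice, the shear is a translation. *)
Lemma shear_preserving A : measurable A -> P (shear @^-1` A) = P A.
Proof.
move=> mA; have mS : measurable (shear @^-1` A).
  by rewrite -[X in measurable X]setTI; exact: measurable_shear.
have i1 B : measurable B -> (P B = \int[m]_y \int[m]_x (\1_B (x, y))%:E)%E.
  move=> mB; transitivity (\int[P]_z (\1_B z)%:E)%E.
    by rewrite (integral_indic _ measurableT mB) setIT.
  by apply: (tonelli2 (F := \1_B)) => //; exact: measurable_indic.
rewrite !i1//; apply: eq_integral => y _.
have mAy : measurable_fun [set: X] (fun x : X => (\1_A (x, y) : R)%:E).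
  apply: measurable_EFin; apply: measurableT_comp; first exact: measurable_indic.
  exact: measurable_pair2.
rewrite -(ge0_integral_shift (y : V) mAy)//.
apply: eq_integral => x _.
have -> : \1_(shear @^-1` A) (x, y) = \1_A (shear (x, y)) :> R by [].
by rewrite /shear/= addrC.
Qed.

Lemma enorm_sqr (k : nat) (x : 'rV[R]_k) : enorm x ^+ 2 = \sum_i x ord0 i ^+ 2.
Proof. by rewrite sqr_sqrtr// sumr_ge0// => i _; exact: sqr_ge0. Qed.

Lemma measurable_enorm_sqr :
  measurable_fun [set: X] (fun x : X => enorm (x : V) ^+ 2).
Proof.
rewrite (_ : (fun _ => _) = fun x : X => \sum_i (x : V) ord0 i ^+ 2).
  by apply: measurable_sum => i; apply: measurable_funX; exact: measurable_coord.
by apply/funext => x; rewrite enorm_sqr.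
Qed.

Definition levy_density (z : X) : R := Num.min 1 (enorm (z : V) ^+ 2) * j z.

Lemma levy_density_ge0 z : 0 <= levy_density z.
Proof. by rewrite mulr_ge0 ?(kernel_ge0 jP)// le_min ler01 sqr_ge0. Qed.

Lemma levy_density_intble : intble m levy_density.
Proof.
apply: ge0_intble; [|exact: levy_density_ge0|exact: kernel_levy jP].
apply: measurable_funM; last exact: kernel_measurable jP.
by apply: measurable_minr => //; exact: measurable_enorm_sqr.
Qed.

Lemma energy_density_shear u v (z x : V) : energy_density j u v (shear (z, x)) =
  j z * ((u (x + z) - u x) * (v (x + z) - v x)).
Proof. by rewrite /energy_density /shear/= addrAC subrr add0r mulrC. Qed.

(** Only second differences at points of the support of phi matter, and only an
    upper bound: G may have corners that point downwards. *)
Lemma second_difference_le G phi (M C : R) (z : V) : measurable_fun [set: X] G ->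
  measurable_fun [set: X] phi -> (forall x, `|G x| <= M) -> intble m phi ->
  (forall x, 0 <= phi x) ->
  {ae m, forall x : X, phi x != 0 -> forall z : V,
      2 * G x - G ((x : V) + z) - G ((x : V) - z) <=
      C * Num.min 1 (enorm z ^+ 2)} ->
  \int[m]_x (phi x * (2 * G x - G (x + z) - G (x - z))) <=
  C * Num.min 1 (enorm z ^+ 2) * \int[m]_x phi x.
Proof.
move=> mG mp GM ip p0 hC; rewrite -RintegralZl//; apply: le_Rintegral_ae.
- apply: (@le_intble _ _ _ _ _ (fun x : X => 4 * M * `|phi x|)).
  + apply: measurable_funM; first exact: mp.
    apply: measurable_funB; last exact: measurable_shift_fun.
    apply: measurable_funB; last exact: measurable_shift_fun.
    exact: measurable_funM.
  + move=> x; rewrite normrM mulrC ler_wpM2r//.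
    have := GM x; have := GM ((x : V) + z); have := GM ((x : V) - z).
    rewrite !ler_norml => /andP[? ?] /andP[? ?] /andP[? ?].
    by apply/andP; split; lra.
  + by apply: intbleZ; exact: intble_norm.
- exact: intbleZ.
- apply: filterS hC => x hC; have [->|px] := eqVneq (phi x) 0; first by rewrite mul0r mulr0.
  by rewrite mulrC ler_wpM2r// hC.
Qed.

(** After the shear, the inner integral over x is a difference of G against one of
    phi, which becomes a second difference of G; the Levy condition integrates
    the resulting min(1, |z|^2). *)
Lemma form_second_difference_le G phi (M C : R) : fin_energy j G ->
  (forall x, `|G x| <= M) -> fin_energy j phi -> intble m phi ->
  (forall x, 0 <= phi x) ->
  {ae m, forall x : X, phi x != 0 -> forall z : V,
      2 * G x - G ((x : V) + z) - G ((x : V) - z) <=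
      C * Num.min 1 (enorm z ^+ 2)} ->
  form j G phi <= C * (\int[m]_z levy_density z) * \int[m]_x phi x.
Proof.
move=> fG GM fp ip p0 hC; have [mG _] := fG.
have iE := energy_density_intble jP fG fp.
have iS := preserving_intble measurable_shear shear_preserving iE.
rewrite /form -(preserving_Rintegral measurable_shear shear_preserving iE).
have iL := intbleZ (\int[m]_x phi x) (intbleZ C levy_density_intble).
rewrite mulrC -(RintegralZl C)//; last exact: levy_density_intble.
rewrite -RintegralZl//; last by apply: intbleZ; exact: levy_density_intble.
rewrite -lee_fin !EFin_Rintegral//.
rewrite -(integral12_prod_meas1 iS); apply: le_integral => //.
  exact: integrable_fubini_F iS.
move=> z _; rewrite /fubini_F/=.
under eq_integral do rewrite energy_density_shear.
have [i1 i2] := second_difference z mG GM ip.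
rewrite -EFin_Rintegral; last exact: intbleZ.
rewrite lee_fin RintegralZl// i2.
rewrite (_ : _ * (C * _) = j z * (C * Num.min 1 (enorm (z : V) ^+ 2) * \int[m]_x phi x));
  last by rewrite /levy_density; ring.
rewrite ler_wpM2l ?(kernel_ge0 jP)//; apply (@second_difference_le G phi M C z mG (proj1 fp) GM ip p0 hC).
Qed.

(** The same computation with phi = G, before the finiteness of the energy of G
    is known; hence in extended nonnegative integrals. *)
Lemma fin_energy_second_difference G (M C : R) : measurable_fun [set: X] G ->
  (forall x, `|G x| <= M) -> intble m G -> (forall x, 0 <= G x) ->
  {ae m, forall x : X, G x != 0 -> forall z : V,
      2 * G x - G ((x : V) + z) - G ((x : V) - z) <=
      C * Num.min 1 (enorm z ^+ 2)} ->
  fin_energy j G.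
Proof.
move=> mG GM iG G0 hC; split => //.
have mE := measurable_energy_density jP mG mG.
have E0 := energy_density_ge0 jP G.
apply: ge0_intble => //.
have mES : measurable_fun [set: X * X] (energy_density j G G \o shear).
  exact: (measurableT_comp mE measurable_shear).
rewrite -(ge0_preserving_integral measurable_shear shear_preserving (measurable_EFin mE)); last first.
  by move=> z; rewrite lee_fin.
rewrite (tonelli1 mES); last by move=> z; exact: E0.
have iL := intbleZ (\int[m]_x G x) (intbleZ C levy_density_intble).
apply: (@le_lt_trans _ _ (\int[m]_z (\int[m]_x G x * (C * levy_density z))%:E)%E); last first.
  by rewrite -EFin_Rintegral// ltry.
have inner (z : X) : (\int[m]_x (energy_density j G G (shear (z, x)))%:E =
    (j z * \int[m]_x (G x * (2 * G x - G ((x : V) + (z : V)) - G ((x : V) - (z : V)))))%:E)%E.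
  under eq_integral do rewrite energy_density_shear.
  have [i1 i2] := second_difference z mG GM iG.
  by rewrite -EFin_Rintegral; [rewrite RintegralZl// i2|exact: intbleZ].
apply: ge0_le_integral => //.
- by move=> z _; apply: integral_ge0 => x _; rewrite lee_fin E0.
- have ES0 z : (0 <= ((energy_density j G G \o shear) z)%:E)%E by rewrite lee_fin E0.
  exact: (@measurable_fun_fubini_tonelli_F _ _ X X R m _ (measurable_EFin mES) ES0).
- by apply: measurable_EFin; exact: (intble_measurable iL).
move=> z _; rewrite [leLHS](inner z) lee_fin.
rewrite (_ : _ * (C * _) = j z * (C * Num.min 1 (enorm (z : V) ^+ 2) * \int[m]_x G x));
  last by rewrite /levy_density; ring.
rewrite ler_wpM2l ?(kernel_ge0 jP)//.
apply (@second_difference_le G G M C z mG mG GM iG G0 hC).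
Qed.

End poincare.

(** * Odd test functions *)

Section test_functions.
Variables (R : realType) (n : nat).
Local Notation V := 'rV[R]_n.+1.
Local Notation X := (borel_rV R n.+1).
Local Notation m := (borel_lebesgue R n.+1).
Local Notation P := (m \x m)%E.
Implicit Types (x y : V).

Lemma intble_bounded_support (F : X -> R) (A : set X) (M : R) :
  measurable_fun [set: X] F -> measurable A -> (m A < +oo)%E ->
  (forall x, `|F x| <= M) -> (forall x, ~ A x -> F x = 0) -> intble m F.
Proof.
move=> mF mA Aoo FM F0; apply: (@le_intble _ _ _ _ _ (fun x : X => M * \1_A x)) => //.
  move=> x; rewrite indicE; case: (boolP (x \in A)) => xA; first by rewrite mulr1.
  by rewrite notin_setE in xA; rewrite F0// normr0 mulr0.
apply: intbleZ; apply: ge0_intble => //.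
by rewrite (integral_indic _ measurableT mA) setIT.
Qed.

Lemma intble_tensor (F G : X -> R) : intble m F -> intble m G ->
  (forall x, 0 <= F x) -> (forall x, 0 <= G x) ->
  intble P (fun z => F z.1 * G z.2).
Proof.
move=> iF iG F0 G0; have mF := intble_measurable iF; have mG := intble_measurable iG.
have mFG : measurable_fun [set: X * X] (fun z : X * X => F z.1 * G z.2).
  by apply: measurable_funM; [exact: measurable_arg1|exact: measurable_arg2].
have FG0 z : 0 <= F z.1 * G z.2 by rewrite mulr_ge0.
apply: ge0_intble => //.
rewrite (tonelli1 mFG)//.
under eq_integral do [under eq_integral do rewrite /= EFinM].
rewrite (eq_integral (fun x : X => ((\int[m]_y G y) * F x)%:E)).
  by apply: intble_ge0_fin; [exact: intbleZ|move=> x; rewrite mulr_ge0// Rintegral_ge0].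
move=> x _; rewrite ge0_integralZl//; last by rewrite lee_fin.
- by rewrite -EFin_Rintegral// -EFinM mulrC.
- exact: measurable_EFin.
- by move=> y _; rewrite lee_fin.
Qed.

Lemma Rintegral_product_ge (D : X * X -> R) (h : X -> R) : intble P D -> intble m h ->
  (forall x : X, (h x)%:E <= \int[m]_y (D (x, y))%:E)%E ->
  \int[m]_x h x <= \int[P]_z D z.
Proof.
move=> iD ih hD; rewrite -lee_fin !EFin_Rintegral//.
rewrite -(integral12_prod_meas1 iD).
apply: le_integral => //.
exact: (integrable_fubini_F iD).
Qed.

Definition sqnorm (x : V) : R := \sum_i x ord0 i ^+ 2.

Lemma sqnorm_ge0 x : 0 <= sqnorm x.
Proof. by apply: sumr_ge0 => i _; exact: sqr_ge0. Qed.

Lemma coord_sqnorm x i : x ord0 i ^+ 2 <= sqnorm x.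
Proof.
by rewrite /sqnorm (bigD1 i)//= lerDl sumr_ge0// => k _; exact: sqr_ge0.
Qed.

Lemma sqnorm_parallelogram x z :
  sqnorm (x + z) + sqnorm (x - z) = 2 * sqnorm x + 2 * sqnorm z.
Proof.
rewrite /sqnorm -!big_split/= !mulr_sumr -big_split/=; apply: eq_bigr => i _.
by rewrite !mxE; ring.
Qed.

Lemma sqnorm_ltP x rho : 0 < rho -> sqnorm x < rho ^+ 2 ->
  forall i, `|x ord0 i| < rho.
Proof.
move=> rho0 xr i; rewrite -(@ltr_pXn2r _ 2)// ?nnegrE ?(ltW rho0)//.
by rewrite real_normK ?num_real//; exact: le_lt_trans (coord_sqnorm x i) xr.
Qed.

Lemma sqnorm_small x rho : 0 <= rho -> (forall i, `|x ord0 i| < rho / (2 * n.+1%:R)) ->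
  sqnorm x <= rho ^+ 2 / 2.
Proof.
move=> rho0 xr.
apply: (@le_trans _ _ (\sum_(i < n.+1) (rho / (2 * n.+1%:R)) ^+ 2)).
  apply: ler_sum => i _; rewrite -[X in X <= _](real_normK (num_real _)).
  have xi := ltW (xr i); rewrite lerXn2r// ?nnegrE// divr_ge0// mulr_ge0//.
rewrite sumr_const card_ord.
have n0 : 1 <= n.+1%:R :> R by rewrite ler1n.
rewrite -[leLHS]mulr_natl (_ : _ * _ = rho ^+ 2 * (4 * n.+1%:R)^-1); last first.
  have t0 : n.+1%:R != 0 :> R by rewrite pnatr_eq0.
  by move: (n.+1%:R) t0 => t t0; field.
by rewrite ler_wpM2l ?sqr_ge0// lef_pV2 ?posrE ?mulr_gt0//; lra.
Qed.

Section bump.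
Variables (x0 : V) (rho : R).
Hypothesis rho_gt0 : 0 < rho.

(** A maximum of two semiconvex functions; unlike a smooth cut-off, its second
    differences are bounded above by inspection. *)
Definition bump (x : X) : R := Num.max 0 (1 - sqnorm ((x : V) - x0) / rho ^+ 2).

Lemma bump_ge0 x : 0 <= bump x.
Proof. by rewrite /bump le_max lexx. Qed.

Lemma bump_le1 x : bump x <= 1.
Proof.
rewrite /bump ge_max ler01/= gerBl divr_ge0 ?sqnorm_ge0// sqr_ge0//.
Qed.

Lemma bump_ge_half x : sqnorm (x - x0) <= rho ^+ 2 / 2 -> 1 / 2 <= bump x.
Proof.
move=> sx; have : sqnorm (x - x0) / rho ^+ 2 <= 1 / 2.
  by rewrite ler_pdivrMr ?exprn_gt0// mulrC mulrA mulr1.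
by move=> h; rewrite /bump le_max; apply/orP; right; lra.
Qed.

Lemma bump_support x : bump x != 0 -> sqnorm (x - x0) < rho ^+ 2.
Proof.
apply: contraNT; rewrite -leNgt => le_rho; apply/eqP/max_idPl.
by rewrite subr_le0 ler_pdivlMr ?mul1r// exprn_gt0.
Qed.

Lemma bump_ball x : bump x != 0 -> ball x0 rho x.
Proof.
move=> /bump_support /(sqnorm_ltP rho_gt0) xr; apply/ball_rVP => // i.
by rewrite distrC; have := xr i; rewrite !mxE.
Qed.

Lemma bump_second_difference x z :
  2 * bump x - bump (x + z) - bump (x - z) <= 2 * Num.min 1 (sqnorm z / rho ^+ 2).
Proof.
have := bump_ge0 (x + z); have := bump_ge0 (x - z); have := bump_le1 x.
have := bump_ge0 x.
have q0 : 0 <= sqnorm z / rho ^+ 2 by rewrite divr_ge0 ?sqnorm_ge0 ?sqr_ge0.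
have par : sqnorm (x + z - x0) / rho ^+ 2 + sqnorm (x - z - x0) / rho ^+ 2 =
    2 * (sqnorm (x - x0) / rho ^+ 2) + 2 * (sqnorm z / rho ^+ 2).
  rewrite -mulrDl !mulrA -mulrDl -sqnorm_parallelogram; congr ((sqnorm _ + sqnorm _) / _).
    by rewrite addrAC.
  by rewrite addrAC.
move=> b0 b1 bm bp; rewrite minr_pMr// le_min mulr1; apply/andP; split; first by lra.
have gep : 1 - sqnorm (x + z - x0) / rho ^+ 2 <= bump (x + z) by rewrite /bump le_max lexx orbT.
have gem : 1 - sqnorm (x - z - x0) / rho ^+ 2 <= bump (x - z) by rewrite /bump le_max lexx orbT.
have : bump x = 0 \/ bump x = 1 - sqnorm (x - x0) / rho ^+ 2.
  by rewrite /bump; case: (leP 0 (1 - _)); [right|left].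
by case=> ->; lra.
Qed.

Lemma measurable_bump : measurable_fun [set: X] bump.
Proof.
apply: measurable_maxr => //; apply: measurable_funB => //.
apply: measurable_funM => //.
apply: (measurableT_comp (f := fun x : X => sqnorm (x : V)) _ (measurable_shift (- x0))).
by apply: measurable_sum => i; apply: measurable_funX; exact: measurable_coord.
Qed.

Lemma bump_intble : intble m bump.
Proof.
apply: (@intble_bounded_support _ ((fun x : X => (x : V) - x0) @^-1` cube rho) 1).
- exact: measurable_bump.
- rewrite -[X in measurable X]setTI; apply: (measurable_shift (- x0)) => //.
  exact: measurable_cube.
- by rewrite shift_preserving; [exact: cube_fin|exact: measurable_cube].
- by move=> x; rewrite ger0_norm ?bump_ge0// bump_le1.
- move=> x; apply: contra_notP => /eqP/bump_support/(sqnorm_ltP rho_gt0) xr i.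
  exact: xr.
Qed.

Lemma min_sqnorm_scale (z : V) :
  Num.min 1 (sqnorm z / rho ^+ 2) <= (1 + (rho ^+ 2)^-1) * Num.min 1 (enorm z ^+ 2).
Proof.
have i0 : 0 < (rho ^+ 2)^-1 by rewrite invr_gt0 exprn_gt0.
have c0 : 0 <= 1 + (rho ^+ 2)^-1 by rewrite addr_ge0// ltW.
rewrite enorm_sqr -/(sqnorm z) minr_pMr// mulr1 le_min.
have q0 := sqnorm_ge0 z.
apply/andP; split.
  by rewrite ge_min; apply/orP; left; rewrite lerDl ltW.
rewrite ge_min; apply/orP; right; rewrite mulrDl mul1r mulrC lerDr//.
Qed.

Variables (j : X -> R) (r0 : R).
Hypothesis jP : kernel_spec j r0.

Lemma fin_energy_bump : fin_energy j bump.
Proof.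
apply: (@fin_energy_second_difference _ _ j r0 jP bump 1 (2 * (1 + (rho ^+ 2)^-1))).
- exact: measurable_bump.
- by move=> x; rewrite ger0_norm ?bump_ge0// bump_le1.
- exact: bump_intble.
- exact: bump_ge0.
- apply/aeW => x _ z; apply: (le_trans (bump_second_difference x z)).
  by rewrite -mulrA ler_wpM2l// min_sqnorm_scale.
Qed.

Variable l : R.
Hypothesis rho_l : rho <= (hd x0 - l) / 2.

(** The bump minus its mirror image. As rho is at most half the distance of x0 to
    the hyperplane, the two have disjoint supports. *)
Definition odd_bump (x : X) : R := bump x - bump (refl l x).

Lemma odd_bump_refl x : odd_bump (refl l x) = - odd_bump x.
Proof. by rewrite /odd_bump reflK opprB. Qed.

Lemma odd_bump_norm x : `|odd_bump x| <= 1.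
Proof.
rewrite /odd_bump; have := bump_ge0 x; have := bump_le1 x.
have := bump_ge0 (refl l x); have := bump_le1 (refl l x).
by move=> *; rewrite ler_norml; apply/andP; split; lra.
Qed.

Lemma bump_hd x : bump x != 0 -> hd x0 - rho < hd x < hd x0 + rho.
Proof.
by move/bump_support/(sqnorm_ltP rho_gt0)/(_ ord0); rewrite -/(hd _) !hdtlE ltr_distl.
Qed.

Lemma bump_half_space x : bump x != 0 -> l < hd x.
Proof. by move=> /bump_hd/andP[hx _]; move: rho_l rho_gt0; lra. Qed.

Lemma odd_bump_half_space x : l < hd x -> odd_bump x = bump x.
Proof.
move=> lx; rewrite /odd_bump; have [->|/bump_hd] := eqVneq (bump (refl l x)) 0.
  by rewrite subr0.
by rewrite hd_refl => /andP[? _]; exfalso; move: rho_l rho_gt0; lra.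
Qed.

Lemma fin_energy_odd_bump : fin_energy j odd_bump.
Proof.
apply: (fin_energyB jP); first exact: fin_energy_bump.
by apply: (fin_energy_refl jP); exact: fin_energy_bump.
Qed.

(** At a point of the bump, a displacement reaching the mirror bump has first
    coordinate at least rho, where min(1, |z|^2 / rho^2) equals 1 and absorbs the value. *)
Lemma odd_bump_second_difference x z : bump x != 0 ->
  2 * odd_bump x - odd_bump (x + z) - odd_bump (x - z) <=
  4 * (1 + (rho ^+ 2)^-1) * Num.min 1 (enorm z ^+ 2).
Proof.
move=> bx; have /andP[hx1 hx2] := bump_hd bx.
have lx := bump_half_space bx.
have far y : bump (refl l (x + y)) <= Num.min 1 (sqnorm y / rho ^+ 2).
  have q0 : 0 <= sqnorm y / rho ^+ 2 by rewrite divr_ge0 ?sqnorm_ge0 ?sqr_ge0.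
  have [->|/bump_hd] := eqVneq (bump (refl l (x + y))) 0; first by rewrite le_min ler01.
  rewrite !hdtlE => /andP[hy _]; rewrite le_min bump_le1/=.
  apply: (le_trans (bump_le1 _)); rewrite ler_pdivlMr ?exprn_gt0// mul1r.
  apply: le_trans (coord_sqnorm y ord0); rewrite -/(hd y).
  have yr : rho <= - hd y by move: rho_l; lra.
  by rewrite -[leRHS]sqrrN lerXn2r ?nnegrE ?(ltW rho_gt0)// (le_trans (ltW rho_gt0)).
have sz : sqnorm (- z) = sqnorm z by apply: eq_bigr => i _; rewrite mxE sqrrN.
have := far z; have := far (- z); rewrite sz.
have := bump_second_difference x z; have := min_sqnorm_scale z.
rewrite (odd_bump_half_space lx) /odd_bump; move: (Num.min 1 (sqnorm z / _)) => q.
rewrite -mulrA; move: (_ * Num.min _ _) => c; lra.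
Qed.

End bump.
End test_functions.

(** * Maximum principles for reflection differences *)

(** The arithmetic behind the strong maximum principle: the perturbation by
    eps * G costs eps * (L + C), and the interaction with the positive part gains
    theta. *)
Lemma absorption (R : realType) (L C eps theta Iw fG fw fpp ID I : R) :
  0 < eps -> 0 <= L -> eps * (L + C) < theta -> 0 <= fpp ->
  Iw <= eps * I -> fG <= C * I -> theta * I <= ID -> - L * Iw <= fw ->
  fw - eps * fG + fpp + ID <= 0 -> I <= 0.
Proof.
move=> eps0 L0 lt_theta fpp0 h1 h2 h3 h4 h5.
have h6 : L * Iw <= L * (eps * I) by rewrite ler_wpM2l.
have h7 : eps * fG <= eps * (C * I) by rewrite ler_pM2l.
have : (theta - eps * (L + C)) * I <= 0 by lra.
by rewrite pmulr_rle0// subr_gt0.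
Qed.

Lemma minr_sub_le (R : realDomainType) (a c k : R) : c <= a ->
  Num.min a k - Num.min c k <= a - c.
Proof. by move=> ac; case: (leP a k) => ?; case: (leP c k) => ?; lra. Qed.

Section maximum_principles.
Variables (R : realType) (n : nat).
Local Notation V := 'rV[R]_n.+1.
Local Notation X := (borel_rV R n.+1).
Local Notation m := (borel_lebesgue R n.+1).
Local Notation P := (m \x m)%E.
Implicit Types (x y : V).
Variables (j : X -> R) (r0 : R).
Hypothesis jP : kernel_spec j r0.
Hypothesis r0_gt0 : 0 < r0.

Variables (Omega : set V) (c0 : R).
Hypothesis oOmega : open Omega.
Hypothesis Omega_cube : Omega `<=` cube c0.

Definition refl_diff (u : X -> R) (l : R) (x : X) : R := u (refl l x) - u x.

(** What the argument retains of a positive bounded solution: the function is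
    normalised to be Borel and to satisfy the bounds everywhere, and the equation
    is reduced to a linear differential inequality for its reflection differences. *)
Record moving_plane_data (u : X -> R) (M L : R) : Prop := MovingPlaneData {
  mp_energy : fin_energy j u;
  mp_ge0 : forall x : X, 0 <= u x;
  mp_le : forall x : X, u x <= M;
  mp_out : forall x : X, ~ Omega x -> u x = 0;
  mp_pos : {ae m, forall x : X, Omega x -> 0 < u x};
  mp_super : forall (l : R) (phi : X -> R), 0 < l -> fin_energy j phi ->
    (forall x, 0 <= phi x) -> (exists B, forall x, phi x <= B) ->
    {ae m, forall x : X, ~ (Omega x /\ l < hd (x : V)) -> phi x = 0} ->
    - L * \int[m]_x (`|refl_diff u l x| * phi x) <= form j (refl_diff u l) phi }.

Variables (u : X -> R) (M L : R).
Hypothesis uP : moving_plane_data u M L.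
Hypothesis L_ge0 : 0 <= L.

Local Notation w := (refl_diff u).

Lemma refl_diff_anti l x : w l (refl l x) = - w l x.
Proof. by rewrite /refl_diff reflK opprB. Qed.

Lemma refl_diff_energy l : fin_energy j (w l).
Proof.
apply: (fin_energyB jP); last exact: mp_energy uP.
exact: (fin_energy_refl jP l (mp_energy uP)).
Qed.

Lemma measurable_refl_diff l : measurable_fun [set: X] (w l).
Proof. by case: (refl_diff_energy l). Qed.

Lemma refl_diff_norm l x : `|w l x| <= M.
Proof.
have := mp_ge0 uP x; have := mp_le uP x; have := mp_ge0 uP (refl l x).
have := mp_le uP (refl l x); rewrite /refl_diff ler_norml => *.
by apply/andP; split; lra.
Qed.

Lemma refl_diff_out l (x : X) : ~ Omega x -> 0 <= w l x.
Proof. by move=> /(mp_out uP) ux; rewrite /refl_diff ux subr0 (mp_ge0 uP). Qed.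

Let mOmega : measurable (Omega : set X) := open_measurable_rV oOmega.

Lemma half_space_measurable l : measurable ([set x : X | l < hd (x : V)] : set X).
Proof.
have := @measurable_hd R n measurableT `]l, +oo[%classic (measurable_itv _).
by rewrite setTI; congr measurable; apply/seteqP; split => x /=; rewrite in_itv/= andbT.
Qed.

Lemma Omega_fin (A : set X) : measurable A -> A `<=` Omega -> (m A < +oo)%E.
Proof.
move=> mA AO; apply: le_lt_trans (cube_fin n.+1 c0).
apply: le_measure; rewrite ?inE//; first exact: measurable_cube.
exact: subset_trans AO Omega_cube.
Qed.

Definition bad_set (l : R) : set X := [set x | [/\ Omega x, l < hd (x : V) & w l x < 0]].

Lemma bad_setE l : bad_set l = Omega `&` [set x : X | l < hd (x : V)] `&` (w l @^-1` `]-oo, 0[).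
Proof.
apply/seteqP; split => x /=; rewrite in_itv/=; first by case.
by move=> [[]].
Qed.

Lemma measurable_bad_set l : measurable (bad_set l).
Proof.
rewrite bad_setE; apply: measurableI.
  by apply: measurableI => //; exact: half_space_measurable.
by rewrite -[X in measurable X]setTI; apply: measurable_refl_diff.
Qed.

Lemma neg_half_out l x : ~ bad_set l x -> neg_half l (w l) x = 0.
Proof.
move=> nb; rewrite /neg_half; case: ifP => // lx; apply/max_idPr; rewrite oppr_le0.
have [//|wx] := leP 0 (w l x); have [Ox|/(refl_diff_out l)] := pselect (Omega x).
  by exfalso; apply: nb.
by rewrite leNgt wx.
Qed.

Lemma intble0 : intble P (fun=> 0). Proof. exact: integrable0. Qed.

(** Test with 1_H w^-, supported in the bad set. The differential inequality bounds
    its energy by L times its L^2 norm, whereas the Poincare inequality on a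
    small set bounds it below by (L + 1) times that norm. *)
Lemma weak_maximum_principle : exists2 delta : R, 0 < delta &
  forall l, 0 < l -> (m (bad_set l) < delta%:E)%E ->
  {ae m, forall x : X, l < hd (x : V) -> 0 <= w l x}.
Proof.
have L1 : 0 <= L + 1 by rewrite addr_ge0.
have [delta d0 poinc] := poincare jP L1.
exists delta => // l l0 bad_small.
pose phi := neg_half l (w l).
have phi0 x : 0 <= phi x by exact: neg_half_ge0.
have fphi : fin_energy j phi.
  by apply: (fin_energy_neg_half jP (refl_diff_anti l)); exact: refl_diff_energy.
have phi_le x : phi x <= M.
  have M0 : 0 <= M := le_trans (normr_ge0 _) (refl_diff_norm l x).
  rewrite /phi /neg_half; case: ifP => // _; rewrite ge_max M0 andbT.
  by rewrite (le_trans _ (refl_diff_norm l x))// -normrN ler_norm.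
have iphi2 : intble m (fun x => phi x ^+ 2).
  apply: (@intble_bounded_support _ _ _ (bad_set l) (M ^+ 2)).
  - by apply: measurable_funX; case: fphi.
  - exact: measurable_bad_set.
  - by apply: Omega_fin; [exact: measurable_bad_set|move=> x []].
  - move=> x; rewrite ger0_norm ?sqr_ge0// lerXn2r ?nnegrE//.
    exact: le_trans (phi_le x).
  - by move=> x nb; rewrite /phi neg_half_out// expr0n.
have sup : - L * \int[m]_x (phi x ^+ 2) <= form j (w l) phi.
  rewrite (_ : \int[m]_x (phi x ^+ 2) = \int[m]_x (`|w l x| * phi x)).
    apply: (mp_super uP) => //; first by exists M.
    by apply/aeW => x nO; apply: neg_half_out => -[? ? _]; exact: nO.
  apply: eq_Rintegral => x _; rewrite /phi /neg_half; case: ifP => [lx|]; last by rewrite mulr0 expr0n.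
  case: (max0P (w l x)) => -[wx -> _]; first by rewrite mulr0 expr0n.
  by rewrite ltr0_norm// expr2.
have neg := form_neg_half jP (refl_diff_anti l) (refl_diff_energy l) intble0 (fun _ _ => erefl).
have {neg} : form j (w l) phi + form j phi phi + \int[P]_z 0 <= 0.
  apply: neg; apply: filterS (kernel_half_space_ae jP l) => z kz l1 l2.
  by rewrite !mulr_ge0 ?neg_half_ge0 ?le_max ?lexx ?orbT// subr_ge0 kz.
have -> : \int[P]_z 0 = 0 :> R by rewrite /Rintegral integral0.
rewrite addr0 => neg.
have := poinc _ phi (measurable_bad_set l) bad_small fphi (@neg_half_out l).
rewrite -EFin_Rintegral; last exact: intbleZ.
rewrite lee_fin RintegralZl// => poi.
have I0 : \int[m]_x (phi x ^+ 2) <= 0 by lra.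
have phi2_ge0 : {ae m, forall x : X, 0 <= phi x ^+ 2} by apply/aeW => x; exact: sqr_ge0.
have := Rintegral_eq0_ae iphi2 phi2_ge0 I0.
apply: filterS => x /eqP; rewrite sqrf_eq0 => /eqP + lx.
rewrite /phi /neg_half lx; case: (max0P (w l x)) => -[// wx -> _ w0].
by rewrite -oppr_le0 w0.
Qed.

Section strong.
Variable l : R.
Hypothesis l_gt0 : 0 < l.
Hypothesis w_ge0 : {ae m, forall x : X, l < hd (x : V) -> 0 <= w l x}.

(** A radius, for the maximum norm, at which the kernel is strictly decreasing: the
    Euclidean norm of n coordinates below r0 / (n + 1) is at most r0. *)
Definition reach : R := r0 / n.+1%:R.

Lemma reach_gt0 : 0 < reach. Proof. by rewrite divr_gt0. Qed.

Lemma reachP x y : ball x reach y -> `|hd (x - y)| < r0 /\ enorm (tl (x - y)) <= r0.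
Proof.
move=> /(ball_rVP _ _ reach_gt0) xy.
have n1 : 1 <= n.+1%:R :> R by rewrite ler1n.
have xyi i : `|(x - y) ord0 i| < reach by rewrite !mxE.
split.
  apply: (lt_le_trans (xyi ord0)).
  by rewrite /reach ler_pdivrMr// ler_peMr// (ltW r0_gt0).
rewrite -(@ler_pXn2r _ 2 _ (enorm _))// ?nnegrE ?sqrtr_ge0 ?(ltW r0_gt0)// enorm_sqr.
apply: (@le_trans _ _ (\sum_(i < n) reach ^+ 2)).
  apply: ler_sum => i _; rewrite tl_coord -[X in X <= _](real_normK (num_real _)).
  by rewrite lerXn2r ?nnegrE ?(ltW reach_gt0)// ltW.
rewrite sumr_const card_ord -[leLHS]mulr_natl /reach expr_div_n mulrCA.
rewrite -[leRHS]mulr1 ler_wpM2l ?sqr_ge0// ler_pdivrMr ?exprn_gt0// mul1r.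
have nn : n%:R <= n.+1%:R :> R by rewrite ler_nat.
by rewrite expr2; nra.
Qed.

(** The positive mass of w near x0 that pushes the solution up. Subtracting e
    leaves room for a perturbation of w by an odd function of size at most e. *)
Definition near_positive_part (x0 : V) (e : R) (x : X) : R :=
  if (l < hd (x : V)) && `[< ball x0 reach x >] then Num.max 0 (w l x - e) else 0.

Lemma near_positive_part_ge0 x0 e x : 0 <= near_positive_part x0 e x.
Proof. by rewrite /near_positive_part; case: ifP => // _; rewrite le_max lexx. Qed.

Lemma near_positive_part_le x0 e x : 0 <= e -> near_positive_part x0 e x <= M.
Proof.
move=> e0; have := refl_diff_norm l x; rewrite ler_norml => /andP[_ wM].
have M0 : 0 <= M := le_trans (normr_ge0 _) (refl_diff_norm l x).
rewrite /near_positive_part; case: ifP => // _; rewrite ge_max M0/=; lra.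
Qed.

Lemma measurable_near_positive_part x0 e :
  measurable_fun [set: X] (near_positive_part x0 e).
Proof.
apply: measurable_fun_ifT => //.
  apply: measurable_and.
    by apply: measurable_fun_ltr => //; exact: measurable_hd.
  apply: (measurable_fun_bool true).
  rewrite setTI (_ : _ @^-1` _ = ball x0 reach); last first.
    by apply/seteqP; split => x /=; [move/asboolP|move=> xb; apply/asboolP].
  exact: (open_measurable_rV (ball_open _ _)).
apply: measurable_maxr => //; apply: measurable_funB => //.
exact: measurable_refl_diff.
Qed.

Lemma near_positive_part_support x0 e x : near_positive_part x0 e x != 0 ->
  l < hd x /\ ball x0 reach x.
Proof.
by rewrite /near_positive_part; case: ifP => [/andP[lx /asboolP]|]; rewrite ?eqxx.
Qed.

Lemma ball_cube x0 (e : R) : 0 < e -> ball x0 e `<=` cube (enorm x0 + e).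
Proof.
move=> e0 x /(ball_rVP _ _ e0) xe i.
have xi : `|x0 ord0 i| <= enorm x0.
  rewrite -(@ler_pXn2r _ 2)// ?nnegrE ?sqrtr_ge0// enorm_sqr real_normK ?num_real//.
  exact: coord_sqnorm.
have := xe i; rewrite distrC => {}xe.
rewrite -[x ord0 i](subrK (x0 ord0 i)) addrC.
by apply: (le_lt_trans (ler_normD _ _)); rewrite ler_ltD.
Qed.

Lemma near_positive_part_cube x0 e x : ~ cube (enorm x0 + reach) x ->
  near_positive_part x0 e x = 0.
Proof.
apply: contra_notP => /eqP/near_positive_part_support[_].
exact: ball_cube reach_gt0 _.
Qed.

Lemma near_positive_part_intble x0 e : 0 <= e -> intble m (near_positive_part x0 e).
Proof.
move=> e0; apply: (@intble_bounded_support _ _ _ (cube (enorm x0 + reach)) M).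
- exact: measurable_near_positive_part.
- exact: measurable_cube.
- exact: cube_fin.
- by move=> x; rewrite ger0_norm ?near_positive_part_ge0// near_positive_part_le.
- exact: near_positive_part_cube.
Qed.

(** The translation is moved onto the integrable factor, where it is continuous in
    L^1; the other factor only has to be bounded. *)
Lemma convolution_continuous (F kap : X -> R) (K : R) x0 (eta : R) :
  translation_continuous F -> intble m F -> measurable_fun [set: X] kap ->
  (forall z, `|kap z| <= K) -> 0 < eta ->
  exists2 d, 0 < d & forall y, (forall i, `|y ord0 i - x0 ord0 i| < d) ->
   `|\int[m]_x (F x * kap (y - (x : V))) - \int[m]_x (F x * kap (x0 - (x : V)))| <= eta.
Proof.
move=> [mF tF] iF mk kK eta0.
have K0 : 0 <= K := le_trans (normr_ge0 _) (kK 0).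
have e0 : 0 < eta / (K + 1) by rewrite divr_gt0// ltr_wpDl.
have [d d0 Fd] := tF _ e0; exists d => // y yd.
have iFk y' : intble m (fun x : X => F x * kap (y' - (x : V))).
  apply: (@le_intble _ _ _ _ _ (fun x : X => K * `|F x|)).
  - apply: measurable_funM => //; exact: (measurableT_comp mk (sub_measurable y')).
  - by move=> x; rewrite normrM mulrC ler_wpM2r.
  - by apply: intbleZ; exact: intble_norm.
have sub2 y' : intble m (fun t : X => F (y' - (t : V)) * kap t) /\
    \int[m]_x (F x * kap (y' - (x : V))) = \int[m]_t (F (y' - (t : V)) * kap t).
  rewrite -(preserving_Rintegral (sub_measurable y') (@sub_preserving R n y') (iFk y')).
  have E : (fun t : X => F (y' - (t : V)) * kap t) =
      (fun x : X => F x * kap (y' - (x : V))) \o (fun x : X => y' - (x : V) : X).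
    by apply/funext => t /=; rewrite subKr.
  split; first by rewrite E; exact: (preserving_intble (sub_measurable y') (@sub_preserving R n y') (iFk y')).
  by apply: eq_Rintegral => t _; rewrite /= subKr.
have [iy ->] := sub2 y; have [ix ->] := sub2 x0.
rewrite -RintegralB//.
have iD := intbleB iy ix.
pose a : V := y - x0.
have iFa : intble m (fun s : X => F ((s : V) + a) - F s).
  by apply: intbleB => //; exact: (preserving_intble (measurable_shift a) (@shift_preserving _ _ a) iF).
have iN := intble_norm iFa.
have iNS := preserving_intble (sub_measurable x0) (@sub_preserving R n x0) iN.
have := le_normr_Rintegral measurableT iD; move=> /le_trans; apply.
apply: (@le_trans _ _ (\int[m]_t (K * `|F (((x0 - (t : V)) : V) + a) - F (x0 - (t : V))|))).
  apply: le_Rintegral => //; [exact: intble_norm|exact: (intbleZ K iNS)|].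
  move=> t _; rewrite -mulrBl normrM mulrC.
  rewrite (_ : x0 - (t : V) + a = y - (t : V)); last by rewrite [LHS]addrC addrA subrK.
  by rewrite ler_wpM2r.
rewrite (RintegralZl K _ iNS)// (preserving_Rintegral (sub_measurable x0) (@sub_preserving R n x0) iN).
apply: (@le_trans _ _ (K * (eta / (K + 1)))).
  apply: ler_wpM2l => //; rewrite -lee_fin EFin_Rintegral//.
  by apply: Fd => i; rewrite !mxE.
by rewrite mulrA ler_pdivrMr ?ltr_wpDl// mulrC ler_pM2l// lerDl.
Qed.

Definition trunc_kernel (k : nat) (z : X) : R := Num.min (j z) k%:R.

Lemma measurable_trunc_kernel k : measurable_fun [set: X] (trunc_kernel k).
Proof. by apply: measurable_minr => //; exact: kernel_measurable jP. Qed.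

Lemma trunc_kernel_norm k z : `|trunc_kernel k z| <= k%:R.
Proof.
by rewrite ger0_norm /trunc_kernel ?ge_min ?lexx ?orbT// le_min (kernel_ge0 jP) ler0n.
Qed.

(** The gain density: the net interaction of y with the mass near x0 and its mirror
    image. The truncation of the kernel makes it a convolution with a bounded
    function, continuous in y. *)
Definition push (x0 : V) (e : R) (k : nat) (y : V) : R :=
  \int[m]_x (near_positive_part x0 e x *
    (trunc_kernel k (y - (x : V)) - trunc_kernel k (y - refl l x))).

Lemma measurable_kernel_gap k y : measurable_fun [set: X] (fun x : X =>
  trunc_kernel k (y - (x : V)) - trunc_kernel k (y - refl l x)).
Proof.
have mk := measurable_trunc_kernel k.
have m1 := measurableT_comp mk (sub_measurable y).
exact: (measurable_funB m1 (measurableT_comp m1 (measurable_refl l))).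
Qed.

Lemma kernel_gap_norm k y x :
  `|trunc_kernel k (y - x) - trunc_kernel k (y - refl l x)| <= 2 * k%:R.
Proof.
rewrite (le_trans (ler_normB _ _))// (_ : 2 * k%:R = k%:R + k%:R); last by ring.
by rewrite lerD// trunc_kernel_norm.
Qed.

Lemma push_intble x0 e k y : 0 <= e -> intble m (fun x : X => near_positive_part x0 e x *
    (trunc_kernel k (y - (x : V)) - trunc_kernel k (y - refl l x))).
Proof.
move=> e0; apply: (@le_intble _ _ _ _ _ (fun x : X => 2 * k%:R * near_positive_part x0 e x)).
- by apply: measurable_funM; [exact: measurable_near_positive_part|exact: measurable_kernel_gap].
- move=> x; rewrite normrM mulrC (ger0_norm (near_positive_part_ge0 _ _ _)).
  by rewrite ler_wpM2r ?near_positive_part_ge0// kernel_gap_norm.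
- by apply: intbleZ; exact: near_positive_part_intble.
Qed.

Lemma kernel_gap_ae x0 : l < hd x0 -> {ae m, forall x : X, l < hd (x : V) ->
  j (x0 - refl l x) <= j (x0 - (x : V)) /\
  (ball x0 reach x -> j (x0 - refl l x) < j (x0 - (x : V)))}.
Proof.
move=> lx0; have mo := preserving_ae (sub_measurable x0) (@sub_preserving R n x0) (kernel_mono jP).
have st := preserving_ae (sub_measurable x0) (@sub_preserving R n x0) (kernel_strict jP).
move: (ae_and mo st); apply: filterS => x [kmo kst] lx.
have tle : tl (x0 - refl l x) = tl (x0 - x) by rewrite !hdtlE.
have hle : `|hd (x0 - x)| < `|hd (x0 - refl l x)|.
  rewrite !hdtlE [ltRHS]ger0_norm ?ltr_norml; last by lra.
  by apply/andP; split; lra.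
split; first by apply: kmo => //; exact: ltW.
by move=> /reachP[? ?]; apply: kst.
Qed.

(** If no truncation level and no threshold e produced a positive gain, then the
    integrands would vanish for all of them, and by strict monotonicity of the
    kernel w would vanish near x0. *)
Lemma push_gt0 x0 : l < hd x0 ->
  ~ {ae m, forall x : X, ball x0 reach x -> l < hd (x : V) -> w l x = 0} ->
  exists e k, 0 < e /\ 0 < push x0 e k x0.
Proof.
move=> lx0; apply: contra_notP => nex.
pose e (i : nat) : R := i.+1%:R^-1.
have e0 i : 0 < e i by rewrite invr_gt0.
have gap := kernel_gap_ae lx0.
have H i k : {ae m, forall x : X, near_positive_part x0 (e i) x *
    (trunc_kernel k (x0 - (x : V)) - trunc_kernel k (x0 - refl l x)) = 0}.
  apply: Rintegral_eq0_ae; first by apply: push_intble; exact: ltW.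
    apply: filterS gap => x gapx.
    have [->|/near_positive_part_support[lx _]] := eqVneq (near_positive_part x0 (e i) x) 0.
      by rewrite mul0r.
    rewrite mulr_ge0 ?near_positive_part_ge0// subr_ge0 /trunc_kernel.
    by have [jle _] := gapx lx; rewrite le_min !ge_min jle lexx/= orbT.
  by rewrite leNgt; apply/negP => Ipos; apply: nex; exists (e i), k.
have {}H := ae_foralln (fun i => ae_foralln (H i)).
move: (ae_and H (ae_and gap w_ge0)); apply: filterS => x [Hx [gapx wx0]] xb lx.
have w0 := wx0 lx; have [_ /(_ xb) jlt] := gapx lx.
apply/eqP; rewrite eq_le w0 andbT leNgt; apply/negP => wpos.
pose i := Num.truncn (w l x)^-1.
have ei : e i < w l x by rewrite /e invf_plt ?posrE// truncnS_gt.
have ppos : 0 < near_positive_part x0 (e i) x.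
  rewrite /near_positive_part lx/= ifT; last exact/asboolP.
  by rewrite lt_max subr_gt0 ei orbT.
pose k := (Num.truncn (j (x0 - x))).+1.
have /eqP := Hx i k; rewrite mulf_eq0 gt_eqF//= subr_eq0 => /eqP.
rewrite /trunc_kernel (min_idPl (ltW (truncnS_gt _))) => je.
by move: jlt; rewrite je lt_min ltxx.
Qed.

(** Reflecting the integration variable writes the gain as a difference of two
    convolutions with the truncated kernel, both continuous. *)
Lemma push_lower_bound x0 e k : 0 <= e -> 0 < push x0 e k x0 ->
  exists2 d, 0 < d & forall y, (forall i, `|y ord0 i - x0 ord0 i| < d) ->
    push x0 e k x0 / 2 <= push x0 e k y.
Proof.
move=> e0 p0; set psi := near_positive_part x0 e.
have c0' : 0 < enorm x0 + reach by rewrite ltr_wpDl ?sqrtr_ge0 ?reach_gt0.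
have ipsi : intble m psi := near_positive_part_intble x0 e0.
have tpsi : translation_continuous psi.
  apply: (translation_continuous_integrable c0' ipsi) => x; exact: near_positive_part_cube.
have mr := @measurable_refl R n l; have pr := @refl_preserving R n l.
have ipsir : intble m (psi \o refl l) := preserving_intble mr pr ipsi.
have tpsir : translation_continuous (psi \o refl l).
  apply: (@translation_continuous_integrable _ _ (enorm x0 + reach + `|2 * l|) _ _ ipsir).
    by rewrite ltr_wpDr.
  move=> x xc; apply: near_positive_part_cube => xr; apply: xc => i.
  case: (unliftP ord0 i) => [h ->|->].
    rewrite -tl_coord -(tl_refl l) tl_coord; apply: (lt_le_trans (xr _)).
    by rewrite lerDl.
  have := xr ord0; rewrite -!/(hd _) hd_refl => xr0.
  rewrite (_ : hd x = 2 * l - (2 * l - hd x)); last by ring.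
  by apply: (le_lt_trans (ler_normB _ _)); rewrite addrC ltr_leD.
have p4 : 0 < push x0 e k x0 / 4 by rewrite divr_gt0.
have mk := measurable_trunc_kernel k; have nk := trunc_kernel_norm k.
have [d1 d10 H1] := convolution_continuous x0 tpsi ipsi mk nk p4.
have [d2 d20 H2] := convolution_continuous x0 tpsir ipsir mk nk p4.
exists (Num.min d1 d2); first by rewrite lt_min d10.
have split_push y : push x0 e k y = \int[m]_x (psi x * trunc_kernel k (y - (x : V))) -
    \int[m]_x ((psi \o refl l) x * trunc_kernel k (y - (x : V))).
  have mkd := measurableT_comp mk (sub_measurable y).
  have prod (F : X -> R) : intble m F -> intble m (fun x : X => F x * trunc_kernel k (y - (x : V))).
    move=> iF; apply: (@le_intble _ _ _ _ _ (fun x : X => k%:R * `|F x|)).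
    - by apply: measurable_funM => //; exact: intble_measurable iF.
    - by move=> x; rewrite normrM mulrC ler_wpM2r.
    - by apply: intbleZ; exact: intble_norm.
  have i1 := prod _ ipsi; have i2 := prod _ ipsir.
  rewrite -(preserving_Rintegral mr pr i2) -RintegralB//; last first.
    exact: (preserving_intble mr pr i2).
  by apply: eq_Rintegral => x _; rewrite /= reflK mulrBr.
move=> y yd.
have y1 i : `|y ord0 i - x0 ord0 i| < d1 by move: (yd i); rewrite lt_min => /andP[].
have y2 i : `|y ord0 i - x0 ord0 i| < d2 by move: (yd i); rewrite lt_min => /andP[].
have := H1 y y1; have := H2 y y2; move: p0; rewrite !split_push.
move: (Rintegral _ _ _) (Rintegral _ _ _) (Rintegral _ _ _) (Rintegral _ _ _) => a b c d.
by rewrite !ler_norml => ? /andP[? ?] /andP[? ?]; lra.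
Qed.

(** The basic inequality is applied to v = w - eps G with G an odd bump. Its test
    function phi = 1_H v^- lives where the bump is positive and w <= eps, so the
    reaction term and B(G, phi) cost at most a multiple of int phi; the gain is at
    least theta int phi. For small eps, phi = 0, that is w >= eps G. *)
Lemma strong_maximum_principle_local x0 : Omega x0 -> l < hd x0 ->
  ~ {ae m, forall x : X, ball x0 reach x -> l < hd (x : V) -> w l x = 0} ->
  exists rho c, [/\ 0 < rho, 0 < c & {ae m, forall x : X, ball x0 rho x -> c <= w l x}].
Proof.
move=> Ox0 lx0 nw0; have [e [k [e0 p0]]] := push_gt0 lx0 nw0.
have [d d0 pushd] := push_lower_bound (ltW e0) p0.
set theta := push x0 e k x0 / 2 in pushd.
have theta0 : 0 < theta by rewrite divr_gt0.
have /nbhs_ballP[rr /= rr0 Orr] := open_nbhs_nbhs (conj oOmega Ox0).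
pose rho := Num.min d (Num.min rr ((hd x0 - l) / 2)).
have rho0 : 0 < rho by rewrite !lt_min d0 rr0/= divr_gt0// subr_gt0.
have rho_d : rho <= d by rewrite /rho ge_min lexx.
have rho_rr : rho <= rr by rewrite /rho !ge_min lexx !orbT.
have rho_l : rho <= (hd x0 - l) / 2 by rewrite /rho !ge_min lexx !orbT.
pose b := bump x0 rho; pose G := odd_bump x0 rho l.
have bO x : b x != 0 -> Omega x.
  by move=> /(bump_ball rho0) xb; apply: Orr; exact: le_ball xb.
pose C := 4 * (1 + (rho ^+ 2)^-1) * \int[m]_z levy_density j z.
have C0 : 0 <= C.
  rewrite mulr_ge0 ?mulr_ge0 ?addr_ge0 ?invr_ge0 ?sqr_ge0//.
  by apply: Rintegral_ge0 => z _; exact: (levy_density_ge0 jP).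
have LC : 0 < L + C + 1 by rewrite ltr_wpDl// addr_ge0.
pose eps := Num.min e (theta / (L + C + 1)).
have eps0 : 0 < eps by rewrite lt_min e0 divr_gt0.
have eps_e : eps <= e by rewrite /eps ge_min lexx.
have eps_theta : eps * (L + C) < theta.
  have : eps * (L + C + 1) <= theta by rewrite -ler_pdivlMr// /eps ge_min lexx orbT.
  by lra.
pose v x := w l x - eps * G x.
have v_anti x : v (refl l x) = - v x.
  by rewrite /v refl_diff_anti /G odd_bump_refl; ring.
have fG : fin_energy j G := fin_energy_odd_bump x0 rho0 jP l.
have fw := refl_diff_energy l.
have feG := fin_energyZ eps fG.
have fv : fin_energy j v := fin_energyB jP fw feG.
pose phi := neg_half l v.
have fphi : fin_energy j phi := fin_energy_neg_half jP v_anti fv.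
have phi0 x : 0 <= phi x := neg_half_ge0 l v x.
have vM x : `|v x| <= M + eps.
  apply: (le_trans (ler_normB _ _)); apply: lerD; first exact: refl_diff_norm.
  by rewrite normrM (gtr0_norm eps0) -[leRHS]mulr1 ler_pM2l// odd_bump_norm.
have M0 : 0 <= M := le_trans (normr_ge0 _) (refl_diff_norm l x0).
have phi_le x : phi x <= M + eps.
  rewrite /phi /neg_half; case: ifP => _; last by rewrite addr_ge0// ltW.
  rewrite ge_max (le_trans _ (vM x)) ?addr_ge0 ?(ltW eps0)//.
  by rewrite -normrN ler_norm.
have phiP x : phi x != 0 -> l < hd x /\ v x < 0.
  rewrite /phi /neg_half; case: ifP => [lx|]; last by rewrite eqxx.
  by case: (max0P (v x)) => -[vx -> _]; rewrite ?eqxx.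
have vE x : l < hd x -> v x = w l x - eps * b x.
  by move=> lx; rewrite /v /G (odd_bump_half_space rho0 rho_l lx).
have phi_out x : ~ Omega x -> phi x = 0.
  move=> nO; apply/eqP; apply: contraT => /phiP[lx].
  rewrite vE//; have -> : b x = 0 by apply/eqP; apply: contraT => /bO.
  by rewrite mulr0 subr0 ltNge refl_diff_out.
have iphi : intble m phi.
  apply: (@intble_bounded_support _ _ _ (Omega : set X) (M + eps)) => //.
  - by case: fphi.
  - exact: Omega_fin.
  - by move=> x; rewrite ger0_norm.
have phi_b : {ae m, forall x : X, phi x != 0 -> [/\ l < hd (x : V), b x != 0 & `|w l x| <= eps]}.
  apply: filterS w_ge0 => x wx /phiP[lx]; have {}wx := wx lx; rewrite vE// => vx.
  have bx1 := bump_le1 x0 rho x; split => //.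
    by apply: contraTneq vx => ->; rewrite mulr0 subr0 -leNgt.
    rewrite ger0_norm// (le_trans (_ : _ <= eps * b x))//.
      by rewrite ltW// -subr_lt0.
    by rewrite ger_pMr.
have sup : - L * \int[m]_x (`|w l x| * phi x) <= form j (w l) phi.
  apply: (mp_super uP) => //; first by exists (M + eps).
  apply: filterS phi_b => x bx nO; apply/eqP; apply: contraT => px.
  by have [lx /bO Ox _] := bx px; exfalso; apply: nO.
have mw := measurable_refl_diff l.
have mphi : measurable_fun [set: X] phi by case: fphi.
have iwphi : intble m (fun x => `|w l x| * phi x).
  apply: (@le_intble _ _ _ _ _ (fun x : X => M * phi x)).
  - by apply: measurable_funM => //; exact: measurableT_comp.
  - by move=> x; rewrite normrM normr_id (ger0_norm (phi0 x)) ler_wpM2r// refl_diff_norm.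
  - exact: intbleZ.
have wphi_le : \int[m]_x (`|w l x| * phi x) <= eps * \int[m]_x phi x.
  rewrite -RintegralZl//; apply: le_Rintegral_ae => //; first exact: intbleZ.
  apply: filterS phi_b => x bx; have [->|/bx[_ _ wx]] := eqVneq (phi x) 0.
    by rewrite !mulr0.
  by rewrite ler_wpM2r.
have formG : form j G phi <= C * \int[m]_x phi x.
  apply: (form_second_difference_le jP fG (odd_bump_norm x0 rho l) fphi iphi phi0).
  apply: filterS phi_b => x bx /bx[_ bx0 _] z.
  exact: (odd_bump_second_difference rho0 rho_l).
(* phi is supported in the bump only almost everywhere; phi' is so everywhere,
   as the lower bound for the gain holds only near x0 *)
pose phi' (y : X) := if sqnorm ((y : V) - x0) < rho ^+ 2 then phi y else 0.
have phi'0 y : 0 <= phi' y by rewrite /phi'; case: ifP.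
have phi'_le y : phi' y <= phi y by rewrite /phi'; case: ifP.
have mphi' : measurable_fun [set: X] phi'.
  apply: measurable_fun_ifT => //; apply: measurable_fun_ltr => //.
  apply: (measurableT_comp (f := fun x : X => sqnorm (x : V)) _ (measurable_shift (- x0))).
  by apply: measurable_sum => i; apply: measurable_funX; exact: measurable_coord.
have iphi' : intble m phi'.
  by apply: (le_intble mphi' _ iphi) => x; rewrite ger0_norm.
have phi'E : \int[m]_x phi' x = \int[m]_x phi x.
  apply: Rintegral_ae_eq => //; apply: filterS phi_b => x bx; rewrite /phi'.
  case: ifPn => // nx; apply/eqP; rewrite eq_sym; apply: contraNT nx => /bx[_ bx0 _].
  exact: (bump_support rho0).
pose psi := near_positive_part x0 e.
have ipsi : intble m psi := near_positive_part_intble x0 (ltW e0).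
have psi0 x : 0 <= psi x := near_positive_part_ge0 x0 e x.
pose gap (z : X * X) := trunc_kernel k ((z.1 : V) - (z.2 : V)) -
  trunc_kernel k ((z.1 : V) - refl l z.2).
have mgap : measurable_fun [set: X * X] gap.
  have mk := measurableT_comp (measurable_trunc_kernel k) (@measurable_diff R n).
  by have [m2 _] := @refl2_preserving R n l; exact: (measurable_funB mk (measurableT_comp mk m2)).
pose D (z : X * X) := phi' z.1 * psi z.2 * gap z.
have iD : intble P D.
  apply: (@le_intble _ _ _ _ _ (fun z : X * X => 2 * k%:R * (phi' z.1 * psi z.2))).
  - apply: measurable_funM => //; apply: measurable_funM.
      exact: measurable_arg1.
    by apply: measurable_arg2; exact: intble_measurable ipsi.
  - move=> z; have pp : 0 <= phi' z.1 * psi z.2 by rewrite mulr_ge0.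
    rewrite /D normrM mulrC (ger0_norm pp) ler_wpM2r//; exact: kernel_gap_norm.
  - by apply: intbleZ; exact: intble_tensor.
have D0 z : ~~ ((l < hd (z.1 : V)) && (l < hd (z.2 : V))) -> D z = 0.
  rewrite negb_and => /orP[/negP h|/negP h].
    rewrite /D (_ : phi' z.1 = 0) ?mul0r//; apply/eqP; apply: contraT => h1.
    have : phi z.1 != 0 by apply: contraNneq h1 => h2; rewrite eq_le phi'0 -{1}h2 phi'_le.
    by case/phiP.
  rewrite /D (_ : psi z.2 = 0) ?mulr0 ?mul0r//; apply/eqP; apply: contraT.
  by case/near_positive_part_support.
have leD : {ae P, forall z : X * X, l < hd (z.1 : V) -> l < hd (z.2 : V) ->
    D z <= neg_half l v z.1 * Num.max (v z.2) 0 *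
      (j ((z.1 : V) - (z.2 : V)) - j ((z.1 : V) - refl l z.2))}.
  apply: filterS (kernel_half_space_ae jP l) => z kz l1 l2; have {}kz := kz l1 l2.
  have gap0 : 0 <= gap z.
    by rewrite subr_ge0 /trunc_kernel le_min !ge_min kz lexx !orbT.
  have gap_le : gap z <= j ((z.1 : V) - (z.2 : V)) - j ((z.1 : V) - refl l z.2).
    exact: minr_sub_le.
  have psi_le : psi z.2 <= Num.max (v z.2) 0.
    rewrite /psi /near_positive_part; case: ifP => _; last by rewrite le_max lexx orbT.
    rewrite maxC ge_max !le_max lexx orbT andbT; apply/orP; left.
    rewrite /v lerD2l lerN2 (le_trans _ eps_e)// -[leRHS]mulr1 ler_pM2l//.
    by apply: (le_trans (ler_norm _)); exact: odd_bump_norm.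
  by apply: ler_pM => //; [rewrite mulr_ge0|apply: ler_pM => //; exact: phi'_le].
have key := form_neg_half jP v_anti fv iD D0 leD.
have IDge : theta * \int[m]_x phi x <= \int[P]_z D z.
  rewrite -phi'E -RintegralZl//; apply: Rintegral_product_ge => //; first exact: intbleZ.
  move=> y.
  rewrite (eq_integral (fun x : X => (phi' y * (psi x * gap (y, x)))%:E)); last first.
    by move=> x _; rewrite /D/= mulrA.
  have ipush := push_intble x0 k y (ltW e0).
  rewrite -EFin_Rintegral; last exact: (intbleZ (phi' y) ipush).
  rewrite (RintegralZl _ measurableT ipush) lee_fin mulrC.
  have [->|py] := eqVneq (phi' y) 0; first by rewrite !mul0r.
  rewrite ler_wpM2l//; apply: pushd => i.
  move: py; rewrite /phi'; case: ifP => [/(sqnorm_ltP rho0)/(_ i)|]; last by rewrite eqxx.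
  by rewrite !mxE => h _; exact: lt_le_trans h rho_d.
have vform : form j v phi = form j (w l) phi - eps * form j G phi.
  by rewrite /v (formB jP fw feG fphi) (formZ jP _ fG fphi).
have phi_form : 0 <= form j phi phi.
  by apply: Rintegral_ge0 => z _; exact: (energy_density_ge0 jP).
have I0 : \int[m]_x phi x <= 0.
  have Iphi : 0 <= \int[m]_x phi x by apply: Rintegral_ge0 => x _.
  move: key; rewrite vform; move: (\int[m]_x phi x) wphi_le formG IDge sup Iphi.
  move: (Rintegral _ _ _) (form j G phi) (form j (w l) phi) phi_form.
  move: (form j phi phi) (Rintegral P _ _) => fpp ID Iw fG' fw' fpp0 I h1 h2 h3 h4 h5 h6.
  exact: (absorption eps0 L_ge0 eps_theta fpp0 h1 h2 h3 h4 h6).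
have phi_ge0 : {ae m, forall x : X, 0 <= phi x} by apply/aeW => x; exact: phi0.
have phi_ae0 := Rintegral_eq0_ae iphi phi_ge0 I0.
exists (rho / (2 * n.+1%:R)), (eps / 2); split.
- by rewrite divr_gt0// mulr_gt0.
- by rewrite divr_gt0.
apply: filterS phi_ae0 => x px xb.
have rn0 : 0 < rho / (2 * n.+1%:R) by rewrite divr_gt0// mulr_gt0.
have sx : sqnorm (x - x0) <= rho ^+ 2 / 2.
  apply: sqnorm_small; first exact: ltW.
  by move=> i; rewrite !mxE distrC; move: i; apply/ball_rVP.
have bx : 1 / 2 <= b x := bump_ge_half rho0 sx.
have bx0 : b x != 0 by rewrite gt_eqF// (lt_le_trans _ bx)// divr_gt0.
have lx := bump_half_space rho0 rho_l bx0.
have : 0 <= v x.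
  rewrite leNgt; apply/negP => vx; move: px; rewrite /phi /neg_half lx.
  case: (max0P (v x)) => -[vx0 -> _]; first by move: vx; rewrite ltNge vx0.
  by move/eqP; rewrite oppr_eq0 (lt_eqF vx).
rewrite vE// subr_ge0; apply: le_trans.
by rewrite -[leLHS]/(eps * 2^-1) -[2^-1]div1r ler_pM2l.
Qed.

End strong.
End maximum_principles.

(** * Moving planes *)

Section moving_planes.
Variables (R : realType) (n : nat).
Local Notation V := 'rV[R]_n.+1.
Local Notation X := (borel_rV R n.+1).
Local Notation m := (borel_lebesgue R n.+1).
Implicit Types (x y : V).

Lemma open_refl l (U : set V) : open U -> open (refl l @^-1` U).
Proof.
move=> oU; rewrite openE => x Ux.
have /nbhs_ballP[e /= e0 xe] := open_nbhs_nbhs (conj oU Ux).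
apply/nbhs_ballP; exists e => //= y /(ball_rVP _ _ e0) xy.
apply: xe; apply/(ball_rVP _ _ e0) => i; case: (unliftP ord0 i) => [h ->|->].
  by rewrite -!tl_coord !tl_refl !tl_coord; exact: xy.
rewrite -!/(hd _) !hd_refl (_ : _ - _ = hd y - hd x); last by ring.
by rewrite distrC; exact: xy.
Qed.

Lemma open_half_space (l : R) : open [set x : V | l < hd x].
Proof.
apply: (@open_comp _ _ (@hd R n) [set t : R | l < t]); last exact: open_gt.
by move=> x _; exact: coord_continuous.
Qed.

Lemma ball_not_negligible x0 (e : R) : 0 < e ->
  {ae m, forall x : X, ~ ball x0 e x} -> False.
Proof.
move=> e0 aeb.
have bE : ball x0 e = box (fun i => `]x0 ord0 i - e, x0 ord0 i + e[%classic).
  apply/seteqP; split => x.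
    by move/(ball_rVP _ _ e0) => xe i; rewrite /= in_itv/= -ltr_distlC.
  by move=> xe; apply/(ball_rVP _ _ e0) => i; have := xe i; rewrite /= in_itv/= -ltr_distlC.
have mb : measurable (ball x0 e : set X) := open_measurable_rV (ball_open _ _).
have : m.-negligible (ball x0 e : set X) by apply: negligibleS aeb => x xb /(_ xb).
move/(negligibleP m mb); apply/eqP; rewrite gt_eqF//.
rewrite bE [X in (0 < X)%E](_ : _ = (\prod_(i < n.+1)
    lebesgue_measure (`](x0 ord0 i - e)%R, (x0 ord0 i + e)%R[%classic : set R))%E); last first.
  by apply: borel_lebesgue_box => i; exact: measurable_itv.
elim/big_ind : _ => [|a b a0 b0|i _]; first by rewrite lte01.
  exact: mule_gt0.
rewrite lebesgue_measure_itv/= lte_fin ifT -?EFinB ?lte_fin; lra.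
Qed.

Variables (j : X -> R) (r0 : R).
Hypothesis jP : kernel_spec j r0.
Hypothesis r0_gt0 : 0 < r0.
Variables (Omega : set V) (c0 : R).
Hypothesis oOmega : open Omega.
Hypothesis Omega_cube : Omega `<=` cube c0.
Hypothesis Omega_sym : forall x (s : R), Omega x -> -1 <= s <= 1 ->
  Omega (cons_rV (s * hd x) (tl x)).
Variables (u : X -> R) (M L : R).
Hypothesis uP : moving_plane_data j Omega u M L.
Hypothesis L_ge0 : 0 <= L.
Local Notation w := (refl_diff u).

Lemma Omega_hd x (t : R) : Omega x -> `|t| <= `|hd x| -> Omega (cons_rV t (tl x)).
Proof. by move=> Ox /cons_rV_scale[s s1 ->]; exact: Omega_sym. Qed.

(** Suppose that w vanishes in H around some point of the cap. Among such points
    take x with first coordinate within eta of the supremum, and step to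
    y0 = x + eta e_1. Points near y0 are beyond the supremum, so they cannot lie in
    Omega, and their reflections do; there w = u o r_l > 0, although w = 0. *)
Lemma strong_maximum_principle l : 0 < l ->
  {ae m, forall x : X, l < hd (x : V) -> 0 <= w l x} ->
  forall x0, Omega x0 -> l < hd x0 ->
  exists rho c, [/\ 0 < rho, 0 < c & {ae m, forall x : X, ball x0 rho x -> c <= w l x}].
Proof.
move=> l0 w_ge0 x0 Ox0 lx0.
pose rch := reach n r0.
have rch0 : 0 < rch := reach_gt0 n r0_gt0.
pose vanish (y : V) := {ae m, forall x : X, ball y rch x -> l < hd (x : V) -> w l x = 0}.
suff nv y : Omega y -> l < hd y -> ~ vanish y.
  exact: (strong_maximum_principle_local jP r0_gt0 oOmega Omega_cube uP L_ge0 l0 w_ge0 Ox0 lx0 (nv _ Ox0 lx0)).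
move=> Oy ly vy.
pose S := [set t : R | exists x, [/\ Omega x, l < hd x, vanish x & t = hd x]].
have supS : has_sup S.
  split; first by exists (hd y), y.
  exists c0 => t [x [Ox _ _ ->]]; have := Omega_cube Ox ord0.
  by move/ltW; apply: le_trans; exact: ler_norm.
(* eta <= l keeps the reflection of the translated point inside Omega *)
pose eta := Num.min (rch / 2) l.
have eta0 : 0 < eta by rewrite lt_min l0 andbT divr_gt0.
have eta_rch : eta < rch.
  by rewrite /eta gt_min; apply/orP; left; lra.
have eta_l : eta <= l by rewrite /eta ge_min lexx orbT.
have [_ [x [Ox lx vx ->]] supx] := sup_adherent eta0 supS.
pose y0 := x + cons_rV eta 0.
have hy0 : hd y0 = hd x + eta by rewrite !hdtlE hd_cons_rV.
have ty0 : tl y0 = tl x by rewrite !hdtlE tl_cons_rV addr0.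
(* beyond the supremum the domain must be left *)
have outside z : ball x rch z -> sup S < hd z -> l < hd z -> ~ Omega z.
  move=> xz Sz lz Oz.
  have nvz : ~ vanish z.
    move=> vz; have : hd z <= sup S by apply: (ub_le_sup supS.2); exists z.
    by rewrite leNgt Sz.
  have [rho [c [rho0 cc0 wc]]] := strong_maximum_principle_local
    jP r0_gt0 oOmega Omega_cube uP L_ge0 l0 w_ge0 Oz lz nvz.
  have oU : open (ball x rch `&` [set z : V | l < hd z]).
    by apply: openI; [exact: ball_open|exact: open_half_space].
  have /nbhs_ballP[s /= s0 zs] := open_nbhs_nbhs (conj oU (conj xz lz)).
  apply: (@ball_not_negligible z (Num.min rho s)); first by rewrite lt_min rho0.
  move: (ae_and vx wc); apply: filterS => a [va wa] az.
  have [xa la] : (ball x rch `&` [set z : V | l < hd z]) a.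
    by apply: zs; apply: le_ball az; rewrite ge_min lexx orbT.
  have az' : ball z rho a by apply: le_ball az; rewrite ge_min lexx.
  by have := wa az'; rewrite va// leNgt cc0.
have Sx : hd x <= sup S by apply: (ub_le_sup supS.2); exists x.
have Sy0 : sup S < hd y0 by rewrite hy0; lra.
have ly0 : l < hd y0 by apply: (le_lt_trans _ Sy0); apply: le_trans Sx; exact: ltW.
have xy0 : ball x rch y0.
  apply/(ball_rVP _ _ rch0) => i; rewrite [y0 ord0 i]mxE opprD addNKr normrN.
  case: (unliftP ord0 i) => [h ->|->]; first by rewrite cons_rV_lift mxE normr0.
  by rewrite -/(hd _) hd_cons_rV gtr0_norm.
have Ory0 : Omega (refl l y0).
  rewrite /refl ty0; apply: Omega_hd => //; rewrite hy0 [leRHS]gtr0_norm; last by lra.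
  by rewrite ler_norml; apply/andP; split; lra.
have oU : open (ball x rch `&` [set z : V | l < hd z] `&` [set z : V | sup S < hd z]
    `&` (refl l @^-1` Omega)).
  apply: openI; last exact: open_refl.
  by do 2 (apply: openI; last exact: open_half_space); exact: ball_open.
have /nbhs_ballP[s /= s0 sU] := open_nbhs_nbhs (conj oU (conj (conj (conj xy0 ly0) Sy0) Ory0)).
apply: (@ball_not_negligible y0 s s0).
have mr := @measurable_refl R n l; have pr := @refl_preserving R n l.
move: (ae_and vx (preserving_ae mr pr (mp_pos uP))); apply: filterS => a [va pa] ay.
have [[[xa la] Sa] ra] := sU _ ay.
have := pa ra; have := va xa la.
by rewrite /refl_diff (mp_out uP (outside _ xa Sa la)) subr0 => ->; rewrite ltxx.
Qed.

Lemma mp_intble : intble m u.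
Proof.
have [mu _] := mp_energy uP.
apply: (@intble_bounded_support _ _ _ (Omega : set X) M) => //.
- exact: open_measurable_rV.
- apply: (Omega_fin Omega_cube) => //; exact: open_measurable_rV.
- by move=> x; rewrite ger0_norm ?(mp_ge0 uP)// (mp_le uP).
- exact: mp_out uP.
Qed.

(** Reflections in two hyperplanes differ by a translation. *)
Lemma refl_diff_continuous l (eta : R) : 0 < eta -> exists2 d, 0 < d &
  forall k, `|k - l| < d ->
    intble m (fun x => `|w k x - w l x|) /\
    \int[m]_x `|w k x - w l x| <= eta.
Proof.
move=> eta0; have iu := mp_intble; have [mu _] := mp_energy uP.
have c1 : 0 < `|c0| + 1 by rewrite ltr_wpDl.
have [_ /(_ _ eta0)[d d0 ud]] : translation_continuous u.
  apply: (translation_continuous_integrable c1 iu) => x xc; apply: (mp_out uP).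
  move=> /Omega_cube xc0; apply: xc => i; apply: (lt_le_trans (xc0 i)).
  by apply: (le_trans (ler_norm _)); rewrite lerDl.
exists (d / 2) => [|k kl]; first by rewrite divr_gt0.
pose a : V := cons_rV (2 * (k - l)) 0.
have mr := @measurable_refl R n l; have pr := @refl_preserving R n l.
have i1 : intble m (fun x : X => `|u ((x : V) + a) - u x|).
  apply: intble_norm; apply: intbleB => //.
  exact: (preserving_intble (measurable_shift a) (@shift_preserving _ _ a) iu).
have E : (fun x : X => `|w k x - w l x|) = (fun x : X => `|u ((x : V) + a) - u x|) \o refl l.
  apply/funext => x /=; rewrite /refl_diff (refl_shift l k); congr `|_|.
  by rewrite -/a; ring.
rewrite E; split; first exact: (preserving_intble mr pr i1).
rewrite (preserving_Rintegral mr pr i1) -lee_fin EFin_Rintegral//; apply: ud => i.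
case: (unliftP ord0 i) => [h ->|->].
  by rewrite /a cons_rV_lift mxE normr0.
rewrite -/(hd a) /a hd_cons_rV normrM gtr0_norm//; lra.
Qed.

Definition good (l : R) := {ae m, forall x : X, l < hd (x : V) -> 0 <= w l x}.

(** On x_1 > h > l, the negative part of w_l is dominated by |w_k - w_l| for every k
    in (l, h), which tends to 0 in L^1. *)
Lemma good_closed l : 0 <= l -> (forall k, l < k -> good k) -> good l.
Proof.
move=> l0 gk.
suff H i : {ae m, forall x : X, l + i.+1%:R^-1 < hd (x : V) -> 0 <= w l x}.
  have := ae_foralln H; apply: filterS => x Hx lx.
  pose i := Num.truncn (hd x - l)^-1.
  apply: (Hx i); rewrite -ltrBrDl invf_plt ?posrE ?subr_gt0//; exact: truncnS_gt.
set h := l + _.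
have lh : l < h by rewrite ltrDl invr_gt0.
pose F := neg_half h (w l).
have F0 x : 0 <= F x := neg_half_ge0 _ _ x.
have Fout x : ~ Omega x -> F x = 0.
  move=> /(refl_diff_out uP l) w0; rewrite /F /neg_half; case: ifP => // _.
  by apply/max_idPr; rewrite oppr_le0.
have Fle x : F x <= `|w l x|.
  by rewrite /F /neg_half; case: ifP => // _; rewrite ge_max normr_ge0 -normrN ler_norm.
have iF : intble m F.
  apply: (@intble_bounded_support _ _ _ (Omega : set X) M).
  - by apply: measurable_neg_half; exact: (measurable_refl_diff jP uP).
  - exact: open_measurable_rV.
  - apply: (Omega_fin Omega_cube) => //; exact: open_measurable_rV.
  - by move=> x; rewrite ger0_norm// (le_trans (Fle x))// (refl_diff_norm uP).
  - exact: Fout.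
have IF0 : \int[m]_x F x <= 0.
  apply/ler_addgt0Pl => eta eta0; rewrite addr0.
  have [d d0 /= kd] := refl_diff_continuous l eta0.
  pose k := l + Num.min (d / 2) (h - l).
  have k0 : 0 < Num.min (d / 2) (h - l) by rewrite lt_min subr_gt0 lh divr_gt0.
  have kdl : `|k - l| < d.
    by rewrite /k addrC addKr gtr0_norm// gt_min; apply/orP; left; lra.
  have kh : k <= h by rewrite /k -lerBrDl ge_min lexx orbT.
  have [iD Dle] := kd k kdl; apply: le_trans Dle; apply: le_Rintegral_ae => //.
  have lk : l < k by rewrite /k ltrDl.
  have := gk k lk; apply: filterS => x wk.
  rewrite /F /neg_half; case: ifP => // hx.
  have {}wk := wk (le_lt_trans kh hx).
  by rewrite ge_max normr_ge0 andbT (le_trans _ (ler_norm _))//; lra.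
have F0' : {ae m, forall x : X, 0 <= F x} by apply/aeW => x; exact: F0.
have := Rintegral_eq0_ae iF F0' IF0; apply: filterS => x + hx.
rewrite /F /neg_half hx; case: (max0P (w l x)) => -[// wx -> _]; lra.
Qed.

Lemma vanishing_decreasing_measure (F : nat -> set X) : (forall i, measurable (F i)) ->
  (forall i, F i `<=` Omega) -> (forall i, F i.+1 `<=` F i) ->
  m.-negligible (\bigcap_i F i) -> forall e : R, 0 < e -> exists i, (m (F i) < e%:E)%E.
Proof.
move=> mF FO Fd Fneg e e0.
have mI : measurable (\bigcap_i F i) by apply: bigcap_measurable => // i _.
have niF : nonincreasing_seq F by apply/nonincreasing_seqP => i; apply/subsetPset; exact: Fd.
have := @nonincreasing_cvg_mu _ X _ m F (Omega_fin Omega_cube (mF 0%N) (FO 0%N)) mF mI niF.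
rewrite [X in _ --> X](_ : _ = 0%E); last by apply/(negligibleP m mI).
by move=> /ecvg0_lt/(_ e0)[i iP]; exists i; exact: (iP i (leqnn i)).
Qed.

(** The bad set for k < l consists of three small parts: a thin slab between the two
    planes, the points of the cap where w_l is small (few, as w_l is locally bounded
    away from 0), and the points where w_k differs much from w_l (few, by
    Markov's inequality). *)
Lemma good_open l : 0 < l -> good l -> exists2 d, 0 < d &
  forall k, 0 < k -> l - d < k -> k <= l -> good k.
Proof.
move=> l0 gl.
have [delta d0 wmp] := weak_maximum_principle jP oOmega Omega_cube uP L_ge0.
have d3 : 0 < delta / 3 by rewrite divr_gt0.
have mO : measurable (Omega : set X) := open_measurable_rV oOmega.
have mw := measurable_refl_diff jP uP l.
(* the slab between the two hyperplanes *)
pose A (i : nat) : set X := Omega `&` [set x : X | l - i.+1%:R^-1 < hd (x : V)]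
  `\` [set x : X | l < hd (x : V)].
have mA i : measurable (A i).
  by apply: measurableD; [apply: measurableI => //|]; exact: half_space_measurable.
have dec i : i.+2%:R^-1 <= i.+1%:R^-1 :> R by rewrite lef_pV2 ?posrE// ler_nat.
have [i1 Ai1] : exists i, (m (A i) < (delta / 3)%:E)%E.
  apply: vanishing_decreasing_measure => //.
  - by move=> i x [[]].
  - move=> i x [[Ox /= lx] nx]; split => //; split => //=.
    by apply: le_lt_trans lx; rewrite lerD2l lerN2.
  - apply: negligibleS (@hyperplane_ae R n l) => x Ax /=; apply; apply/eqP.
    have [_ /negP nx] := Ax 0%N I; rewrite eq_le leNgt nx/= leNgt; apply/negP => xl.
    pose i := Num.truncn (l - hd x)^-1.
    have [[_ /= lx] _] := Ax i I.
    have : i.+1%:R^-1 < l - hd x by rewrite invf_plt ?posrE ?subr_gt0//; exact: truncnS_gt.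
    by move: lx; rewrite ltrBlDr -ltrBlDl => lx /(lt_trans lx); rewrite ltxx.
(* the part of the cap where the limit difference is small *)
pose B (i : nat) : set X := Omega `&` [set x : X | l < hd (x : V)] `&`
  (w l @^-1` `]-oo, i.+1%:R^-1[).
have mB i : measurable (B i).
  apply: measurableI; first by apply: measurableI => //; exact: half_space_measurable.
  by rewrite -[X in measurable X]setTI; exact: mw.
have [i2 Bi2] : exists i, (m (B i) < (delta / 3)%:E)%E.
  apply: vanishing_decreasing_measure => //.
  - by move=> i x [[]].
  - move=> i x [Ox /=]; rewrite in_itv/= => wx; split => //=.
    by rewrite in_itv/= (lt_le_trans wx).
  - pose U := Omega `&` [set x : V | l < hd x].
    have UB : \bigcap_i B i `<=` U `&` \bigcap_i B i.
      by move=> x Bx; split => //; have [[]] := Bx 0%N I.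
    apply: (@negligibleS _ X R m _ _ UB); apply: negligible_locally => x [Ox lx].
    have [rho [c [rho0 c_gt0 wc]]] := strong_maximum_principle l0 gl Ox lx.
    exists rho => //; apply: negligibleS wc => y [xy By] /= /(_ xy) cw.
    pose i := Num.truncn c^-1.
    have [_ /=] := By i I; rewrite in_itv/= => wi.
    have : i.+1%:R^-1 < c by rewrite invf_plt ?posrE//; exact: truncnS_gt.
    by move=> /(lt_trans wi); rewrite ltNge cw.
have eta0 : 0 < delta / 4 * i2.+1%:R^-1 by rewrite mulr_gt0 ?invr_gt0 ?divr_gt0.
have [d' d'0 kd] := refl_diff_continuous l eta0.
exists (Num.min d' i1.+1%:R^-1); first by rewrite lt_min d'0/= invr_gt0.
move=> k k0 lk kl; apply: wmp => //.
have [kld' kli] : l - k < d' /\ l - k < i1.+1%:R^-1.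
  by apply/andP; rewrite -lt_min ltrBlDl -ltrBlDr.
have kld : `|k - l| < d' by rewrite distrC ger0_norm// subr_ge0.
have [iD Dle] := kd k kld.
pose E : set X := [set x : X | i2.+1%:R^-1 <= `|w k x - w l x|].
have mwk := measurable_refl_diff jP uP k.
have mE : measurable E.
  have := intble_measurable iD measurableT (measurable_itv `[i2.+1%:R^-1, +oo[).
  by rewrite setTI; congr measurable; apply/seteqP; split => x; rewrite /E/= in_itv/= andbT.
have mEle : (m E < (delta / 3)%:E)%E.
  apply: (@le_lt_trans _ _ (delta / 4)%:E); last by rewrite lte_fin; lra.
  have i20 : (0 < (i2.+1%:R^-1 : R)%:E)%E by rewrite lte_fin invr_gt0.
  rewrite -(@lee_pmul2r _ (i2.+1%:R^-1)%:E)//.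
  rewrite -EFinM; apply: (@le_trans _ _ (\int[m]_x `|w k x - w l x|)%:E); last by rewrite lee_fin.
  rewrite EFin_Rintegral//.
  have -> : (m E * (i2.+1%:R^-1)%:E = \int[m]_x (i2.+1%:R^-1 * \1_E x)%:E)%E.
    under eq_integral do rewrite EFinM.
    rewrite ge0_integralZl//; last by apply: measurable_EFin; exact: measurable_indic.
    by rewrite (integral_indic _ measurableT mE) setIT muleC.
  apply: le_int.
  - by apply: measurable_funM => //; exact: measurable_indic.
  - exact: intble_measurable iD.
  - by move=> x; rewrite mulr_ge0// invr_ge0.
  - move=> x; rewrite indicE; case: (boolP (x \in E)) => [/set_mem|_].
      by rewrite mulr1.
    by rewrite mulr0.
apply: (@le_lt_trans _ _ (m (A i1) + m (B i2) + m E)%E); last first.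
  rewrite (_ : delta = delta / 3 + delta / 3 + delta / 3); last by lra.
  by rewrite !EFinD lteD// lteD.
apply: (@le_trans _ _ (m (A i1 `|` B i2 `|` E))).
  apply: le_measure; rewrite ?inE.
  - exact: (measurable_bad_set jP oOmega uP).
  - by apply: measurableU => //; exact: measurableU.
  move=> x [Ox kx wx]; have [lx|xl] := ltP l (hd x); last first.
    left; left; split; last by apply/negP; rewrite -leNgt.
    split => //=; apply: lt_trans kx; rewrite ltrBlDl addrC -ltrBlDl; exact: kli.
  have [wl|wl] := ltP (w l x) i2.+1%:R^-1.
    by left; right; split => //=; rewrite in_itv.
  right; rewrite /E /= distrC; apply: le_trans (ler_norm _).
  by apply: (le_trans wl); rewrite lerBrDr gerDl ltW.
apply: (le_trans (measureU2 _ _ _)) => //; first exact: measurableU.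
by apply: leeD2r; exact: measureU2.
Qed.

(** If the infimum of the l beyond which all planes are good were positive, it
    would be good itself by closedness, and openness would lower it. *)
Lemma good_all l : 0 < l -> good l.
Proof.
pose S := [set l : R | 0 < l /\ forall k, l <= k -> good k].
have S0 : S (`|c0| + 1).
  split=> [|k ck]; first by rewrite ltr_wpDl.
  apply/aeW => x kx; apply: (refl_diff_out uP) => /Omega_cube/(_ ord0).
  have := ler_norm c0; have := ler_norm (x ord0 ord0); rewrite -/(hd x).
  by move=> *; lra.
have infS : has_inf S.
  by split; [exists (`|c0| + 1)|exists 0 => t [/ltW]].
have above k : inf S < k -> good k.
  move=> Sk; have ki : 0 < k - inf S by rewrite subr_gt0.
  have [t [t0 tg] tk] := inf_adherent ki infS.
  by apply: tg; rewrite addrC subrK in tk; exact: ltW.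
have inf_ge0 : 0 <= inf S by apply: lb_le_inf; [exists (`|c0| + 1)|move=> t [/ltW]].
have [inf0|inf0] := eqVneq (inf S) 0.
  by move=> l0; apply: above; rewrite inf0.
have inf_gt0 : 0 < inf S by rewrite lt_def inf0.
have [d d0 gd] := good_open inf_gt0 (good_closed inf_ge0 above).
pose t := Num.max (inf S - d / 2) (inf S / 2).
have t0 : 0 < t by rewrite lt_max [X in _ || X]divr_gt0// orbT.
have tinf : t < inf S by rewrite gt_max; apply/andP; split; lra.
have St : S t.
  split=> // k tk; have [ki|ki] := leP k (inf S); last exact: above.
  apply: gd => //; first exact: lt_le_trans tk.
  apply: lt_le_trans tk; rewrite lt_max; apply/orP; left; lra.
by have := ge_inf infS.2 St; rewrite leNgt tinf.
Qed.

Lemma good0 : good 0.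
Proof. by apply: good_closed => // k; exact: good_all. Qed.

End moving_planes.

(** * Integration with respect to the completion *)

Section completion_integral.
Context d (T : measurableType d) (R : realType).
Variable m : {sigma_finite_measure set T -> \bar R}.
Local Notation C := (caratheodory_type m^*%mu).
Local Notation mc := (@completed_measure_extension _ _ _ m).
Local Open Scope ereal_scope.

Lemma completion_measurable_id : measurable_fun [set: C] (fun x : C => x : T).
Proof. by move=> _ A mA; rewrite setTI; exact: measurable_completion. Qed.

Lemma completion_measurable d' (T' : measurableType d') (F : T -> T') :
  measurable_fun [set: T] F -> measurable_fun [set: C] (F : C -> T').
Proof. by move=> mF; exact: (measurableT_comp mF completion_measurable_id). Qed.

Lemma ge0_completion_integral (F : T -> \bar R) : measurable_fun [set: T] F ->
  (forall x, 0 <= F x) -> \int[mc]_x F x = \int[m]_x F x.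
Proof.
move=> mF F0; transitivity (\int[pushforward mc (fun x : C => x : T)]_x F x).
  by rewrite (ge0_integral_pushforward completion_measurable_id).
apply: eq_measure_integral => [|mid A mA _]; first exact: completion_measurable_id.
exact: (completionE m mA).
Qed.

Lemma completion_integral (F : T -> \bar R) : measurable_fun [set: T] F ->
  \int[mc]_x F x = \int[m]_x F x.
Proof.
move=> mF; rewrite integralE [RHS]integralE; congr (_ - _).
  by apply: (ge0_completion_integral (F := F^\+)) => //; exact: measurable_funepos.
by apply: (ge0_completion_integral (F := F^\-)) => //; exact: measurable_funeneg.
Qed.

Lemma completion_ae_measurable (F : C -> \bar R) (G : T -> \bar R) :
  measurable_fun [set: T] G -> {ae m, forall x, F x = G x} ->
  measurable_fun [set: C] F.
Proof.
move=> mG /completion_ae FG.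
apply: (@ae_measurable_fun _ C R mc _ _ (G : C -> \bar R)).
- exact: measure_is_complete_caratheodory.
- by apply: filterS FG => x /= -> _.
- exact: completion_measurable.
Qed.

Lemma completion_integral_ae (F : C -> \bar R) (G : T -> \bar R) :
  measurable_fun [set: T] G -> {ae m, forall x, F x = G x} ->
  \int[mc]_x F x = \int[m]_x G x.
Proof.
move=> mG FG; rewrite -completion_integral//; apply: ae_eq_integral => //.
- exact: (completion_ae_measurable mG).
- exact: completion_measurable.
- by move/completion_ae : FG; apply: filterS => x /= -> _.
Qed.

Lemma completion_integrable (F : C -> \bar R) (G : T -> \bar R) :
  measurable_fun [set: T] G -> {ae m, forall x, F x = G x} ->
  mc.-integrable [set: C] F <-> m.-integrable [set: T] G.
Proof.
move=> mG FG.
have E : \int[mc]_x `|F x| = \int[m]_x `|G x|.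
  apply: (@completion_integral_ae (fun x => `|F x|)); first exact: measurableT_comp.
  move/completion_ae : FG => FG; apply/completion_ae.
  by apply: filterS FG => x ->.
split => /integrableP[mF Foo]; apply/integrableP; split => //.
- by rewrite -E.
- exact: (completion_ae_measurable mG).
- by rewrite E.
Qed.

Lemma completion_borel_version (g : C -> R) : measurable_fun [set: C] g ->
  exists2 G : T -> R, measurable_fun [set: T] G & {ae m, forall x, g x = G x}.
Proof.
move=> /completion_measurable_fun[N [mN N0 mG]].
exists (fun x => if x \in N then 0%R else g x) => //.
exists N; split => // x /=; case: ifPn => [/set_mem//|_] /(_ erefl) [].
Qed.

End completion_integral.

(** * A Borel version of the kernel *)

Lemma ge0_integral_splitC d (T : measurableType d) (R : realType)
    (mu : {measure set T -> \bar R}) (D : set T) (F : T -> \bar R) :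
  measurable D -> measurable_fun [set: T] F -> (forall x, 0 <= F x)%E ->
  (\int[mu]_x F x = \int[mu]_(x in ~` D) F x + \int[mu]_(x in D) F x)%E.
Proof.
move=> mD mF F0; rewrite -[in LHS](setvU D).
rewrite ge0_integral_setU ?setvU//; first exact: measurableC.
by apply/disj_setPS => z [].
Qed.

Lemma ge0_le_integral_in d (T : measurableType d) (R : realType)
    (mu : {measure set T -> \bar R}) (D : set T) (F G : T -> R) :
  measurable D -> measurable_fun [set: T] F -> measurable_fun [set: T] G ->
  (forall x, 0 <= F x) -> (forall x, D x -> F x <= G x) ->
  (\int[mu]_(x in D) (F x)%:E <= \int[mu]_(x in D) (G x)%:E)%E.
Proof.
move=> mD mF mG F0 FG; apply: ge0_le_integral => //.
- by move=> z _; rewrite lee_fin.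
- by apply: measurable_funTS; exact: measurable_EFin.
- by apply: measurable_funTS; exact: measurable_EFin.
Qed.

Section lebesgue_to_borel.
Variables (R : realType) (n : nat).
Local Notation V := 'rV[R]_n.+1.
Local Notation X := (borel_rV R n.+1).
Local Notation m := (borel_lebesgue R n.+1).
Local Notation P := (m \x m)%E.
Local Notation LN := (lebesgue_rV R n.+1).
Local Notation mu := (@lebesgue R n.+1).
Implicit Types (x y : V).

Lemma borel_lebesgue_measurable (F : X -> R) : measurable_fun [set: X] F ->
  measurable_fun [set: LN] (F : LN -> R).
Proof. exact: (@completion_measurable _ X R m _ _ F). Qed.

Lemma lebesgue_integral_borel (F : X -> \bar R) : measurable_fun [set: X] F ->
  (\int[mu]_x F x = \int[m]_x F x)%E.
Proof. exact: (@completion_integral _ X R m F). Qed.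

Lemma lebesgue_integral_ae (F : LN -> \bar R) (G : X -> \bar R) :
  measurable_fun [set: X] G -> {ae m, forall x : X, F x = G x} ->
  (\int[mu]_x F x = \int[m]_x G x)%E.
Proof. exact: (@completion_integral_ae _ X R m F G). Qed.

Lemma lebesgue_integrable (F : LN -> \bar R) (G : X -> \bar R) :
  measurable_fun [set: X] G -> {ae m, forall x : X, F x = G x} ->
  mu.-integrable [set: LN] F <-> m.-integrable [set: X] G.
Proof. exact: (@completion_integrable _ X R m F G). Qed.

Lemma lebesgue_ae (Q : V -> Prop) :
  {ae mu, forall x : LN, Q x} <-> {ae m, forall x : X, Q x}.
Proof. exact: (@completion_ae _ X R m Q). Qed.

Lemma lebesgue_borel_version (g : LN -> R) : measurable_fun [set: LN] g ->
  exists2 G : X -> R, measurable_fun [set: X] G & {ae m, forall x : X, g x = G x}.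
Proof. exact: (@completion_borel_version _ X R m g). Qed.

Section kernel.
Variable J : V -> R.
Hypotheses (hJ : even_kernel J) (hJ1 : condJ1 J) (hJ2 : condJ2' J).

Lemma neq0_hd_tl x y : tl y = tl x -> `|hd x| <= `|hd y| -> x != 0 -> y != 0.
Proof.
move=> txy hxy; apply: contra => /eqP y0; move: txy hxy; rewrite y0 => tx.
rewrite [hd 0]mxE normr0 normr_le0 => /eqP hx.
by apply/eqP; apply: rV_ext; [rewrite hx /hd mxE|rewrite -tx].
Qed.

Lemma kernel_le x y : x != 0 -> tl y = tl x -> `|hd x| <= `|hd y| -> J y <= J x.
Proof.
move=> x0 txy hxy; rewrite -(cons_hd_tl x) -(cons_hd_tl y) txy; apply: hJ2.1 => //.
by rewrite cons_hd_tl.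
Qed.

(** The strict monotonicity compares points with |x_1| below r0; a point y beyond
    that range is reached through the intermediate point whose first coordinate
    is min(|y_1|, r0). *)
Lemma kernel_lt : exists2 r0 : R, 0 < r0 & forall x y, x != 0 -> tl y = tl x ->
  `|hd x| < `|hd y| -> `|hd x| < r0 -> enorm (tl x) <= r0 -> J y < J x.
Proof.
have [r0 r00 Jlt] := hJ2.2; exists r0 => // x y x0 txy hxy xr tr.
pose s := Num.min `|hd y| r0.
have xs : `|hd x| < s by rewrite lt_min hxy.
have sE : `|s| = s by rewrite ger0_norm// ltW// (le_lt_trans _ xs).
have J1 : J (cons_rV s (tl x)) < J x.
  rewrite -[X in _ < J X](cons_hd_tl x); apply: Jlt => //; rewrite ?sE// ?cons_hd_tl//.
  by rewrite ge_min lexx orbT.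
apply: le_lt_trans J1; apply: kernel_le.
- apply: (@neq0_hd_tl x) => //; first by rewrite tl_cons_rV.
  by rewrite hd_cons_rV sE ltW.
- by rewrite tl_cons_rV.
- by rewrite hd_cons_rV sE ge_min lexx.
Qed.

Lemma neq0_ae : {ae m, forall x : X, (x : V) != 0}.
Proof.
apply: negligibleS (@hyperplane_ae R n 0) => x /= /negP; rewrite negbK => /eqP ->.
by apply; rewrite /hd mxE.
Qed.

Lemma measurable_unit_ball : measurable (@unit_ball R n : set X).
Proof.
rewrite (_ : @unit_ball R n = (fun x : X => enorm (x : V) ^+ 2) @^-1` `]-oo, 1[).
  rewrite -[X in measurable X]setTI; apply: (@measurable_enorm_sqr R n) => //.
apply/seteqP; split => x; rewrite /unit_ball/= in_itv/= expr_lt1// sqrtr_ge0//.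
Qed.

Lemma enorm0 : enorm (0 : V) = 0.
Proof. by rewrite /enorm big1 ?sqrtr0// => i _; rewrite mxE expr0n. Qed.

(** The kernel is replaced by 0 on a Borel null set N outside which it is Borel. N is
    made invariant under x |-> - x and the flip of x_1, so that the symmetries
    hold everywhere; monotonicity survives at z outside N, since lowering the
    value at the other point is harmless. *)
Lemma kernel_borel_version : exists j r0,
  [/\ 0 < r0, kernel_spec j r0 & {ae m, forall x : X, J x = j x}].
Proof.
have [mJ J0 JN] := hJ; have [r0 r00 Jlt] := kernel_lt.
pose g (x : V) := if x == 0 then 0 else J x.
have gJ x : x != 0 -> g x = J x by rewrite /g => /negbTE ->.
have g0 x : 0 <= g x by rewrite /g; case: eqVneq => // x0; exact: J0.
have m0 : measurable ([set~ 0] : set X).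
  apply: open_measurable_rV; apply: closed_openC.
  by apply: accessible_closed_set1; apply: hausdorff_accessible; exact: norm_hausdorff.
have gE : g = (J : LN -> R) \_ [set~ 0].
  apply/funext => x; rewrite patchE /g; case: eqVneq => [->|x0].
    by rewrite memNset// => /(_ erefl).
  by rewrite mem_set//; exact/eqP.
have mg : measurable_fun [set: LN] g.
  rewrite gE; apply: (measurable_restrictT _ _).1 => //; exact: measurable_completion.
have [N0 [mN0 N00 mgN]] := completion_measurable_fun mg.
pose fl := refl (0 : R) : V -> V.
have flN x : fl (- x) = - fl x.
  by apply: rV_ext; rewrite /fl !hdtlE//; ring.
pose N := [set x : V | [\/ N0 x, N0 (- x), N0 (fl x) | N0 (- fl x)]].
pose opp := fun x : X => (- (x : V)) : X.
have NE : N = N0 `|` opp @^-1` N0 `|` fl @^-1` N0 `|` (fl @^-1` (opp @^-1` N0)).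
  apply/seteqP; split => x; first by case => h; [left; left; left|left; left; right|left; right|right].
  by move=> [[[h|h]|h]|h]; [exact: Or41|exact: Or42|exact: Or43|exact: Or44].
have mo := @measurable_opp R n; have mf := @measurable_refl R n 0.
have mN1 : measurable (opp @^-1` N0) by rewrite -[X in measurable X]setTI; exact: mo.
have mN : measurable (N : set X).
  rewrite NE; apply: measurableU; last by rewrite -[X in measurable X]setTI; exact: mf.
  apply: measurableU; last by rewrite -[X in measurable X]setTI; exact: mf.
  exact: measurableU.
have negN : m.-negligible N.
  have n0 : m.-negligible N0 by exact/negligibleP.
  have n1 : m.-negligible (opp @^-1` N0).
    exact: (preserving_negligible mo (@opp_preserving R n)).
  rewrite NE; apply: negligibleU; last exact: (preserving_negligible mf (@refl_preserving R n 0)).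
  apply: negligibleU; last exact: (preserving_negligible mf (@refl_preserving R n 0)).
  exact: negligibleU.
have NN x : N (- x) <-> N x.
  by rewrite /N/= flN !opprK; split => -[]; do 1?[exact: Or41|exact: Or42|exact: Or43|exact: Or44].
have Nfl x : N (fl x) <-> N x.
  have flK : fl (fl x) = x by exact: reflK.
  by rewrite /N/= flK; split => -[]; do 1?[exact: Or41|exact: Or42|exact: Or43|exact: Or44].
pose j (x : X) : R := \1_(~` N) x * g x.
have j_le x : j x <= g x by rewrite /j indicE; case: (_ \in _); rewrite ?mul1r ?mul0r.
have j0 x : 0 <= j x by rewrite mulr_ge0.
have jE x : ~ N x -> j x = g x by move=> nN; rewrite /j indicE mem_set ?mul1r.
have mj : measurable_fun [set: X] j.
  rewrite (_ : j = fun x => \1_(~` N) x * (if x \in N0 then 0 else g x)).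
    by apply: measurable_funM => //; apply: measurable_indic; exact: measurableC.
  apply/funext => x; rewrite /j; case: ifPn => // /set_mem xN.
  by rewrite indicE memNset ?mul0r// => /(_ (Or41 _ _ _ xN)).
have aeN : {ae m, forall x : X, ~ N x /\ (x : V) != 0}.
  apply: ae_and; last exact: neq0_ae.
  by apply: negligibleS negN => x /= /contrapT.
have aeJ : {ae m, forall x : X, J x = j x}.
  by apply: filterS aeN => x [xN x0]; rewrite jE// gJ.
have aeg : {ae m, forall x : X, g x = j x}.
  by apply: filterS aeN => x [xN x0]; rewrite jE.
exists j, r0; split => //; split => //.
- move=> z; rewrite /j !indicE; congr (_ * _).
    congr (nat_of_bool _)%:R; apply/idP/idP => /set_mem h; apply/mem_set => Nz; apply: h; exact/NN.
  by rewrite /g oppr_eq0; case: eqVneq => // z0; exact: JN.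
- move=> z; rewrite /j !indicE; congr (_ * _).
    congr (nat_of_bool _)%:R; apply/idP/idP => /set_mem h; apply/mem_set => Nz; apply: h; exact/Nfl.
  have [->|z0] := eqVneq z 0.
    suff -> : refl 0 (0 : V) = 0 by [].
    by apply: rV_ext; rewrite ?tl_refl// hd_refl /hd mxE mulr0 subr0.
  have hz : `|hd (refl 0 z)| = `|hd z| by rewrite hd_refl mulr0 sub0r normrN.
  have rz0 : refl 0 z != 0 by apply: (neq0_hd_tl (x := z)); rewrite ?tl_refl ?hz.
  by rewrite !gJ//; apply/le_anti/andP; split; apply: kernel_le; rewrite ?tl_refl ?hz.
- apply: filterS aeN => z [zN z0] z' tz hz; rewrite [leRHS]jE//.
  have z'0 : z' != 0 by exact: (@neq0_hd_tl z).
  by apply: (le_trans (j_le _)); rewrite !gJ//; exact: kernel_le.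
- apply: filterS aeN => z [zN z0] z' tz hz hr tr; rewrite [ltRHS]jE//.
  have z'0 : z' != 0 by apply: (@neq0_hd_tl z) => //; exact: ltW.
  by apply: (le_lt_trans (j_le _)); rewrite !gJ//; exact: (Jlt z z').
- have mub : measurable (@unit_ball R n : set LN).
    exact: (measurable_completion m measurable_unit_ball).
  pose F (z : X) := Num.min 1 (enorm (z : V) ^+ 2) * j z.
  have mF : measurable_fun [set: X] F.
    by apply: measurable_funM => //; apply: measurable_minr => //; exact: measurable_enorm_sqr.
  have F0 z : 0 <= F z by rewrite mulr_ge0// le_min ler01 sqr_ge0.
  have mFr : measurable_fun [set: LN] (F : LN -> R) by exact: borel_lebesgue_measurable.
  have mFc := measurable_EFin mFr.
  have mG : measurable_fun [set: LN] (fun z : LN => enorm (z : V) ^+ 2 * g z).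
    apply: measurable_funM => //.
    exact: (borel_lebesgue_measurable (@measurable_enorm_sqr R n)).
  suff : (\int[mu]_z (F z)%:E < +oo)%E.
    by rewrite (lebesgue_integral_borel (measurable_EFin mF)).
  apply: le_lt_trans hJ1.1.
  rewrite (@ge0_integral_splitC _ LN R mu _ _ mub mFc); last by move=> z; rewrite lee_fin.
  apply: leeD.
    rewrite [leRHS](_ : _ = \int[mu]_(z in ~` @unit_ball R n) (g z)%:E)%E.
      apply: (@ge0_le_integral_in _ LN R mu _ F g (measurableC mub) mFr mg F0) => z _.
      by apply: le_trans (j_le z); rewrite -[leRHS]mul1r ler_wpM2r// ge_min lexx.
    apply: eq_integral => z /set_mem nz; rewrite gJ//; apply/eqP => z0; apply: nz.
    by rewrite /unit_ball/= z0 enorm0.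
  rewrite [leRHS](_ : _ = \int[mu]_(z in @unit_ball R n) (enorm (z : V) ^+ 2 * g z)%:E)%E.
    apply: (@ge0_le_integral_in _ LN R mu _ F _ mub mFr mG F0) => z _.
    by apply: ler_pM => //; rewrite ?le_min ?ler01 ?sqr_ge0// ge_min lexx orbT.
  apply: eq_integral => z _; have [z0|z0] := eqVneq z 0; last by rewrite gJ.
  by rewrite z0 enorm0 expr0n !mul0r.
- transitivity (\int[mu]_z (g z)%:E)%E.
    apply/esym; apply: (@lebesgue_integral_ae (fun z : LN => (g z)%:E) (fun z : X => (j z)%:E)).
      exact: measurable_EFin.
    by apply: filterS aeg => z <-.
  rewrite -hJ1.2 [RHS]integral_mkcond; apply: eq_integral => z _.
  rewrite patchE /g; case: eqVneq => [->|z0]; first by rewrite memNset// => /(_ erefl).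
  by rewrite mem_set//; exact/eqP.
Qed.

End kernel.
End lebesgue_to_borel.

(** * The energy form on Borel versions *)

Section weak_form.
Variables (R : realType) (n : nat).
Local Notation V := 'rV[R]_n.+1.
Local Notation X := (borel_rV R n.+1).
Local Notation m := (borel_lebesgue R n.+1).
Local Notation P := (m \x m)%E.
Local Notation LN := (lebesgue_rV R n.+1).
Local Notation mu := (@lebesgue R n.+1).
Implicit Types (x y : V).

Variables (j : X -> R) (r0 : R) (J : V -> R).
Hypothesis jP : kernel_spec j r0.
Hypothesis jJ : {ae m, forall x : X, J x = j x}.

(** The kernel is even, so the inner variable may be put in second place, where
    the integral over the first variable of the product is the outer one. *)
Lemma energy_section (u v : V -> R) (u0 v0 : X -> R) (y : X) :
  measurable_fun [set: X] u0 -> measurable_fun [set: X] v0 ->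
  {ae m, forall x : X, u x = u0 x} -> {ae m, forall x : X, v x = v0 x} ->
  u y = u0 y -> v y = v0 y ->
  (\int[mu]_x ((u x - u y) * (v x - v y) * J ((x : V) - (y : V)))%:E =
   \int[m]_x (energy_density j u0 v0 (y, x))%:E)%E.
Proof.
move=> mu0 mv0 uu0 vv0 uy vy.
apply: (@lebesgue_integral_ae R n
  (fun x : LN => ((u x - u y) * (v x - v y) * J ((x : V) - (y : V)))%:E)
  (fun x : X => (energy_density j u0 v0 (y, x))%:E)).
  apply: measurable_EFin; apply: (measurableT_comp (measurable_energy_density jP mu0 mv0)).
  exact: pair1_measurable.
have jy := preserving_ae (@measurable_shift R n.+1 (- y)) (@shift_preserving R n.+1 (- y)) jJ.
move: (ae_and (ae_and uu0 vv0) jy); apply: filterS => x [[ux vx] Jx].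
rewrite /energy_density/= ux vx uy vy [J _]Jx -(kernel_opp jP) opprB.
by congr (_%:E); rewrite -(opprB (u0 x)) -(opprB (v0 x)) mulrNN.
Qed.

Lemma Jform_sections (u v : V -> R) (u0 v0 : X -> R) :
  measurable_fun [set: X] u0 -> measurable_fun [set: X] v0 ->
  {ae m, forall x : X, u x = u0 x} -> {ae m, forall x : X, v x = v0 x} ->
  measurable_fun [set: X] (fun y => \int[m]_x (energy_density j u0 v0 (y, x))%:E)%E ->
  (Jform J u v = (2^-1)%:E * \int[m]_y \int[m]_x (energy_density j u0 v0 (y, x))%:E)%E.
Proof.
move=> mu0 mv0 uu0 vv0 mI; rewrite /Jform; congr (_ * _)%E.
apply: (@lebesgue_integral_ae R n
  (fun y : LN => \int[mu]_x ((u x - u y) * (v x - v y) * J ((x : V) - (y : V)))%:E)%E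
  (fun y : X => \int[m]_x (energy_density j u0 v0 (y, x))%:E)%E mI).
move: (ae_and uu0 vv0); apply: filterS => y [uy vy]; exact: energy_section.
Qed.

Lemma Jform_energy (u : V -> R) (u0 : X -> R) : measurable_fun [set: X] u0 ->
  {ae m, forall x : X, u x = u0 x} ->
  (Jform J u u = (2^-1)%:E * \int[P]_z (energy_density j u0 u0 z)%:E)%E.
Proof.
move=> mu0 uu0; have mE := measurable_energy_density jP mu0 mu0.
have E0 z : 0 <= energy_density j u0 u0 z := energy_density_ge0 jP u0 z.
rewrite (tonelli1 mE E0); apply: Jform_sections => //.
apply: (@measurable_fun_fubini_tonelli_F _ _ X X R m (fun z => (energy_density j u0 u0 z)%:E)).
- exact: measurable_EFin.
- by move=> z; rewrite lee_fin.
Qed.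

Lemma Jform_form (u v : V -> R) (u0 v0 : X -> R) :
  fin_energy j u0 -> fin_energy j v0 ->
  {ae m, forall x : X, u x = u0 x} -> {ae m, forall x : X, v x = v0 x} ->
  Jform J u v = (2^-1 * form j u0 v0)%:E.
Proof.
move=> fu fv uu0 vv0; have iE := energy_density_intble jP fu fv.
have [mu0 _] := fu; have [mv0 _] := fv.
rewrite EFinM /form (EFin_Rintegral iE).
rewrite -(@integral12_prod_meas1 _ _ X X R m m _ iE); apply: Jform_sections => //.
exact: (@measurable_fubini_F _ _ X X R m m _ iE).
Qed.

Lemma form_domain_fin_energy (Omega : set V) (u : V -> R) (u0 : X -> R) :
  form_domain J Omega u -> measurable_fun [set: X] u0 ->
  {ae m, forall x : X, u x = u0 x} -> fin_energy j u0.
Proof.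
move=> [_ Joo _] mu0 uu0; split => //; move: Joo; rewrite (Jform_energy mu0 uu0).
rewrite lte_pdivrMl// gt0_muley ?lte_fin// => Joo.
apply: ge0_intble => //; last exact: energy_density_ge0 jP u0.
exact: (measurable_energy_density jP).
Qed.

Lemma fin_energy_form_domain (Omega : set V) (phi : X -> R) : fin_energy j phi ->
  {ae m, forall x : X, ~ Omega x -> phi x = 0} -> form_domain J Omega phi.
Proof.
move=> fphi phi0; have [mphi iphi] := fphi; split.
- exact: borel_lebesgue_measurable.
- by rewrite (Jform_form fphi fphi) ?ltry//; exact: aeW.
- exact/lebesgue_ae.
Qed.

End weak_form.

(** * From the equation to the reflected inequality *)

Lemma intble_ae_eq d (T : measurableType d) (R : realType)
    (mu : {measure set T -> \bar R}) (F G : T -> R) :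
  measurable_fun [set: T] F -> intble mu G -> {ae mu, forall x, F x = G x} ->
  intble mu F.
Proof.
move=> mF iG FG; apply/integrableP; split; first exact: measurable_EFin.
rewrite (ae_eq_integral (fun x => `|(G x)%:E|)%E) //; first by case/integrableP : iG.
- by apply: measurableT_comp => //; exact: measurable_EFin.
- by apply: measurableT_comp => //; exact: measurable_int iG.
- by apply: filterS FG => x /= -> _.
Qed.

Section weak_solutions.
Variables (R : realType) (n : nat).
Local Notation V := 'rV[R]_n.+1.
Local Notation X := (borel_rV R n.+1).
Local Notation m := (borel_lebesgue R n.+1).
Local Notation LN := (lebesgue_rV R n.+1).
Local Notation mu := (@lebesgue R n.+1).
Implicit Types (x y : V).

Variables (j : X -> R) (r0 : R).
Hypothesis jP : kernel_spec j r0.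
Variables (Omega : set V) (f : V -> R -> R).
Hypothesis oOmega : open Omega.
Hypothesis Omega_sym : forall x (s : R), Omega x -> -1 <= s <= 1 ->
  Omega (cons_rV (s * hd x) (tl x)).

(** The equation on Borel functions. A is a Borel version of the reaction term
    f(x, u x) psi(x) extended by 0, and the factor 2 accounts for the form being
    twice the energy form of the problem. *)
Definition weak_solution (u : X -> R) := forall psi : X -> R,
  fin_energy j psi -> {ae m, forall x : X, ~ Omega x -> psi x = 0} ->
  exists A : X -> R, [/\ intble m A,
    {ae m, forall x : X, A x = if x \in Omega then f x (u x) * psi x else 0} &
    form j u psi = 2 * \int[m]_x A x].

Lemma solution_weak_solution (J : V -> R) (u : V -> R) (u0 : X -> R) :
  {ae m, forall x : X, J x = j x} -> solution J Omega f u ->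
  measurable_fun [set: X] u0 -> {ae m, forall x : X, u x = u0 x} ->
  weak_solution u0.
Proof.
move=> jJ [du hu] mu0 uu0 psi fpsi psi0.
have fu0 := form_domain_fin_energy jP jJ du mu0 uu0.
have [iO JE] := hu psi (fin_energy_form_domain jP jJ fpsi psi0).
have mO : measurable (Omega : set LN).
  exact: (measurable_completion m (open_measurable_rV oOmega)).
pose F (x : LN) := if x \in Omega then f x (u x) * psi x else 0.
have FE : (fun x : LN => (f x (u x) * psi x)%:E) \_ Omega = (fun x => (F x)%:E).
  by apply/funext => x; rewrite patchE /F; case: ifP.
have iF : mu.-integrable [set: LN] (fun x => (F x)%:E).
  by rewrite -FE; exact: ((integrable_mkcond _ mO).1 iO).
have mF : measurable_fun [set: LN] F.
  by apply/measurable_EFinP; exact: measurable_int iF.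
have [A mA FA] := lebesgue_borel_version mF.
have FA' : {ae m, forall x : X, (F x)%:E = (A x)%:E} by apply: filterS FA => x ->.
have iA : intble m A by apply/(lebesgue_integrable (measurable_EFin mA) FA').
exists A; split => //.
  move: (ae_and FA uu0); apply: filterS => x [<- <-]; rewrite /F; exact: erefl.
have : Jform J u psi = (2^-1 * form j u0 psi)%:E.
  by apply: (Jform_form jP jJ) => //; exact: aeW.
rewrite JE integral_mkcond FE.
rewrite (lebesgue_integral_ae (measurable_EFin mA) FA') -(EFin_Rintegral iA).
by move=> [->]; rewrite mulrA mulfV// mul1r.
Qed.

Hypothesis f_sym : forall (a : R) x (s : R), Omega x -> -1 <= s <= 1 ->
  f x a <= f (cons_rV (s * hd x) (tl x)) a.

Lemma f_hd x (t a : R) : Omega x -> `|t| <= `|hd x| -> f x a <= f (cons_rV t (tl x)) a.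
Proof. by move=> Ox /cons_rV_scale[s s1 ->]; exact: f_sym. Qed.

Local Notation flip := (refl (0 : R)).

Lemma Omega_flip x : Omega x -> Omega (flip x).
Proof. by move=> Ox; apply: (Omega_hd Omega_sym Ox); rewrite mulr0 sub0r normrN. Qed.

Lemma Omega_flipE x : (flip x \in Omega) = (x \in Omega).
Proof.
apply/idP/idP => /set_mem Ox; apply/mem_set; last exact: Omega_flip.
by rewrite -(reflK 0 x); exact: Omega_flip.
Qed.

Lemma f_flip x a : Omega x -> f (flip x) a = f x a.
Proof.
move=> Ox; apply/le_anti/andP; split.
  rewrite -[X in _ <= f X _](reflK 0 x); apply: f_hd; first exact: Omega_flip.
  by rewrite hd_refl mulr0 sub0r normrN.
by apply: f_hd => //; rewrite mulr0 sub0r normrN.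
Qed.

(** On Omega the function f is invariant under the flip of x_1, because f_hd
    applies in both directions; so the problem is symmetric, and the moving planes
    may come from either side. *)
Lemma weak_solution_flip u : fin_energy j u -> weak_solution u -> weak_solution (u \o flip).
Proof.
move=> fu wu psi fpsi psi0.
have mr := @measurable_refl R n 0; have pr := @refl_preserving R n 0.
have [||A [iA AE fE]] := wu (psi \o flip).
- exact: (fin_energy_refl jP).
- have := preserving_ae mr pr psi0; apply: filterS => x + nO /=; apply => Ofx.
  by apply: nO; rewrite -(reflK 0 x); exact: Omega_flip.
exists (A \o flip); split.
- exact: (preserving_intble mr pr iA).
- have := preserving_ae mr pr AE; apply: filterS => x /= ->.
  rewrite Omega_flipE reflK; case: ifPn => // /set_mem Ox; by rewrite f_flip.
- by rewrite (form_refl jP) // fE (preserving_Rintegral mr pr iA).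
Qed.

Variables (u : X -> R) (M c0 : R).
Hypothesis Omega_cube : Omega `<=` cube c0.
Hypothesis fu : fin_energy j u.
Hypothesis u_ge0 : forall x : X, 0 <= u x.
Hypothesis u_le : forall x : X, u x <= M.
Hypothesis u_out : forall x : X, ~ Omega x -> u x = 0.
Hypothesis u_pos : {ae m, forall x : X, Omega x -> 0 < u x}.
Hypothesis u_sol : weak_solution u.
Variable L : R.
Hypothesis f_lip : forall a b x, 0 <= a <= M -> 0 <= b <= M -> Omega x ->
  `|f x a - f x b| <= L * `|a - b|.

(** Test the equation with phi o r_l and phi. Where phi is positive, r_l x is
    closer to x_1 = 0 than x, so that f(r_l x, u(r_l x)) >= f(x, u(r_l x)), which
    differs from f(x, u x) by at most L |w|. *)
Lemma weak_solution_moving_plane : moving_plane_data j Omega u M (2 * L).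
Proof.
split => // l phi l0 fphi phi0 [B phiB] phi_out.
have mr := @measurable_refl R n l; have pr := @refl_preserving R n l.
have Or x : Omega x -> l < hd x -> `|2 * l - hd x| <= `|hd x|.
  move=> _ lx; rewrite [leRHS]gtr0_norm ?(lt_trans l0)// ler_norml; apply/andP; split; lra.
have phi_outO : {ae m, forall x : X, ~ Omega x -> phi x = 0}.
  by apply: filterS phi_out => x + nO; apply => -[].
have [||A1 [iA1 A1E f1E]] := @u_sol (phi \o refl l).
- exact: (fin_energy_refl jP).
- have := preserving_ae mr pr phi_out; apply: filterS => x + nO /=; apply => -[Orx lx].
  by apply: nO; rewrite -(reflK l x); exact: (Omega_hd Omega_sym Orx (Or _ Orx lx)).
have [A2 [iA2 A2E f2E]] := @u_sol _ fphi phi_outO.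
rewrite /refl_diff (formB jP (fin_energy_refl jP l fu) fu fphi).
rewrite (form_refl jP l fu fphi) f1E f2E -(preserving_Rintegral mr pr iA1).
have iA1' := preserving_intble mr pr iA1.
pose W x := `|refl_diff u l x| * phi x.
have W_le x : `|refl_diff u l x| <= M.
  have := u_ge0 x; have := u_le x; have := u_ge0 (refl l x); have := u_le (refl l x).
  by rewrite /refl_diff ler_norml => *; apply/andP; split; lra.
have mphi : measurable_fun [set: X] phi by case: fphi.
have mu0 : measurable_fun [set: X] u by case: fu.
have mW : measurable_fun [set: X] W.
  apply: measurable_funM => //; apply: measurableT_comp => //.
  by apply: measurable_funB; [exact: (measurableT_comp mu0 mr)|exact: mu0].
have mO : measurable (Omega : set X) := open_measurable_rV oOmega.
have M0 : 0 <= M := le_trans (u_ge0 0) (u_le 0).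
have iW : intble m W.
  apply: (@intble_ae_eq _ _ _ _ _ (fun x : X => W x * \1_Omega x) mW).
    apply: (@intble_bounded_support _ _ _ (Omega : set X) (M * B)) => //.
    - by apply: measurable_funM => //; exact: measurable_indic.
    - exact: (Omega_fin Omega_cube).
    - move=> x; rewrite normrM [X in _ * X]ger0_norm//.
      apply: (@le_trans _ _ `|W x|); last first.
        by rewrite /W normrM normr_id (ger0_norm (phi0 x)) ler_pM.
      by rewrite -[leRHS]mulr1 ler_wpM2l// indicE lern1 leq_b1.
    - by move=> x nO; rewrite indicE memNset// mulr0.
  apply: filterS phi_outO => x Px; rewrite indicE.
  case: (boolP (x \in Omega)) => [_|]; first by rewrite mulr1.
  by rewrite notin_setE => /Px; rewrite /W => ->; rewrite !mulr0.
suff H : \int[m]_x A2 x <= \int[m]_x A1 (refl l x) + L * \int[m]_x W x.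
  rewrite -/W; move: H; move: (\int[m]_x _) (\int[m]_x _) (\int[m]_x _) => a b c; lra.
rewrite -RintegralZl// -RintegralD//; last exact: intbleZ.
apply: le_Rintegral_ae => //; first by apply: intbleD => //; exact: intbleZ.
move: (ae_and (preserving_ae mr pr A1E) (ae_and A2E phi_out)).
apply: filterS => x [E1 [E2 out]]; rewrite E1 E2 /= reflK /W.
have [px|px] := eqVneq (phi x) 0.
  by rewrite px !mulr0 addr0; case: ifP; case: ifP; rewrite lexx.
have [Ox lx] : Omega x /\ l < hd x.
  by apply: contrapT => nO; move: px; rewrite out ?eqxx.
have Orx : Omega (refl l x) by apply: (Omega_hd Omega_sym Ox); exact: Or.
rewrite !mem_set// mulrA -mulrDl ler_wpM2r//.
have h1 : f x (u (refl l x)) <= f (refl l x) (u (refl l x)).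
  by apply: f_hd => //; exact: Or.
have : `|f x (u x) - f x (u (refl l x))| <= L * `|u x - u (refl l x)|.
  by apply: f_lip; rewrite ?u_ge0 ?u_le.
rewrite distrC (distrC (u x)) -/(refl_diff u l x).
rewrite ler_norml => /andP[h2 _]; lra.
Qed.

End weak_solutions.

(** * Symmetry and lower bounds on compact sets *)

Section local_bounds.
Variables (R : realType) (n : nat).
Local Notation V := 'rV[R]_n.+1.
Local Notation X := (borel_rV R n.+1).
Local Notation m := (borel_lebesgue R n.+1).
Implicit Types (x y : V) (g : V -> R).

Lemma bounded_cube (A : set V) : bounded_set A -> exists c, A `<=` cube c.
Proof.
move=> /pinfty_ex_gt0[M M0 AM]; exists (M + 1) => x Ax i.
have M1 : 0 < M + 1 by rewrite addr_gt0.
have : ball (0 : V) (M + 1) x.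
  by rewrite -ball_normE /ball_/= sub0r normrN (le_lt_trans (AM x Ax))// ltrDl.
by move/(ball_rVP _ _ M1) => /(_ i); rewrite mxE sub0r normrN.
Qed.

Definition locally_bounded_below g x0 := exists rho c, [/\ 0 < rho, 0 < c &
  {ae m, forall x : X, ball x0 rho x -> c <= g x}].

Lemma locally_bounded_below_refl g l x0 : locally_bounded_below g (refl l x0) ->
  locally_bounded_below (g \o refl l) x0.
Proof.
move=> [rho [c [rho0 c0 gc]]]; exists rho, c; split => //.
have := preserving_ae (@measurable_refl R n l) (@refl_preserving R n l) gc.
apply: filterS => x /= + xx0; apply.
apply/(ball_rVP _ _ rho0) => i; move/(ball_rVP _ _ rho0) : xx0 => xx0.
case: (unliftP ord0 i) => [h ->|->].
  by rewrite -!tl_coord !tl_refl !tl_coord; exact: xx0.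
rewrite -!/(hd _) !hd_refl (_ : _ - _ = hd x - hd x0); last by ring.
by rewrite distrC; exact: xx0.
Qed.

Lemma compact_bounded_below g (K : set V) : compact K ->
  (forall x0, K x0 -> locally_bounded_below g x0) ->
  exists2 c : R, 0 < c & {ae m, forall x : X, K x -> c <= g x}.
Proof.
move=> cK Kg.
have /choice[rho Hrho] : forall x0, exists r : R, 0 < r /\ (K x0 -> exists2 c : R, 0 < c &
    {ae m, forall x : X, ball x0 r x -> c <= g x}).
  move=> x0; have [Kx0|nK] := pselect (K x0); last by exists 1; split.
  by have [r [c [r0 c0 gc]]] := Kg x0 Kx0; exists r; split => // _; exists c.
have [D' D'K KD'] : finite_subset_cover K (fun x0 => ball x0 (rho x0)) K.
  move: cK; rewrite compact_cover; apply => [x0 _|x0 Kx0]; first exact: ball_open.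
  by exists x0 => //; apply: ballxx; exact: (Hrho x0).1.
have : forall s : seq V, (forall x0, x0 \in s -> K x0) -> exists2 c : R, 0 < c &
    {ae m, forall x : X, (exists2 x0, x0 \in s & ball x0 (rho x0) x) -> c <= g x}.
  elim=> [|x0 s IH] sK; first by exists 1 => //; apply/aeW => x [].
  have [|c c0 gc] := IH; first by move=> y ys; apply: sK; rewrite inE ys orbT.
  have [d d0 gd] := (Hrho x0).2 (sK x0 (mem_head _ _)).
  exists (Num.min c d); first by rewrite lt_min c0.
  move: (ae_and gc gd); apply: filterS => x [xc xd] [y]; rewrite inE => /orP[/eqP ->|ys] xy.
    by rewrite ge_min xd// orbT.
  by rewrite ge_min xc//; exists y.
move=> /(_ (finmap.enum_fset D'))[x0 x0D|c c0 gc]; first by have := D'K _ x0D; rewrite inE.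
by exists c => //; apply: filterS gc => x gx /KD'[y yD xy]; apply: gx; exists y.
Qed.

Lemma ess_inf_on_gt0 g (h : V -> R) (K : set V) : compact K ->
  {ae m, forall x : X, h x = g x} -> (forall x0, K x0 -> locally_bounded_below g x0) ->
  (0 < ess_inf_on K h)%E.
Proof.
move=> cK hg Kg; have [c c0 gc] := compact_bounded_below cK Kg.
apply: (@lt_le_trans _ _ c%:E); first by rewrite lte_fin.
apply/ess_infP; apply/(lebesgue_ae (fun x => (c%:E <= if x \in K then (h x)%:E else +oo)%E)).
move: (ae_and hg gc); apply: filterS => x [-> Kc].
by case: ifPn => [/set_mem /Kc|_]; rewrite ?lee_fin ?leey.
Qed.

Variables (j : X -> R) (r0 : R).
Hypothesis jP : kernel_spec j r0.
Hypothesis r0_gt0 : 0 < r0.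
Variables (Omega : set V) (c0 : R).
Hypothesis oOmega : open Omega.
Hypothesis Omega_cube : Omega `<=` cube c0.
Hypothesis Omega_sym : forall x (s : R), Omega x -> -1 <= s <= 1 ->
  Omega (cons_rV (s * hd x) (tl x)).
Variables (u : X -> R) (M L : R).
Local Notation flip := (refl (0 : R)).
Hypothesis L_ge0 : 0 <= L.
Hypothesis uP : moving_plane_data j Omega u M L.
Hypothesis flipP : moving_plane_data j Omega (u \o flip) M L.

(** At l = 0 the two moving planes give opposite inequalities. *)
Lemma flip_symmetric : {ae m, forall x : X, u (flip x) = u x}.
Proof.
have mr := @measurable_refl R n 0; have pr := @refl_preserving R n 0.
have g1 := good0 jP r0_gt0 oOmega Omega_cube Omega_sym uP L_ge0.
have g2 := good0 jP r0_gt0 oOmega Omega_cube Omega_sym flipP L_ge0.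
have g : {ae m, forall x : X, 0 < hd (x : V) -> u (flip x) = u x}.
  move: (ae_and g1 g2); apply: filterS => x; rewrite /refl_diff/= reflK => -[h1 h2] hx.
  by have := h1 hx; have := h2 hx; lra.
have h0 : {ae m, forall x : X, hd (x : V) <> 0} by exact: hyperplane_ae.
move: (ae_and h0 (ae_and g (preserving_ae mr pr g))); apply: filterS => x [hx [h1 h2]].
have [x0|x0|x0] := ltgtP 0 (hd x); first exact: h1.
by have := h2; rewrite reflK hd_refl mulr0 sub0r oppr_gt0 => /(_ x0) ->.
by case: hx.
Qed.

(** For l < 0 the strong maximum principle is applied to the mirror image of u. *)
Lemma refl_diff_locally_bounded_below l x0 : l != 0 -> Omega x0 -> 1 < hd x0 / l ->
  locally_bounded_below (fun x => u (refl l x) - u x) x0.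
Proof.
move=> l0 Ox0 hx0; have [lp|ln] : 0 < l \/ l < 0 by move: l0; rewrite neq_lt => /orP[]; [right|left].
  move: hx0; rewrite ltr_pdivlMr// mul1r => hx0.
  have gl := good_all jP r0_gt0 oOmega Omega_cube Omega_sym uP L_ge0 lp.
  exact: (strong_maximum_principle jP r0_gt0 oOmega Omega_cube Omega_sym uP L_ge0 lp gl Ox0 hx0).
move: hx0; rewrite ltr_ndivlMr// mul1r => hx0.
have lp : 0 < - l by rewrite oppr_gt0.
have gl := good_all jP r0_gt0 oOmega Omega_cube Omega_sym flipP L_ge0 lp.
have hf : - l < hd (flip x0) by rewrite hd_refl mulr0 sub0r ltrN2.
have := strong_maximum_principle jP r0_gt0 oOmega Omega_cube Omega_sym flipP L_ge0 lp gl
  (Omega_flip Omega_sym Ox0) hf.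
move=> /locally_bounded_below_refl; congr locally_bounded_below.
apply/funext => x; rewrite /refl_diff/= reflK; congr (u _ - _).
by apply: rV_ext; rewrite !hdtlE//; ring.
Qed.

(** Choose a plane slightly further from x_1 = 0 than x0, so that the mirror image
    y0 of x0 is still in Omega; near y0 the function u o r_l exceeds u, which is
    nonnegative, by a positive constant. *)
Lemma solution_locally_bounded_below x0 : Omega x0 -> locally_bounded_below u x0.
Proof.
move=> Ox0; have /nbhs_ballP[e /= e0 xe] := open_nbhs_nbhs (conj oOmega Ox0).
(* the direction that points away from x_1 = 0 *)
pose s : R := if 0 <= hd x0 then 1 else -1.
pose l := hd x0 + s * (e / 4); pose y0 := refl l x0.
have e4 : 0 < e / 4 by rewrite divr_gt0.
have Oy0 : Omega y0.
  apply: xe; apply/(ball_rVP _ _ e0) => i; case: (unliftP ord0 i) => [h ->|->].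
    by rewrite -!tl_coord tl_refl subrr normr0.
  rewrite -!/(hd _) hd_refl /l (_ : _ - _ = - (s * (e / 2))); last by field.
  rewrite normrN normrM /s; case: ifP; rewrite ?normrN1 ?normr1 gtr0_norm; lra.
have [l0 ly0] : l != 0 /\ 1 < hd y0 / l.
  rewrite hd_refl /l /s; case: ifPn => [h|]; last rewrite -ltNge => h.
    have lp : 0 < hd x0 + 1 * (e / 4) by lra.
    by rewrite gt_eqF// ltr_pdivlMr//; split => //; lra.
  have lp : hd x0 + - 1 * (e / 4) < 0 by lra.
  by rewrite lt_eqF// ltr_ndivlMr//; split => //; lra.
have /locally_bounded_below_refl : locally_bounded_below (fun x => u (refl l x)) (refl l x0).
  have [rho [c [rho0 cc0 wc]]] := refl_diff_locally_bounded_below l0 Oy0 ly0.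
  exists rho, c; split => //; apply: filterS wc => x + xx0 => /(_ xx0).
  by have := mp_ge0 uP x; lra.
by congr locally_bounded_below; apply/funext => x; rewrite /= reflK.
Qed.

End local_bounds.

(** * Positive bounded solutions *)

Lemma finite_norm_ae_bounded d (T : measurableType d) (R : realType)
    (mu : {measure set T -> \bar R}) (g : T -> R) :
  finite_norm mu +oo%E g -> exists M, {ae mu, forall x, `|g x| <= M}.
Proof.
rewrite /finite_norm unlock /=; case: ifPn => [_|].
  exact: (@ess_supr_bounded _ _ _ _ (fun x => `|g x|)).
rewrite -leNgt => mu0 _; exists 0, setT; split => //.
by apply/eqP; rewrite eq_le mu0 measure_ge0.
Qed.

(** A Borel version of u, set to 0 wherever its value is not in [0, M] or the point
    is outside Omega; this changes it on a null set only. *)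
Lemma bounded_borel_version (R : realType) (n : nat) (Omega : set 'rV[R]_n.+1)
    (u : 'rV[R]_n.+1 -> R) :
  open Omega -> measurable_fun [set: lebesgue_rV R n.+1] u ->
  finite_norm (lebesgue n.+1) +oo%E u ->
  {ae lebesgue n.+1, forall x, ~ Omega x -> u x = 0} ->
  {ae lebesgue n.+1, forall x, Omega x -> 0 < u x} ->
  exists (u0 : borel_rV R n.+1 -> R) (M : R),
    [/\ measurable_fun [set: borel_rV R n.+1] u0,
        {ae borel_lebesgue R n.+1, forall x : borel_rV R n.+1, u x = u0 x},
        forall x, 0 <= u0 x <= M & forall x, ~ Omega x -> u0 x = 0].
Proof.
move=> oO mu0 ub uO up; have [u1 mu1 uu1] := lebesgue_borel_version mu0.
have [M0 uM0] := finite_norm_ae_bounded ub.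
pose M := Num.max M0 0; have M_ge0 : 0 <= M by rewrite le_max lexx orbT.
have {}uM : {ae lebesgue n.+1, forall x, `|u x| <= M}.
  by apply: filterS uM0 => x; rewrite le_max => ->.
move/(@lebesgue_ae R n (fun x => `|u x| <= M)) : uM => uM.
move/(@lebesgue_ae R n (fun x => ~ Omega x -> u x = 0)) : uO => uO.
move/(@lebesgue_ae R n (fun x => Omega x -> 0 < u x)) : up => up.
pose A : set (borel_rV R n.+1) := Omega `&` (u1 @^-1` `[0, M]).
have mA : measurable A.
  apply: measurableI; first exact: open_measurable_rV.
  by rewrite -[X in measurable X]setTI; apply: mu1 => //; exact: measurable_itv.
exists (fun x => u1 x * \1_A x), M; split.
- by apply: measurable_funM => //; exact: measurable_indic.
- move: (ae_and (ae_and uu1 uM) (ae_and uO up)); apply: filterS => x [[ux xM] [xO xp]].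
  rewrite indicE; have [Ox|nO] := pselect (Omega x); last first.
    by rewrite xO// memNset ?mulr0// => -[].
  rewrite mem_set ?mulr1//; split => //=; rewrite in_itv/= -ux ltW ?xp//=.
  exact: le_trans (ler_norm _) xM.
- move=> x; rewrite indicE; case: (boolP (x \in A)) => [/set_mem[_]|_].
    by rewrite /= in_itv/= mulr1.
  by rewrite mulr0 lexx.
- by move=> x nO; rewrite indicE memNset ?mulr0// => -[].
Qed.

Unset Implicit Arguments.

Theorem theorem1p4 (R : realType) (n : nat) (Omega : set 'rV[R]_n.+1)
    (J : 'rV[R]_n.+1 -> R) (f : 'rV[R]_n.+1 -> R -> R)
    (hD : condD Omega) (hJ : even_kernel J) (hJ1 : condJ1 J) (hJ2 : condJ2' J)
    (hF1 : condF1 Omega f) (hF2 : condF2 Omega f)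
    (u : 'rV[R]_n.+1 -> R)
    (hu : solution J Omega f u)
    (hub : finite_norm (lebesgue n.+1) +oo%E u)
    (hu0 : {ae lebesgue n.+1, forall x, Omega x -> 0 < u x}) :
  [/\ symmetric_x1 Omega u,
      strictly_decreasing_abs_x1 Omega u &
      forall K : set 'rV[R]_n.+1, compact K -> K `<=` Omega ->
        (0 < ess_inf_on K u)%E].
Proof.
have [oO /bounded_cube[c0 Oc0] symO] := hD.
have [j [r0 [r0_gt0 jP jJ]]] := kernel_borel_version hJ hJ1 hJ2.
have [mu uO] : measurable_fun [set: lebesgue_rV R n.+1] u /\
    {ae lebesgue n.+1, forall x, ~ Omega x -> u x = 0} by case: (hu.1).
have [v [M [mv uv v0M v_out]]] := bounded_borel_version oO mu hub uO hu0.
have fv := form_domain_fin_energy jP jJ hu.1 mv uv.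
have v_sol := solution_weak_solution jP oO jJ hu mv uv.
have [L L0 f_lip] : exists2 L : R, 0 < L & forall a b x, 0 <= a <= M -> 0 <= b <= M ->
    Omega x -> `|f x a - f x b| <= L * `|a - b|.
  have bM : bounded_set [set a : R | 0 <= a <= M].
    exists M; split; first exact: num_real.
    move=> t Mt a /= /andP[a0 aM]; rewrite ger0_norm//.
    exact: (le_trans aM (ltW Mt)).
  have [L L0 HL] := hF1.2 _ bM; exists L => // a b x ha hb Ox; exact: HL.
have L2 : 0 <= 2 * L by rewrite mulr_ge0// ltW.
have v_pos : {ae borel_lebesgue R n.+1, forall x : borel_rV R n.+1, Omega x -> 0 < v x}.
  move/(@lebesgue_ae R n (fun x => Omega x -> 0 < u x)) : hu0 => hu0.
  by move: (ae_and uv hu0); apply: filterS => x [<-].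
have v_ge0 x : 0 <= v x by case/andP: (v0M x).
have v_leM x : v x <= M by case/andP: (v0M x).
have vP := weak_solution_moving_plane jP oO symO hF2 Oc0 fv v_ge0 v_leM v_out v_pos v_sol f_lip.
have flip_out x : ~ Omega x -> (v \o refl 0) x = 0.
  by move=> nO; apply: v_out => Of; apply: nO; rewrite -(reflK 0 x); exact: Omega_flip.
have flip_pos : {ae borel_lebesgue R n.+1, forall x : borel_rV R n.+1,
    Omega x -> 0 < (v \o refl 0) x}.
  have := preserving_ae (@measurable_refl R n 0) (@refl_preserving R n 0) v_pos.
  by apply: filterS => x vx Ox; apply: vx; exact: Omega_flip.
have flipP := weak_solution_moving_plane jP oO symO hF2 Oc0 (fin_energy_refl jP 0 fv)
  (fun x => v_ge0 (refl 0 x)) (fun x => v_leM (refl 0 x)) flip_out flip_pos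
  (weak_solution_flip jP symO hF2 fv v_sol) f_lip.
have uv_refl l := preserving_ae (@measurable_refl R n l) (@refl_preserving R n l) uv.
split.
- apply/(@lebesgue_ae R n (fun x => Omega x -> u (cons_rV (- hd x) (tl x)) = u x)).
  have vs := flip_symmetric jP r0_gt0 oO Oc0 symO L2 vP flipP.
  move: (ae_and (ae_and uv (uv_refl 0)) vs); apply: filterS => x [[ux urx] vx] _.
  by rewrite ux -vx -urx /refl mulr0 sub0r.
- move=> l l0 K cK KO.
  apply: (ess_inf_on_gt0 (g := fun x => v (refl l x) - v x)) => // [|x0 /KO[Ox0 hx0]].
    by move: (ae_and uv (uv_refl l)); apply: filterS => x [<- <-].
  exact: (refl_diff_locally_bounded_below jP r0_gt0 oO Oc0 symO L2 vP flipP).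
- move=> K cK KO; apply: (ess_inf_on_gt0 cK uv) => x0 /KO Ox0.
  exact: (solution_locally_bounded_below jP r0_gt0 oO Oc0 symO L2 vP flipP).
Qed.
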